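(* Assume that $u$ is a mild solution to the incompressible Navier–Stokes equations $$u_t-\Delta u+u\cdot\nabla u+\nabla p=0$$ on $[0,1]\times\mathbb R^d$ and that $|u|\le C_2$ in $[0,1]\times\mathbb R^d$ for some constant $C_2$. Then there is a sufficiently large constant $N\ge 1$ such that for every integer $n\ge 1$, $$\sup_{t\in(0,1]}t^n\|\partial_t^n u(t,\cdot)\|_{L_\infty(\mathbb R^d)}\le N^{n+1}n^n.$$ Consequently, $u(t,x)$ is analytic in time for any $t\in(0,1]$.
   Context: Here $u:[0,1]\times\mathbb R^d\to\mathbb R^d$ is divergence free in $x$ (incompressibility). Let $\Gamma(t,x)=(4\pi t)^{-d/2}e^{-|x|^2/(4t)}$ be the heat kernel, $\mathcal P$ the Helmholtz (Leray–Hopf) projection in $\mathbb R^d$ (onto divergence-free fields), and $E=\mathcal P\Gamma$ the (matrix-valued) Stokes–Oseen kernel, i.e. $E_{ij}(t,x)=\delta_{ij}\Gamma(t,x)+\int_t^\infty\partial_i\partial_j\Gamma(s,x)\,ds$. A mild solution is a $u$ satisfying, with $*$ denoting spatial convolution, $$u(t,x)=E(t,x)*u(0,x)-\int_0^t E(t-s,x)*\nabla(u\otimes u)(s,x)\,ds ,$$ where the derivative is put on the kernel by integration by parts and, since $u(0,\cdot)$ is divergence free, $E(t)*u(0,\cdot)$ means $\Gamma(t)*u(0,\cdot)$; componentwise, $$u_i(t,x)=\int_{\mathbb R^d}\Gamma(t,x-y)u_i(0,y)\,dy-\sum_{j,k=1}^d\int_0^t\int_{\mathbb R^d}(\partial_kE_{ij})(t-s,x-y)\,u_j(s,y)u_k(s,y)\,dy\,ds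 .$$ At $t=1$, time derivatives and analyticity are understood one-sidedly (for $t\le 1$). *)

(* Defs.v *)
From HB Require Import structures.
From mathcomp Require Import all_boot all_order all_algebra.
From mathcomp Require Import all_classical all_reals all_analysis.
Set Implicit Arguments. Unset Strict Implicit. Unset Printing Implicit Defensive.
Import Order.TTheory GRing.Theory Num.Theory.
Import numFieldNormedType.Exports.
Local Open Scope classical_set_scope.
Local Open Scope ring_scope.

(* The product (here: Borel) sigma-algebra on matrices, generated by the
   entries; it is the analogue for matrices of the library's n.-tuple one.   *)
Definition measure_matrix_display : measure_display -> measure_display.
Proof. exact. Qed.

Section measurable_matrix.
Context {d} {T : measurableType d}.
Variables m n : nat.

Definition mx_preimages : set (set 'M[T]_(m, n)) :=
  [set B | exists ij : 'I_m * 'I_n, exists2 A : set T, measurable A &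
    B = (fun M : 'M[T]_(m, n) => M ij.1 ij.2) @^-1` A].

Let mx_set0 : <<s mx_preimages >> set0.
Proof. exact: sigma_algebra0. Qed.

Let mx_setC A : <<s mx_preimages >> A -> <<s mx_preimages >> (~` A).
Proof. exact: sigma_algebraC. Qed.

Let mx_bigcup (F : _^nat) : (forall i, <<s mx_preimages >> (F i)) ->
  <<s mx_preimages >> (\bigcup_i (F i)).
Proof. exact: sigma_algebra_bigcup. Qed.

HB.instance Definition _ := @isMeasurable.Build (measure_matrix_display d)
  'M[T]_(m, n) <<s mx_preimages >> mx_set0 mx_setC mx_bigcup.

Lemma measurable_entry (i : 'I_m) (j : 'I_n) :
  measurable_fun [set: 'M[T]_(m, n)] (fun M => M i j).
Proof.
move=> _ A mA; rewrite setTI; apply: sub_sigma_algebra.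
by exists (i, j), A.
Qed.

Lemma measurable_fun_mxP d' (S : measurableType d') (f : S -> 'M[T]_(m, n)) :
  (forall i j, measurable_fun [set: S] (fun x => f x i j)) ->
  measurable_fun [set: S] f.
Proof.
move=> mf; apply: (@measurability _ _ _ _ setT f mx_preimages) => //.
move=> _ [_ [[i j] [A mA ->]] <-].
exact: mf.
Qed.

End measurable_matrix.

Section lebesgue_rV.
Context {R : realType}.

Definition rV_cons n (p : measurableTypeR R * 'rV[R]_n) : 'rV[R]_n.+1 :=
  row_mx (const_mx p.1 : 'rV_1) p.2.

Definition rV_uncons n (x : 'rV[R]_n.+1) : measurableTypeR R * 'rV[R]_n :=
  (x 0 0, rsubmx (x : 'rV[R]_(1 + n))).

Lemma rV_cons0 n (p : measurableTypeR R * 'rV[R]_n) i :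
  rV_cons p i 0 = p.1.
Proof.
have -> : 0 = lshift n (0 : 'I_1) :> 'I_(1 + n) by exact/val_inj.
by rewrite [LHS]row_mxEl mxE.
Qed.

Lemma rV_consS n (p : measurableTypeR R * 'rV[R]_n) i k :
  rV_cons p i (lift 0 k) = p.2 i k.
Proof.
have -> : lift 0 k = rshift 1 k :> 'I_(1 + n) by exact/val_inj.
by rewrite [LHS]row_mxEr.
Qed.

Lemma rV_consK n : cancel (@rV_cons n) (@rV_uncons n).
Proof.
move=> [a y]; rewrite /rV_uncons rV_cons0; congr pair.
exact: row_mxKr.
Qed.

Lemma measurable_rV_cons n : measurable_fun setT (@rV_cons n).
Proof.
apply: measurable_fun_mxP => i j; case: (unliftP 0 j) => [k ->|->].
  rewrite [X in measurable_fun _ X](_ : _ = (fun M : 'rV[R]_n => M i k) \o snd).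
    exact: (measurableT_comp (measurable_entry _ _)).
  by apply/funext => p; rewrite rV_consS.
rewrite [X in measurable_fun _ X](_ : _ = fst)//.
by apply/funext => p; rewrite rV_cons0.
Qed.

Lemma measurable_rV_uncons n : measurable_fun setT (@rV_uncons n).
Proof.
apply: measurable_fun_pair; first exact: measurable_entry.
apply: measurable_fun_mxP => i j.
rewrite (_ : (fun _ => _) = (fun x : 'rV[R]_n.+1 => x i (rshift 1 j))).
  exact: measurable_entry.
by apply/funext => x; rewrite mxE.
Qed.

Section lebesgue_rV_succ.
Variables (n : nat) (mu : {sigma_finite_measure set 'rV[R]_n -> \bar R}).

Definition lebesgue_rV_succ : set 'rV[R]_n.+1 -> \bar R :=
  pushforward (lebesgue_measure \x mu)%E (@rV_cons n).

Let mcons := @measurable_rV_cons n.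

Let lebesgue_rV_succ0 : lebesgue_rV_succ set0 = 0%E.
Proof. exact: measure0. Qed.

Let lebesgue_rV_succ_ge0 A : (0 <= lebesgue_rV_succ A)%E.
Proof. exact: measure_ge0. Qed.

Let lebesgue_rV_succ_sigma_additive : semi_sigma_additive lebesgue_rV_succ.
Proof. exact: measure_semi_sigma_additive. Qed.

HB.instance Definition _ := isMeasure.Build _ _ _ lebesgue_rV_succ
  lebesgue_rV_succ0 lebesgue_rV_succ_ge0 lebesgue_rV_succ_sigma_additive.

Let lebesgue_rV_succ_sigma_finite : sigma_finite setT lebesgue_rV_succ.
Proof.
have /sigma_finiteP[F [TF ndF Foo]] := sigma_finiteT (@lebesgue_measure R).
have /sigma_finiteP[G [TG ndG Goo]] := sigma_finiteT mu.
exists (fun k => @rV_uncons n @^-1` (F k `*` G k)) => [|k].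
  rewrite predeqE => x; split=> // _.
  have [k _ Fk] : (\bigcup_k F k) (rV_uncons x).1 by rewrite -TF.
  have [l _ Gl] : (\bigcup_l G l) (rV_uncons x).2 by rewrite -TG.
  exists (maxn k l) => //; split.
    by move: Fk; exact/subsetPset/ndF/leq_maxl.
  by move: Gl; exact/subsetPset/ndG/leq_maxr.
have [mFk Fkoo] := Foo k; have [mGk Gkoo] := Goo k.
split.
  rewrite -[X in measurable X]setTI; apply: measurable_rV_uncons => //.
  exact: measurableX.
rewrite /lebesgue_rV_succ /pushforward -comp_preimage.
rewrite (_ : _ \o _ = id); last by apply/funext => p /=; rewrite rV_consK.
by rewrite preimage_id product_measure1E// lte_mul_pinfty// ge0_fin_numE.
Qed.

HB.instance Definition _ := Measure_isSigmaFinite.Build _ _ _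
  lebesgue_rV_succ lebesgue_rV_succ_sigma_finite.

End lebesgue_rV_succ.

(* Lebesgue measure on R^n as the n-fold product of the one-dimensional one. *)
Fixpoint lebesgue_rV n : {sigma_finite_measure set 'rV[R]_n -> \bar R} :=
  match n with
  | 0 => dirac (0 : 'rV[R]_0)
  | n.+1 => lebesgue_rV_succ (lebesgue_rV n)
  end.

Lemma lebesgue_rV_box n (A : 'I_n -> set (measurableTypeR R)) :
  (forall i, measurable (A i)) ->
  lebesgue_rV n [set x : 'rV[R]_n | forall i, A i (x 0 i)] =
  (\prod_(i < n) lebesgue_measure (A i))%E.
Proof.
elim: n A => [|n IHn] A mA /=.
  rewrite big_ord0 (_ : [set _ | _] = setT) ?diracT//.
  by apply/seteqP; split=> // x _ [].
rewrite /lebesgue_rV_succ /pushforward big_ord_recl -IHn; last by [].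
have mB : measurable [set x : 'rV[R]_n | forall i, A (lift ord0 i) (x 0 i)].
  rewrite (_ : [set _ | _] = \bigcap_(i in [set: 'I_n])
      ((fun x : 'rV[R]_n => x 0 i) @^-1` A (lift ord0 i))).
    apply: fin_bigcap_measurable => // i _.
    by rewrite -[X in measurable X]setTI; apply: measurable_entry => //; exact: mA.
  apply/seteqP; split=> x /= h i; first by move=> _; exact: h.
  exact: (h i I).
rewrite -product_measure1E//; congr (_ _).
apply/seteqP; split=> -[a y] /=.
  move=> h; split; first by have := h 0; rewrite rV_cons0.
  by move=> i; have := h (lift 0 i); rewrite rV_consS.
move=> [ha hy] i; case: (unliftP 0 i) => [k ->|->].
  by rewrite rV_consS; exact: hy.
by rewrite rV_cons0.
Qed.

End lebesgue_rV.

Section navier_stokes.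
Context {R : realType} {d : nat}.
Implicit Types (t s : R) (x y : 'rV[R]_d) (i j k : 'I_d).

(* The library norm on 'rV[R]_d is the sup norm; this is the Euclidean one. *)
Definition enorm x : R := Num.sqrt (\sum_i x 0 i ^+ 2).

Definition partial k (f : 'rV[R]_d -> R) x : R := 'D_(delta_mx 0 k) f x.

Definition heat_kernel t x : R :=
  (4 * pi * t) `^ (- (d%:R / 2)) * expR (- (enorm x ^+ 2 / (4 * t))).

(* The Helmholtz projection of the heat kernel: delta_ij Gamma(t) +
   d_i d_j (-Delta)^-1 Gamma(t), the second term being the integral of
   d_i d_j Gamma(s) over s > t as d_s Gamma = Delta Gamma. *)
Definition oseen_kernel i j t x : R :=
  (i == j)%:R * heat_kernel t x +
  \int[lebesgue_measure]_(s in `]t, +oo[) partial i (partial j (heat_kernel s)) x.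

(* C^oo_c(R^d): differentiability of all iterated partial derivatives amounts
   to smoothness. *)
Definition test_function (phi : 'rV[R]_d -> R) : Prop :=
  (forall (l : seq 'I_d) x, differentiable (foldr partial phi l) x) /\
  compact (closure [set x | phi x != 0]).

(* Distributional sense, as v is only bounded and measurable. *)
Definition divergence_free (v : 'rV[R]_d -> 'rV[R]_d) : Prop :=
  forall phi, test_function phi ->
    \int[lebesgue_rV d]_x (\sum_i v x 0 i * partial i phi x) = 0.

(* u(t) = E(t) * u(0) - \int_0^t E(t - s) * div (u (x) u)(s) ds, with the
   divergence moved onto E by parts, and E(t) * u(0) = Gamma(t) * u(0) since
   u(0) is divergence free. *)
Definition mild_solution (u : R -> 'rV[R]_d -> 'rV[R]_d) : Prop :=
  [/\ measurable_fun [set p : R * 'rV[R]_d | 0 <= p.1 <= 1]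
        (fun p : R * 'rV[R]_d => u p.1 p.2),
      forall t, 0 <= t <= 1 -> divergence_free (u t) &
      forall t x i, 0 < t <= 1 ->
        u t x 0 i =
          \int[lebesgue_rV d]_y (heat_kernel t (x - y) * u 0 y 0 i)
          - \sum_j \sum_k \int[lebesgue_measure]_(s in `]0, t[)
              \int[lebesgue_rV d]_y
                (partial k (oseen_kernel i j (t - s)) (x - y)
                 * (u s y 0 j * u s y 0 k)) ].

End navier_stokes.

(* Calculus on the time interval ]0, 1]; restricting the punctured
   neighbourhoods to it makes derivatives at the endpoint 1 one-sided.       *)
Section time_derivative.
Context {R : realType} {V : normedModType R}.
Implicit Types (f : R -> V) (t : R).

Definition time_quotient f t (s : R) : V := (s - t)^-1 *: (f s - f t).

Definition time_derivable f t : Prop :=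
  cvg (time_quotient f t s @[s --> within `]0, 1] t^']).

Definition time_derive f t : V :=
  lim (time_quotient f t s @[s --> within `]0, 1] t^']).

Definition time_deriven n f : R -> V := iter n time_derive f.

Definition time_derivablen n f : Prop :=
  forall m t, (m < n)%N -> 0 < t <= 1 -> time_derivable (time_deriven m f) t.

Definition time_analytic f t : Prop :=
  exists a : nat -> V, exists2 r : R, 0 < r &
    forall s, 0 < s <= 1 -> `|s - t| < r ->
      series (fun k => (s - t) ^+ k *: a k) @ \oo --> f s.

End time_derivative.

(* Main.v *)
Require Import Defs.
From HB Require Import structures.
From mathcomp Require Import all_boot all_order all_algebra.
From mathcomp Require Import all_classical all_reals all_analysis.
From mathcomp Require Import measurable_realfun ess_sup_inf ring lra.
Set Implicit Arguments.
Unset Strict Implicit.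
Unset Printing Implicit Defensive.
Import Order.TTheory GRing.Theory Num.Theory.
Import numFieldNormedType.Exports.
Local Open Scope classical_set_scope.
Local Open Scope ring_scope.

(* Rescale time: U_h(t, x) = u((1 + h) t, x) solves a fixed point equation whose
   free term and kernel are Gamma((1 + h) t) * u(0) and
   (1 + h) d_k E_ij((1 + h) t, x). Both are power series in h, with weighted l^1
   norms of the coefficients bounded by a Gaussian caloric quantity, because
   (1 + h)^-b exp(- z / (1 + h)) is such a series with norm O(exp(- 3 z / 4)).
   Since the weighted l^1 sequences form a Banach algebra, the quadratic equation
   can be iterated on coefficients, the weight exp(- M t) providing a contraction
   on all of ]0, 1]; evaluated at h, the limit must be U_h by uniqueness of
   bounded solutions. Hence u(s, x) = sum_n ((s - t) / t)^n a_n(t, x) for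
   |s - t| <= sigma t, with |a_n| <= A sigma^-n uniformly in t and x, so that
   |d_t^n u| <= n! A (sigma t)^-n. *)

(** * Weighted l^1 sequences and their sums *)

(** The obstacle is the Duhamel term: a time derivative put on its kernel costs a factor (t - s)^-1
    on top of the size (t - s)^(-1/2), and the result is not integrable at s = t. After dilation the
    singularity stays at s = t for every h, and t - s only undergoes the relative change by 1 + h.
    Hence each coefficient in h is no more singular than the kernel itself, and the radius in h does
    not depend on t. The unknown enters the integral only through the values of U_h, so nothing
    beyond boundedness and measurability of u is used. The Oseen kernel lacks Gaussian decay in
    space; its majorant is therefore a tail integral of Gaussians, of which only the total mass O((t
    - s)^(-1/2)) matters. Everything stays real: analyticity in h is carried by coefficient bounds,
    not by a complex extension. The coefficients do not depend on h, while the identity with U_h is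
    claimed only where (1 + h) t <= 1. At t = 1 this gives a genuine two-sided power series that
    agrees with u on the left, which is what the one-sided derivatives need. *)

Section weighted_l1.
Variable R : realType.
Implicit Types (s h A B : R) (a b c : nat -> R).

(** The weighted l^1 norm is at most [A]. Bounding all finite sums avoids a separate summability
    hypothesis, and N = 0 already forces [A] to be nonnegative. *)
Definition wle s a A := forall N, \sum_(n < N) `|a n| * s ^+ n <= A.

Definition psum h a := limn (pseries a h).

Definition conv a b n := \sum_(i < n.+1) a i * b (n - i)%N.

Lemma wle_ge0 s a A : wle s a A -> 0 <= A.
Proof. by move=> /(_ 0%N); rewrite big_ord0. Qed.

Lemma wle_trans s a A B : wle s a A -> A <= B -> wle s a B.
Proof. by move=> aA AB N; exact: le_trans AB. Qed.

Lemma wle0 s A : 0 <= A -> wle s (fun=> 0) A.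
Proof. by move=> A0 N; rewrite big1// => i _; rewrite normr0 mul0r. Qed.

Lemma wle_shrink s' s a A : 0 <= s' -> s' <= s -> wle s a A -> wle s' a A.
Proof.
move=> s'0 s's aA N; apply: le_trans (aA N); apply: ler_sum => n _.
by apply: ler_wpM2l => //; apply: lerXn2r; rewrite ?nnegrE// (le_trans s'0).
Qed.

Lemma wleD s a b A B : 0 <= s -> wle s a A -> wle s b B ->
  wle s (fun n => a n + b n) (A + B).
Proof.
move=> s0 aA bB N; apply: le_trans (lerD (aA N) (bB N)).
rewrite -big_split; apply: ler_sum => n _ /=.
by rewrite -mulrDl ler_wpM2r ?exprn_ge0// ler_normD.
Qed.

Lemma wleN s a A : wle s a A -> wle s (fun n => - a n) A.
Proof.
by move=> aA N; apply: le_trans (aA N); apply: ler_sum => n _; rewrite normrN.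
Qed.

Lemma wleB s a b A B : 0 <= s -> wle s a A -> wle s b B ->
  wle s (fun n => a n - b n) (A + B).
Proof. by move=> s0 aA bB; apply: wleD => //; exact: wleN. Qed.

Lemma wleZ s k a A : wle s a A -> wle s (fun n => k * a n) (`|k| * A).
Proof.
move=> aA N; apply: le_trans (ler_wpM2l (normr_ge0 k) (aA N)).
by rewrite mulr_sumr; apply: ler_sum => n _; rewrite normrM mulrA.
Qed.

Lemma wle_sum (I : Type) (r : seq I) s (a : I -> nat -> R) (A : I -> R) :
  0 <= s -> (forall i, wle s (a i) (A i)) ->
  wle s (fun n => \sum_(i <- r) a i n) (\sum_(i <- r) A i).
Proof.
move=> s0 aA; elim: r => [|i r IHr] N.
  by rewrite big_nil big1// => n _; rewrite big_nil normr0 mul0r.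
rewrite big_cons; apply: le_trans (wleD s0 (aA i) IHr N).
by under eq_bigr do rewrite big_cons.
Qed.

Lemma wle_coef s a A n : 0 <= s -> wle s a A -> `|a n| * s ^+ n <= A.
Proof.
move=> s0 aA; apply: le_trans (aA n.+1); rewrite big_ord_recr /= lerDr.
by apply: sumr_ge0 => i _; rewrite mulr_ge0// exprn_ge0.
Qed.

Lemma wle_const s x A : `|x| <= A -> wle s (fun n => if n == 0%N then x else 0) A.
Proof.
move=> xA [|N]; first by rewrite big_ord0 (le_trans _ xA).
rewrite big_ord_recl big1 ?addr0 ?mulr1// => i _.
by rewrite normr0 mul0r.
Qed.

Lemma psum_cvg s h a A : `|h| <= s -> wle s a A -> pseries a h @ \oo --> psum h a.
Proof.
move=> hs aA; apply: normed_cvg.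
apply: nondecreasing_is_cvgn.
  apply/nondecreasing_seqP => N; rewrite /normed_series_of /series /= big_nat_recr//= lerDl.
  exact: normr_ge0.
exists A => _ [N _ <-]; apply: le_trans (aA N).
rewrite /normed_series_of /series /= big_mkord; apply: ler_sum => n _.
by rewrite normrM normrX ler_wpM2l// lerXn2r// ?nnegrE// (le_trans _ hs).
Qed.

Lemma partial_psum_le s h a A N : `|h| <= s -> wle s a A ->
  `|pseries a h N| <= A.
Proof.
move=> hs aA; apply: le_trans (aA N).
rewrite /pseries /series /= big_mkord; apply: le_trans (ler_norm_sum _ _ _) _.
apply: ler_sum => n _.
by rewrite normrM normrX ler_wpM2l// lerXn2r// ?nnegrE// (le_trans _ hs).
Qed.

Lemma psum_le s h a A : `|h| <= s -> wle s a A -> `|psum h a| <= A.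
Proof.
move=> hs aA; have := psum_cvg hs aA => /cvg_norm ca.
rewrite -(cvg_lim _ ca)//; apply: limr_le; first by apply: cvgP ca.
by apply: nearW => N; exact: partial_psum_le aA.
Qed.

Lemma psum_eq h a b : a =1 b -> psum h a = psum h b.
Proof. by move=> /funext->. Qed.

Lemma psumE h a l : pseries a h @ \oo --> l -> psum h a = l.
Proof. exact: cvg_lim. Qed.

Lemma psumD s h a b A B : `|h| <= s -> wle s a A -> wle s b B ->
  psum h (fun n => a n + b n) = psum h a + psum h b.
Proof.
move=> hs aA bB; apply: psumE.
rewrite (_ : pseries _ h = pseries a h + pseries b h).
  by apply: cvgD; [exact: psum_cvg aA|exact: psum_cvg bB].
apply/funext => N; rewrite /pseries /series /= -[RHS]big_split.
by apply: eq_bigr => n _ /=; rewrite mulrDl.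
Qed.

Lemma psumZ s h k a A : `|h| <= s -> wle s a A ->
  psum h (fun n => k * a n) = k * psum h a.
Proof.
move=> hs aA; apply: psumE.
rewrite (_ : pseries _ h = (fun N => k * pseries a h N)).
  by apply: cvgMr; exact: psum_cvg aA.
apply/funext => N; rewrite /pseries /series /= mulr_sumr.
by apply: eq_bigr => n _ /=; rewrite mulrA.
Qed.

Lemma psumN s h a A : `|h| <= s -> wle s a A ->
  psum h (fun n => - a n) = - psum h a.
Proof.
move=> hs aA; rewrite -mulN1r -(psumZ _ hs aA).
by apply: psum_eq => n; rewrite mulN1r.
Qed.

Lemma psumB s h a b A B : `|h| <= s -> wle s a A -> wle s b B ->
  psum h (fun n => a n - b n) = psum h a - psum h b.
Proof.
move=> hs aA bB; rewrite (psumD hs aA (wleN bB)).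
by rewrite (psumN hs bB).
Qed.

Lemma psum_sum (I : Type) (r : seq I) s h (a : I -> nat -> R) (A : I -> R) :
  0 <= s -> `|h| <= s -> (forall i, wle s (a i) (A i)) ->
  psum h (fun n => \sum_(i <- r) a i n) = \sum_(i <- r) psum h (a i).
Proof.
move=> s0 hs aA; elim: r => [|i r IHr].
  rewrite big_nil; apply: psumE; rewrite (_ : pseries _ _ = cst 0); first exact: cvg_cst.
  apply/funext => N; rewrite /pseries /series /= big1// => n _.
  by rewrite big_nil mul0r.
rewrite big_cons -IHr -(psumD hs (aA i) (wle_sum r s0 aA)).
by apply: psum_eq => n; rewrite big_cons.
Qed.

Lemma psum_const h x : psum h (fun n => if n == 0%N then x else 0) = x.
Proof.
apply: psumE; rewrite -cvg_shiftS (_ : (fun n : nat => _) = cst x).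
  exact: cvg_cst.
apply/funext => N; rewrite /pseries /series /= big_nat_recl//= mulr1 big1 ?addr0//.
by move=> i _; rewrite mul0r.
Qed.

Lemma psum0 h : psum h (fun=> 0) = 0.
Proof.
by rewrite -[RHS](psum_const h 0); apply: psum_eq => n; rewrite if_same.
Qed.

Lemma psum_at0 a : psum 0 a = a 0%N.
Proof.
rewrite -[RHS](psum_const 0 (a 0%N)) /psum.
rewrite (_ : pseries a 0 = pseries (fun n => if n == 0%N then a 0%N else 0) 0)//.
apply/funext => N; rewrite /pseries /series /=; apply: eq_bigr => -[|n] _ //.
by rewrite expr0n mulr0 mul0r.
Qed.

Lemma conv_exp h a b n :
  conv a b n * h ^+ n = conv (fun m => a m * h ^+ m) (fun m => b m * h ^+ m) n.
Proof.
rewrite /conv mulr_suml; apply: eq_bigr => i _.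
by rewrite mulrACA -exprD subnKC// -ltnS.
Qed.

(** The truncated Cauchy product is a sum over the triangle i + j < N, here arranged by rows.
    Comparing the triangle with squares gives both the algebra bound and the convergence of the
    product. *)
Lemma sum_conv a b N :
  \sum_(n < N) conv a b n = \sum_(i < N) a i * \sum_(j < N - i) b j.
Proof.
elim: N => [|N IHN]; first by rewrite !big_ord0.
rewrite big_ord_recr /= IHN [in RHS]big_ord_recr /= subSnn.
rewrite /conv big_ord_recr /= subnn big_ord1 addrA -big_split; congr (_ + _).
apply: eq_bigr => i _ /=.
by rewrite subSn ?[in RHS]big_ord_recr /= ?mulrDr// ltnW.
Qed.

Lemma norm_conv a b n :
  `|conv a b n| <= conv (fun m => `|a m|) (fun m => `|b m|) n.
Proof.
apply: le_trans (ler_norm_sum _ _ _) _.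
by apply: ler_sum => i _; rewrite normrM.
Qed.

Lemma conv_ge0_le a b N : (forall n, 0 <= a n) -> (forall n, 0 <= b n) ->
  \sum_(n < N) conv a b n <= (\sum_(n < N) a n) * \sum_(n < N) b n.
Proof.
move=> a0 b0; rewrite sum_conv mulr_suml; apply: ler_sum => i _.
apply: ler_wpM2l => //; rewrite -!(big_mkord xpredT).
rewrite [leRHS](@big_cat_nat _ _ _ (N - i)%N) ?leq_subr//= lerDl.
by apply: sumr_ge0.
Qed.

Lemma wle_conv s a b A B : 0 <= s -> wle s a A -> wle s b B ->
  wle s (conv a b) (A * B).
Proof.
move=> s0 aA bB N.
apply: le_trans (_ : \sum_(n < N) conv (fun m => `|a m| * s ^+ m)
    (fun m => `|b m| * s ^+ m) n <= _).
  apply: ler_sum => n _; rewrite -conv_exp ler_wpM2r ?exprn_ge0//.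
  exact: norm_conv.
apply: le_trans (conv_ge0_le _ _ _) _ => [n|n|].
- by rewrite mulr_ge0// exprn_ge0.
- by rewrite mulr_ge0// exprn_ge0.
- by apply: ler_pM => //; apply: sumr_ge0 => n _; rewrite mulr_ge0// exprn_ge0.
Qed.

Lemma convBl a b c : conv (fun n => a n - b n) c = (fun n => conv a c n - conv b c n).
Proof.
by apply/funext => n; rewrite -sumrB; apply: eq_bigr => i _; rewrite mulrBl.
Qed.

Lemma convBr a b c : conv a (fun n => b n - c n) = (fun n => conv a b n - conv a c n).
Proof.
by apply/funext => n; rewrite -sumrB; apply: eq_bigr => i _; rewrite mulrBr.
Qed.

(* The defect of the truncated Cauchy product is bounded by that of the
   moduli, whose truncations at N lie between the products of the partial
   sums at N./2 and at N. *)
Lemma psum_conv s h a b A B : `|h| <= s -> wle s a A -> wle s b B ->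
  psum h (conv a b) = psum h a * psum h b.
Proof.
move=> hs aA bB.
have s0 : 0 <= s by rewrite (le_trans _ hs).
pose x n := a n * h ^+ n; pose y n := b n * h ^+ n.
pose S (z : nat -> R) N := \sum_(n < N) z n.
pose nx n : R := `|x n|; pose ny n : R := `|y n|.
have pE z : pseries z h = S (fun n => z n * h ^+ n).
  by apply/funext => N; rewrite /pseries /series /= big_mkord.
have cx : S x @ \oo --> psum h a by rewrite -pE; exact: psum_cvg aA.
have cy : S y @ \oo --> psum h b by rewrite -pE; exact: psum_cvg bB.
have absE z C : wle s z C -> exists l : R, S (fun n => `|z n * h ^+ n|) @ \oo --> l.
  move=> zC; have : wle s (fun n => `|z n|) C.
    by move=> N; under eq_bigr do rewrite normr_id; exact: zC.
  have hh : `| `|h| | <= s by rewrite normr_id.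
  move=> /(psum_cvg hh) cz; exists (psum `|h| (fun n => `|z n|)).
  rewrite (_ : S _ = pseries (fun n => `|z n|) `|h|)//.
  apply/funext => N; rewrite /pseries /series /= big_mkord.
  by apply: eq_bigr => n _; rewrite normrM normrX.
have [lx cnx] := absE _ _ aA; have [ly cny] := absE _ _ bB.
have cnxy : (fun N => S nx N * S ny N) @ \oo --> lx * ly by exact: cvgM.
have half : (fun N => N./2) @ \oo --> \oo.
  move=> P [n _ nP]; exists n.*2 => // m /= nm; apply: nP => /=.
  by rewrite -(doubleK n) half_leq.
have cnxy2 : (fun N => S nx N./2 * S ny N./2) @ \oo --> lx * ly.
  exact: (cvg_comp _ _ half cnxy).
have cxy : (fun N => S x N * S y N) @ \oo --> psum h a * psum h b by exact: cvgM.
apply: psumE; rewrite pE.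
apply: cvg_sub0 (cxy).
apply: norm_cvg0.
apply: (@squeeze_cvgr _ _ _ _ (cst 0) (fun N => S nx N * S ny N - S nx N./2 * S ny N./2)).
- apply: nearW => N; rewrite normr_ge0 /=.
  rewrite !fctE (_ : S _ N = S (conv x y) N); last first.
    by apply: eq_bigr => n _; rewrite conv_exp.
  rewrite /S sum_conv distrC mulr_suml -sumrB.
  apply: le_trans (ler_norm_sum _ _ _) _.
  apply: le_trans (_ : \sum_(i < N) nx i * (S ny N - S ny (N - i)%N) <= _).
    apply: ler_sum => i _; rewrite -mulrBr normrM ler_wpM2l//.
    rewrite /S -!(big_mkord xpredT) !(@big_cat_nat _ _ _ (N - i)%N 0 N) ?leq_subr//=.
    rewrite addrAC subrr add0r [leRHS]addrAC subrr add0r.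
    exact: ler_norm_sum.
  under eq_bigr do rewrite mulrBr.
  rewrite sumrB -mulr_suml lerB// {1}/S mulr_suml.
  have hN : (N./2 <= N)%N by rewrite -{2}(odd_double_half N) -addnn addnA leq_addl.
  rewrite -(big_mkord xpredT (fun i => nx i * \sum_(n < N./2) ny n)).
  rewrite -(big_mkord xpredT (fun i => nx i * \sum_(n < N - i) ny n)).
  rewrite [leRHS](@big_cat_nat _ _ _ N./2)//=.
  have nx0 i : 0 <= nx i by exact: normr_ge0.
  have ny0 i : 0 <= ny i by exact: normr_ge0.
  apply: ler_wpDr.
    by apply: sumr_ge0 => i _; apply: mulr_ge0 => //; exact: sumr_ge0.
  rewrite !big_mkord; apply: ler_sum => i _; rewrite ler_wpM2l// /S.
  (* For i < N./2 the row of the triangle still has N./2 entries, so the triangle contains the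
     square of side N./2. *)
  have hNi : (N./2 <= N - i)%N.
    rewrite leq_subRL; last by rewrite (leq_trans _ hN)// ltnW.
    rewrite (@leq_trans (N./2 + N./2)) ?leq_add2r ?(ltnW (ltn_ord i))//.
    by rewrite addnn -[leqRHS](odd_double_half N) leq_addl.
  rewrite -!(big_mkord xpredT) [leRHS](@big_cat_nat _ _ _ N./2)//= lerDl.
  by apply: sumr_ge0.
- exact: cvg_cst.
- by rewrite -(subrr (lx * ly)); apply: cvgB.
Qed.

(** Halving the radius pays for the factor n + 1, because n + 1 <= 2^n; shifting the index costs 1 /
    s. *)
Lemma wle_pseries_diffs s a A : 0 < s -> wle s a A ->
  wle (s / 2) (pseries_diffs a) (A / s).
Proof.
move=> s0 aA N.
apply: le_trans (_ : \sum_(n < N) `|a n.+1| * s ^+ n <= _).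
  apply: ler_sum => n _; rewrite /pseries_diffs normrM ger0_norm// mulrAC mulrC.
  rewrite ler_wpM2l// expr_div_n mulrA ler_pdivrMr ?exprn_gt0// mulrC.
  by rewrite ler_pM2l ?exprn_gt0// -natrX ler_nat ltn_expl.
rewrite ler_pdivlMr// mulr_suml.
apply: le_trans (aA N.+1); rewrite big_ord_recl ler_wpDl//.
  by rewrite mulr_ge0.
by apply: ler_sum => n _; rewrite /= /bump leq0n add1n exprSr mulrA.
Qed.

(** Termwise differentiation asks for convergence of the series and of its first two formal
    derivatives at one point beyond |h|. Two halvings of the radius leave s / 4. *)
Lemma is_derive_psum s h a A : 0 < s -> wle s a A -> `|h| < s / 4 ->
  is_derive h (1 : R) (psum^~ a) (psum h (pseries_diffs a)).
Proof.
move=> s0 aA hs.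
have s20 : 0 < s / 2 by rewrite divr_gt0.
have s4 : s / 4 = s / 2 / 2 by rewrite -mulrA -invfM -natrM.
have s40 : 0 < s / 4 by rewrite divr_gt0.
have dA := wle_pseries_diffs s0 aA; have ddA := wle_pseries_diffs s20 dA.
rewrite -s4 in ddA.
apply: (@pseries_snd_diffs R a (s / 4)).
- by apply: cvgP; apply: psum_cvg aA; rewrite ger0_norm; lra.
- by apply: cvgP; apply: psum_cvg dA; rewrite ger0_norm; lra.
- by apply: cvgP; apply: psum_cvg ddA; rewrite ger0_norm; lra.
- by rewrite (ger0_norm (ltW s40)).
Qed.

End weighted_l1.

(** * Power series of the heat kernel in the dilation parameter *)

Section calculus.
Variable R : realType.

Lemma derive_le0_le (f df : R -> R) (r : R) : 0 <= r ->
  (forall x, 0 <= x <= r -> is_derive x (1 : R) f (df x)) ->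
  (forall x, 0 <= x <= r -> df x <= 0) -> f r <= f 0.
Proof.
move=> r0 fdf df0.
have [|x|c c0r] := @MVT_segment R f df 0 r r0.
- by move=> x /subset_itv_oo_cc; rewrite /= in_itv/= => xr; apply: fdf.
- apply: derivable_within_continuous => y; rewrite in_itv/= => yr.
  by case: (fdf y yr).
- rewrite in_itv/= in c0r.
  by move=> e; rewrite -subr_le0 e mulr_le0_ge0 ?subr0// df0.
Qed.

Lemma derive0_eq (f : R -> R) (r h : R) : `|h| < r ->
  (forall x, `|x| < r -> is_derive x (1 : R) f 0) -> f h = f 0.
Proof.
move=> hr f0.
have key x y : x <= y -> `|x| < r -> `|y| < r -> f x = f y.
  move=> xy xr yr.
  have in_xy z : x <= z <= y -> `|z| < r.
    by rewrite !ltr_norml in xr yr *; lra.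
  have [|z|c _] := @MVT_segment R f (cst 0) x y xy.
  - by move=> z /subset_itv_oo_cc; rewrite /= in_itv/= => /in_xy zr; exact: f0.
  - apply: derivable_within_continuous => t; rewrite in_itv/= => /in_xy tr.
    by case: (f0 t tr).
  - by rewrite mul0r => /eqP; rewrite subr_eq0 => /eqP.
have r0 : `|0 : R| < r by rewrite normr0 (le_lt_trans _ hr).
by case: (leP h 0) => [h0|/ltW h0]; [exact: key|apply/esym; exact: key].
Qed.

Lemma is_derive_polysum (a : nat -> R) N (x : R) :
  is_derive x (1 : R) (fun y => \sum_(i < N) a i * y ^+ i)
    (\sum_(i < N) a i * (i%:R * x ^+ i.-1)).
Proof.
rewrite (_ : (fun y => _) = \sum_(i < N) (a i *: (fun y : R => y ^+ i))); last first.
  by apply/funext => y; rewrite fct_sumE; apply: eq_bigr => i _.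
apply: is_derive_sum => i.
apply: is_deriveZ; rewrite -[X in is_derive _ _ _ X]mulr1.
rewrite (_ : (fun y => _) = id ^+ i); last by apply/funext => y; rewrite exprfctE.
exact: is_deriveX.
Qed.

End calculus.

(** * Coefficients of (1 + h)^-b exp(- z / (1 + h)) *)

Section heat_coefficients.
Variable R : realType.
Implicit Types (b z h s : R) (a : nat -> R).

Definition shift_seq a n := if n is m.+1 then a m else 0.

Lemma wle_shift_seq s a A : 0 <= s -> wle s a A -> wle s (shift_seq a) (s * A).
Proof.
move=> s0 aA [|N]; first by rewrite big_ord0 mulr_ge0// (wle_ge0 aA).
rewrite big_ord_recl normr0 mul0r add0r.
apply: le_trans (ler_wpM2l s0 (aA N)); rewrite mulr_sumr; apply: ler_sum => i _.
by rewrite /= exprS mulrCA.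
Qed.

Lemma psum_shift_seq s h a A : `|h| <= s -> wle s a A ->
  psum h (shift_seq a) = h * psum h a.
Proof.
move=> hs aA; apply: psumE; rewrite -cvg_shiftS.
rewrite (_ : (fun n : nat => _) = (fun N => h * pseries a h N)).
  by apply: cvgMr; exact: psum_cvg aA.
apply/funext => N; rewrite /pseries /series /= big_nat_recl//= mul0r add0r mulr_sumr.
by apply: eq_bigr => i _; rewrite exprS mulrCA.
Qed.

(* The generating function F(h) = (1 + h)^-b exp(- z / (1 + h)) satisfies
   (1 + h)^2 F' = (z - b - b h) F; the recursion reads off coefficients, the
   first component of the pair being the previous coefficient. *)
Fixpoint heat_pair b z m : R * R :=
  if m is k.+1 then
    let p := heat_pair b z k in
    (p.2, ((z - b - 2 * k%:R) * p.2 - (k%:R - 1 + b) * p.1) / k.+1%:R)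
  else (0, expR (- z)).

Definition heat_coef b z m := (heat_pair b z m).2.

Lemma heat_pair1 b z m : (heat_pair b z m).1 = shift_seq (heat_coef b z) m.
Proof. by case: m. Qed.

Lemma heat_coefS b z m : m.+1%:R * heat_coef b z m.+1 =
  (z - b - 2 * m%:R) * heat_coef b z m - (m%:R - 1 + b) * shift_seq (heat_coef b z) m.
Proof.
by rewrite {1}/heat_coef /= heat_pair1 -/(heat_coef b z m) mulrC divfK ?pnatr_eq0.
Qed.

Lemma measurable_heat_coef b m :
  measurable_fun setT (fun z : R => heat_coef b z m).
Proof.
suff : measurable_fun setT (fun z : R => (heat_pair b z m).1) /\
    measurable_fun setT (fun z : R => (heat_pair b z m).2) by case.
elim: m => [|m [IH1 IH2]] /=.
  split; first exact: measurable_cst.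
  by apply: measurableT_comp => //; exact: measurableT_comp.
split=> //; apply: measurable_funM => //; apply: measurable_funB.
  apply: measurable_funM => //; apply: measurable_funB => //.
  exact: measurable_funB.
by apply: measurable_funM.
Qed.

(** [Q] is the derivative in [r] of the truncated majorant [P]; a differential inequality between
    the two controls the growth of [P]. *)
Let P b z N (r : R) := \sum_(m < N) `|heat_coef b z m| * r ^+ m.
Let Q b z N (r : R) := \sum_(m < N) `|heat_coef b z m| * (m%:R * r ^+ m.-1).

Let P_ge0 b z N r : 0 <= r -> 0 <= P b z N r.
Proof. by move=> r0; apply: sumr_ge0 => m _; rewrite mulr_ge0// exprn_ge0. Qed.

Let Q_ge0 b z N r : 0 <= r -> 0 <= Q b z N r.
Proof.
by move=> r0; apply: sumr_ge0 => m _; rewrite mulr_ge0// mulr_ge0// exprn_ge0.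
Qed.

Let P_le b z N r : 0 <= r -> P b z N r <= P b z N.+1 r.
Proof. by move=> r0; rewrite /P big_ord_recr /= lerDl mulr_ge0// exprn_ge0. Qed.

Let Q_le b z N r : 0 <= r -> Q b z N r <= Q b z N.+1 r.
Proof.
by move=> r0; rewrite /Q big_ord_recr /= lerDl mulr_ge0// mulr_ge0// exprn_ge0.
Qed.

(** This is the differential equation of the generating function with all signs made positive.
    Taking moduli in the recursion bounds (m + 1) |c_(m+1)| by (z + b + 2 m) |c_m| + (m - 1 + b)
    |c_(m-1)|, and this is summed against r^m. *)
Let QS b z N r : 0 <= b -> 0 <= z -> 0 <= r ->
  Q b z N.+1 r <= (z + b) * P b z N r + 2 * (r * Q b z N r)
    + r * (r * Q b z N r) + b * (r * P b z N r).
Proof.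
move=> b0 z0 r0.
have rQ N' : r * Q b z N' r = \sum_(m < N') `|heat_coef b z m| * m%:R * r ^+ m.
  rewrite mulr_sumr; apply: eq_bigr => -[[|m] _] _ /=; first by rewrite !(mul0r, mulr0).
  by rewrite exprS; ring.
rewrite [leLHS]big_ord_recl mul0r mulr0 add0r.
case: N => [|N].
  by rewrite big_ord0 !addr_ge0// ?mulr_ge0// ?addr_ge0 ?P_ge0 ?Q_ge0.
apply: (@le_trans _ _ ((z + b) * P b z N.+1 r + 2 * (r * Q b z N.+1 r)
    + r * (r * Q b z N r) + b * (r * P b z N r))); last first.
  by rewrite lerD// ?lerD// !ler_wpM2l// ?P_le ?Q_le.
rewrite !rQ [r * P _ _ _ _]mulr_sumr [r * \sum_(i < N) _]mulr_sumr.
rewrite (_ : \sum_(i < N) r * (_ * r ^+ i) = \sum_(i < N.+1)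
    `|shift_seq (heat_coef b z) i| * (i%:R - 1) * r ^+ i); last first.
  rewrite [RHS]big_ord_recl normr0 !mul0r add0r; apply: eq_bigr => i _.
  by rewrite /= /bump add1n -natr1 addrK exprS mulrCA.
rewrite (_ : \sum_(i < N) r * (_ * r ^+ i) = \sum_(i < N.+1)
    `|shift_seq (heat_coef b z) i| * r ^+ i); last first.
  rewrite [RHS]big_ord_recl normr0 !mul0r add0r; apply: eq_bigr => i _.
  by rewrite /= exprS mulrCA.
rewrite ![_ * \sum_(i < N.+1) _]mulr_sumr -!big_split /=.
apply: ler_sum => m _ /=; rewrite /bump add1n /=.
rewrite mulrA -[X in X * _ <= _]mulrC -{1}[m.+1%:R]ger0_norm// -normrM heat_coefS.
set c := heat_coef b z m; set c' := shift_seq _ _.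
(* At m = 0 the factor m - 1 is negative, but the shifted sequence vanishes there, so the modulus
   may be taken term by term. *)
have c'm : `|(m%:R - 1 + b) * c'| <= (m%:R - 1) * `|c'| + b * `|c'|.
  rewrite /c'; case: (m : nat) => [|k] /=; first by rewrite mulr0 normr0 !mulr0 addr0.
  by rewrite normrM ger0_norm -?natr1 ?addrK ?mulrDl// addr_ge0.
have : `|(z - b - 2 * m%:R) * c - (m%:R - 1 + b) * c'| <=
    (z + b + 2 * m%:R) * `|c| + ((m%:R - 1) * `|c'| + b * `|c'|).
  apply: le_trans (ler_normB _ _) _; apply: lerD => //.
  rewrite normrM ler_wpM2r//.
  have m0 : 0 <= m%:R :> R by [].
  by rewrite ler_norml; apply/andP; split; lra.
move=> /(ler_wpM2r (exprn_ge0 m r0)) /le_trans; apply.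
by rewrite le_eqVlt; apply/orP; left; apply/eqP; ring.
Qed.

(** A Gronwall argument: P' <= k P on [0, 1 / 8] with P(0) <= exp(- z), so P exp(- k r) does not
    increase. At r = 1 / 8 the growth exponent is z / 4 + b / 2, which spends a quarter of the
    decay. *)
Lemma wle_heat_coef b z : 0 <= b -> 0 <= z ->
  wle (1 / 8) (heat_coef b z) (expR (b / 2 - 3 / 4 * z)).
Proof.
move=> b0 z0 N.
(* For r <= 1 / 8 the inequality reads Q <= (z + 2 b) P + (3 / 8) Q, and 8 / 5 is rounded up to
   2. *)
pose k := 2 * (z + 2 * b).
pose f r := P b z N r * expR (- (k * r)).
have df r : is_derive r (1 : R) f
    ((Q b z N r - k * P b z N r) * expR (- (k * r))).
  have dP := is_derive_polysum (fun m => `|heat_coef b z m|) N r.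
  rewrite (_ : f = (P b z N) * (expR \o (fun r => - (k * r))))//.
  have dk : is_derive r (1 : R) (fun r => - (k * r)) (- k).
    rewrite -[X in is_derive _ _ _ (- X)]mulr1.
    exact: (@is_deriveN _ _ _ (k \*: id)).
  apply: is_derive_eq.
  rewrite /= -/(P b z N r) -/(Q b z N r) /GRing.scale /=; ring.
have fle : f (1 / 8) <= f 0.
  apply: (@derive_le0_le _ f _ _ _ (fun r _ => df r)) => [|r /andP[r0 r8]]; first by lra.
  rewrite pmulr_lle0 ?expR_gt0// subr_le0.
  have P0 := P_ge0 b z N r0; have Q0 := Q_ge0 b z N r0.
  have : Q b z N r <= (z + b) * P b z N r + 2 * (r * Q b z N r)
      + r * (r * Q b z N r) + b * (r * P b z N r).
    by apply: le_trans (QS N b0 z0 r0); exact: Q_le.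
  have rQ : r * Q b z N r <= 1 / 8 * Q b z N r by apply: ler_wpM2r.
  have rrQ : r * (r * Q b z N r) <= 1 / 8 * Q b z N r.
    by apply: ler_pM => //; [rewrite mulr_ge0|nra].
  have rP : b * (r * P b z N r) <= b * P b z N r.
    by rewrite ler_wpM2l// ler_piMl//; lra.
  rewrite /k; lra.
have f0 : f 0 <= expR (- z).
  rewrite /f mulr0 oppr0 expR0 mulr1 /P; case: (N) => [|N'].
    by rewrite big_ord0 expR_ge0.
  rewrite big_ord_recl big1 ?addr0 ?mulr1; last first.
    by move=> i _; rewrite expr0n mulr0.
  by rewrite /heat_coef /= ger0_norm// expR_ge0.
have := le_trans fle f0.
rewrite /f expRN ler_pdivrMr ?expR_gt0// -expRD => /le_trans; apply.
by rewrite ler_expR /k; lra.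
Qed.

(** Both sides solve the same first order linear equation: the series times the reciprocal of the
    claimed value has zero derivative and equals 1 at h = 0. The range 1 / 32 is a quarter of the
    radius 1 / 8, as differentiation of the series requires. *)
Lemma psum_heat_coef b z h : 0 <= b -> 0 <= z -> `|h| < 1 / 32 ->
  psum h (heat_coef b z) = (1 + h) `^ (- b) * expR (- (z / (1 + h))).
Proof.
move=> b0 z0 h32.
have w := wle_heat_coef b0 z0; set c := heat_coef b z in w *; set A := expR _ in w.
have w16 := wle_pseries_diffs (ltac:(lra) : 0 < 1 / 8 :> R) w.
set D := pseries_diffs c in w16.
have e16 : 1 / 8 / 2 = 1 / 16 :> R by lra.
rewrite e16 in w16.
have x1 (x : R) : `|x| < 1 / 32 -> 0 < 1 + x by rewrite ltr_norml => ?; lra.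
have ode (x : R) : `|x| < 1 / 32 ->
    (1 + x) ^+ 2 * psum x D = (z - b - b * x) * psum x c.
  move=> xlt; have x16 : `|x| <= 1 / 16 by lra.
  have s0 : 0 <= 1 / 16 :> R by lra.
  have w' : wle (1 / 16) c A by apply: wle_shrink w; lra.
  have wSD := wle_shift_seq s0 w16; have wSSD := wle_shift_seq s0 wSD.
  have wSc := wle_shift_seq s0 w'.
  have sD := psum_shift_seq x16 w16.
  have sSD := psum_shift_seq x16 wSD.
  have sc := psum_shift_seq x16 w'.
  have := psumD x16 (wleD s0 w16 (wleZ 2 wSD)) wSSD.
  rewrite (psumD x16 w16 (wleZ 2 wSD)) (psumZ 2 x16 wSD) sSD sD.
  have := psumB x16 (wleZ (z - b) w') (wleZ b wSc).
  rewrite (psumZ (z - b) x16 w') (psumZ b x16 wSc) sc => e1 e2.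
  have -> : (1 + x) ^+ 2 * psum x D = psum x D + 2 * (x * psum x D) + x * (x * psum x D).
    by ring.
  rewrite -e2 mulrBl -[b * x * _]mulrA -e1.
  apply: psum_eq => n; rewrite {1}/D /pseries_diffs heat_coefS -/c.
  case: n => [|[|n]] /=; rewrite /D /pseries_diffs /=; first by ring.
    by ring.
  by rewrite -!natr1; ring.
pose g (x : R) := psum x c * ((1 + x) `^ b * expR (z / (1 + x))).
have dg (x : R) : `|x| < 1 / 32 -> is_derive x (1 : R) g 0.
  move=> xlt.
  have x0 := x1 _ xlt; have xn0 : 1 + x != 0 by rewrite gt_eqF.
  have d1 : is_derive x (1 : R) (fun y : R => 1 + y) 1.
    by rewrite -[X in is_derive _ _ _ X]add0r; exact: is_deriveD.
  have dV : is_derive x (1 : R) (fun y : R => (1 + y)^-1) (- (1 + x) ^- 2 *: 1).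
    exact: is_deriveV.
  have dz : is_derive x (1 : R) (fun y : R => z / (1 + y)) (z * - (1 + x) ^- 2).
    have := @is_deriveZ _ _ _ _ z _ _ _ dV.
    by rewrite [(- _)%:A]mulr1.
  have dpow : is_derive x (1 : R) ((fun y : R => y `^ b) \o (fun y : R => 1 + y))
      (b * (1 + x) `^ (b - 1) * 1).
    by apply: is_derive1_comp; exact: is_derive1_powR.
  have dexp : is_derive x (1 : R) (expR \o (fun y : R => z / (1 + y)))
     (expR (z / (1 + x)) * (z * - (1 + x) ^- 2)).
    exact: is_derive1_comp.
  have dc : is_derive x (1 : R) (fun y : R => psum y c) (psum x D).
    by apply: is_derive_psum w _; lra.
  rewrite (_ : g = (fun y : R => psum y c) * (((fun y : R => y `^ b) \o (fun y : R => 1 + y)) *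
    (expR \o (fun y : R => z / (1 + y)))))//.
  apply: is_derive_eq; rewrite /= /GRing.scale /= ?fctE /= mulr1.
  have := ode x xlt.
  have -> : (1 + x) `^ b = (1 + x) `^ (b - 1) * (1 + x).
    have := @powRD _ (1 + x) (b - 1) 1; rewrite subrK (powRr1 (ltW x0)) xn0 implybT.
    exact.
  set p := _ `^ _; set E := expR _; set f' := psum x D; set f := psum x c.
  move=> ode'.
  apply: (mulfI xn0); rewrite mulr0.
  rewrite (_ : (1 + x) * _ = p * E * ((1 + x) ^+ 2 * f' - (z - b - b * x) * f)).
    by rewrite ode' subrr mulr0.
  by field.
have g1 : g h = 1.
  rewrite (@derive0_eq _ g (1 / 32) h h32 dg) /g psum_at0 /c /heat_coef /=.
  by rewrite addr0 powR1 divr1 mul1r -expRD addNr expR0.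
have := x1 _ h32 => h1.
move: g1; rewrite /g powRN expRN => g1.
rewrite -invfM -[LHS]mulr1.
rewrite -[X in _ * X](@mulfV _ ((1 + h) `^ b * expR (z / (1 + h)))).
  by rewrite mulrA g1 mul1r.
by rewrite mulf_neq0 ?gt_eqF ?expR_gt0 ?powR_gt0.
Qed.

End heat_coefficients.

(** * Integrals of power series *)

Section dominated_integrals.
Context d (T : measurableType d) (R : realType).
Variables (mu : {measure set T -> \bar R}) (D : set T).
Hypothesis mD : measurable D.
Implicit Types (f g : T -> R) (A : R).

Lemma integrable_ub g A : measurable_fun D g -> (forall x, D x -> 0 <= g x) ->
  (\int[mu]_(x in D) (g x)%:E <= A%:E)%E -> mu.-integrable D (EFin \o g).
Proof.
move=> mg g0 gA; apply/integrableP; split; first exact/measurable_EFinP.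
rewrite (eq_integral (EFin \o g)) => [|x /set_mem xD].
  by rewrite (le_lt_trans gA)// ltry.
by rewrite /= ger0_norm// g0.
Qed.

Lemma integrable_dom f g : measurable_fun D f ->
  (forall x, D x -> `|f x| <= g x) -> mu.-integrable D (EFin \o g) ->
  mu.-integrable D (EFin \o f).
Proof.
move=> mf fg; apply: le_integrable => //; first exact/measurable_EFinP.
move=> x Dx /=; rewrite lee_fin; apply: le_trans (fg x Dx) _.
exact: ler_norm.
Qed.

Lemma Rintegral_ub g A : measurable_fun D g -> (forall x, D x -> 0 <= g x) ->
  (\int[mu]_(x in D) (g x)%:E <= A%:E)%E -> \int[mu]_(x in D) g x <= A.
Proof.
move=> mg g0 gA; rewrite -lee_fin /Rintegral fineK//.
by apply: integrable_fin_num => //; exact: integrable_ub gA.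
Qed.

Lemma norm_Rintegral_le f g A : measurable_fun D f -> measurable_fun D g ->
  (forall x, D x -> `|f x| <= g x) ->
  (\int[mu]_(x in D) (g x)%:E <= A%:E)%E -> `|\int[mu]_(x in D) f x| <= A.
Proof.
move=> mf mg fg gA.
have g0 x : D x -> 0 <= g x by move=> Dx; exact: le_trans (fg x Dx).
have ig := integrable_ub mg g0 gA; have If := integrable_dom mf fg ig.
apply: le_trans (le_normr_Rintegral mD If) _.
apply: le_trans (Rintegral_ub mg g0 gA); apply: le_Rintegral => //.
apply: integrable_dom ig; first exact: measurableT_comp.
by move=> x Dx; rewrite normr_id fg.
Qed.

Lemma Rintegral_sumr (I : Type) (r : seq I) (F : I -> T -> R) :
  (forall i, mu.-integrable D (EFin \o F i)) ->
  \int[mu]_(x in D) (\sum_(i <- r) F i x) = \sum_(i <- r) \int[mu]_(x in D) F i x.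
Proof.
move=> iF; elim: r => [|i r IHr].
  rewrite big_nil; under eq_Rintegral do rewrite big_nil.
  by rewrite Rintegral_cst// mul0r.
rewrite big_cons -IHr -RintegralD//.
  by apply: eq_Rintegral => x _; rewrite big_cons.
have := integrable_sum mD r (P := xpredT) (h := fun i => EFin \o F i) (fun i _ => iF i).
by apply: eq_integrable => // x _ /=; rewrite sumEFin.
Qed.

End dominated_integrals.

Section integral_of_power_series.
Context d (T : measurableType d) (R : realType).
Variables (mu : {measure set T -> \bar R}) (D : set T).
Hypothesis mD : measurable D.
Variables (F : nat -> T -> R) (g : T -> R) (s : R).
Hypothesis s0 : 0 < s.
Hypothesis mF : forall n, measurable_fun D (F n).
Hypothesis mg : measurable_fun D g.
Hypothesis Fg : forall x, D x -> wle s (F^~ x) (g x).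

Lemma measurable_psum h : `|h| <= s ->
  measurable_fun D (fun x => psum h (F^~ x)).
Proof.
move=> hs; apply: (@measurable_fun_cvg _ _ _ _ (fun N x => pseries (F^~ x) h N)).
  move=> N; rewrite /pseries /series /=.
  by apply: measurable_sum => n; apply: measurable_funM.
by move=> x Dx; apply: psum_cvg hs (Fg Dx).
Qed.

Variable A : R.
Hypothesis gA : (\int[mu]_(x in D) (g x)%:E <= A%:E)%E.

Let g0 x : D x -> 0 <= g x.
Proof. by move=> /Fg /wle_ge0. Qed.

Let ig := integrable_ub mg g0 gA.

Lemma integrable_coef n : mu.-integrable D (EFin \o F n).
Proof.
have ig' : mu.-integrable D (EFin \o (fun x => (s ^- n) * g x)).
  by have := integrableZl mD (s ^- n) ig; apply: eq_integrable => // x _ /=; rewrite EFinM.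
apply: integrable_dom ig' => // x Dx.
by rewrite mulrC ler_pdivlMr ?exprn_gt0// (wle_coef n (ltW s0) (Fg Dx)).
Qed.

(** The triangle inequality for integrals, followed by exchanging the finite sum with the integral,
    reduces the bound to the pointwise one. *)
Lemma wle_Rintegral : wle s (fun n => \int[mu]_(x in D) F n x) A.
Proof.
move=> N.
have iN n : mu.-integrable D (EFin \o (fun x => `|F n x| * s ^+ n)).
  have := integrable_abse (integrable_coef n) => /(integrableZr mD (s ^+ n)).
  by apply: eq_integrable => // x _ /=; rewrite EFinM.
apply: (@le_trans _ _ (\int[mu]_(x in D) \sum_(n < N) `|F n x| * s ^+ n)).
  rewrite -(big_mkord xpredT (fun n => `|\int[mu]_(x in D) F n x| * s ^+ n)).
  under [leRHS]eq_Rintegral => x _.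
    rewrite -(big_mkord xpredT (fun n => `|F n x| * s ^+ n)); over.
  rewrite Rintegral_sumr//; apply: ler_sum => n _.
  rewrite RintegralZr//; last exact: (integrable_abse (integrable_coef n)).
  apply: ler_wpM2r; first by rewrite exprn_ge0 ?ltW.
  exact/le_normr_Rintegral/integrable_coef.
apply: le_trans (Rintegral_ub mD mg g0 gA).
apply: le_Rintegral => // [|x Dx]; last exact: Fg.
have := integrable_sum mD (index_enum 'I_N) (P := xpredT)
  (h := fun n : 'I_N => EFin \o (fun x => `|F n x| * s ^+ n)) (fun i _ => iN i).
by apply: eq_integrable => // x _ /=; rewrite sumEFin.
Qed.

Lemma integrable_psum h : `|h| <= s ->
  mu.-integrable D (EFin \o (fun x => psum h (F^~ x))).
Proof.
move=> hs; apply: (integrable_dom mD) ig; first exact: (measurable_psum hs).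
by move=> x Dx; exact: psum_le hs (Fg Dx).
Qed.

(** Dominated convergence: every partial sum is bounded pointwise by the integrable majorant [g]. *)
Lemma psum_Rintegral h : `|h| <= s ->
  psum h (fun n => \int[mu]_(x in D) F n x) = \int[mu]_(x in D) psum h (F^~ x).
Proof.
move=> hs; apply: psumE.
pose f_ N x := pseries (F^~ x) h N.
have mf_ N : measurable_fun D (f_ N).
  rewrite /f_ /pseries /series /=.
  by apply: measurable_sum => n; apply: measurable_funM.
have mfE N : measurable_fun D (fun x => (f_ N x)%:E) by exact/measurable_EFinP.
have mpE : measurable_fun D (fun x => (psum h (F^~ x))%:E).
  exact/measurable_EFinP/(measurable_psum hs).
have fp : {ae mu, forall x, D x ->
    (fun N => (f_ N x)%:E) @ \oo --> (psum h (F^~ x))%:E}.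
  by apply: aeW => x Dx; apply: cvg_EFin; [exact: nearW|exact: psum_cvg hs (Fg Dx)].
have fg : {ae mu, forall x N, D x -> (`|(f_ N x)%:E| <= (EFin \o g) x)%E}.
  by apply: aeW => x N Dx; rewrite /= lee_fin; exact: partial_psum_le hs (Fg Dx).
have [_ _] := dominated_convergence mD mfE mpE fp ig fg.
move=> cv.
have fin : (\int[mu]_(x in D) (psum h (F^~ x))%:E)%E \is a fin_num.
  by apply: integrable_fin_num => //; exact: integrable_psum.
move: cv; rewrite -(fineK fin) => /fine_cvg cv.
rewrite (_ : pseries _ h = (fun N => \int[mu]_(x in D) f_ N x))//.
apply/funext => N; rewrite /f_ /pseries /series /= (Rintegral_sumr mD) => [|n].
  by apply: eq_bigr => n _; rewrite RintegralZr//; exact: integrable_coef.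
have := integrableZr mD (h ^+ n) (integrable_coef n).
by apply: eq_integrable => // x _ /=; rewrite EFinM.
Qed.

End integral_of_power_series.

Section parametrized_integral.
Context d1 d2 (T1 : measurableType d1) (T2 : measurableType d2) (R : realType).
Variable m2 : {sigma_finite_measure set T2 -> \bar R}.

(** The positive and negative parts are measurable in the parameter by Tonelli, so no integrability
    of the slices is required. *)
Lemma measurable_Rintegral_param (F : T1 * T2 -> R) :
  measurable_fun setT F ->
  measurable_fun setT (fun x => \int[m2]_y F (x, y)).
Proof.
move=> mF; apply: measurableT_comp; first exact: fine_measurable.
have mE : measurable_fun setT (EFin \o F) by exact/measurable_EFinP.
rewrite (_ : (fun x => _) = fubini_F m2 (EFin \o F)^\+ \- fubini_F m2 (EFin \o F)^\-)%E.
  apply: emeasurable_funB; apply: measurable_fun_fubini_tonelli_F => //.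
    exact: measurable_funepos.
  exact: measurable_funeneg.
apply/funext => x; rewrite [LHS]integralE /fubini_F; by congr (_ - _)%E;
  apply: eq_integral => y _; rewrite ?funeposE ?funenegE.
Qed.

End parametrized_integral.

(** * The quadratic fixed point equation *)

Section weighted_l1_more.
Variable R : realType.
Implicit Types (s A E : R) (a : nat -> R).

Lemma wle_eq s a a' A : a =1 a' -> wle s a A -> wle s a' A.
Proof. by move=> /funext->. Qed.

(** Without a constant term every weight s^n gains at least one factor s / rho. Shrinking the radius
    thus makes the first Picard step as small as desired. *)
Lemma wle_small s rho a A : 0 <= s -> s <= rho -> 0 < rho -> a 0%N = 0 ->
  wle rho a A -> wle s a (s / rho * A).
Proof.
move=> s0 srho rho0 a0 aA N.
apply: le_trans (_ : \sum_(n < N) s / rho * (`|a n| * rho ^+ n) <= _).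
  apply: ler_sum => -[[|n] /= _] _; first by rewrite a0 normr0 !(mul0r, mulr0).
  rewrite mulrCA ler_wpM2l// !exprS.
  have -> : s / rho * (rho * rho ^+ n) = s * rho ^+ n.
    by rewrite mulrA divfK// gt_eqF.
  by rewrite ler_wpM2l// lerXn2r// nnegrE// (le_trans s0).
rewrite -mulr_sumr ler_wpM2l//.
by rewrite divr_ge0// ltW.
Qed.

(** Completeness of weighted l^1. Each coefficient converges by comparison with a geometric series;
    the telescoped bound passes to the limit because it only involves finite sums. *)
Lemma wle_complete s E (b : nat -> nat -> R) : 0 < s ->
  (forall k, wle s (fun n => b k.+1 n - b k n) (E * 2^-1 ^+ k)) ->
  forall k, wle s (fun n => limn (b^~ n) - b k n) (2 * E * 2^-1 ^+ k).
Proof.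
move=> s0 bE.
have E0 : 0 <= E by have := wle_ge0 (bE 0%N); rewrite mulr1.
have tele k m : wle s (fun n => b (k + m)%N n - b k n)
    (E * 2^-1 ^+ k * (2 - 2 * 2^-1 ^+ m)).
  elim: m => [|m IHm].
    move=> N; rewrite big1 => [|n _]; last by rewrite addn0 subrr normr0 mul0r.
    by rewrite mulr1 subrr mulr0.
  have e n : (b (k + m)%N n - b k n) + (b (k + m).+1 n - b (k + m)%N n) =
      b (k + m.+1)%N n - b k n by rewrite addnS; ring.
  apply: wle_eq e _; apply: wle_trans (wleD (ltW s0) IHm (bE (k + m)%N)) _.
  rewrite exprD exprS.
  by rewrite le_eqVlt; apply/orP; left; apply/eqP; field.
have b_cvg n : cvgn (b^~ n).
  have -> : b^~ n = (fun k => b 0%N n + series (fun l => b l.+1 n - b l n) k).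
    apply/funext => k; rewrite /series /= telescope_sumr//.
    by rewrite addrC subrK.
  apply: is_cvgD; first exact: is_cvg_cst.
  apply: normed_cvg.
  apply: (@series_le_cvg _ _ (geometric (E / s ^+ n) 2^-1)).
  - by move=> l; exact: normr_ge0.
  - by move=> l; rewrite /= mulr_ge0// ?exprn_ge0// divr_ge0// exprn_ge0// ltW.
  - move=> l /=; rewrite mulrAC ler_pdivlMr ?exprn_gt0//.
    exact: (wle_coef n (ltW s0) (bE l)).
  - apply: is_cvg_geometric_series; rewrite ger0_norm//; lra.
move=> k N.
have cv : (fun m => \sum_(n < N) `|b (m + k)%N n - b k n| * s ^+ n) @ \oo -->
    \sum_(n < N) `|limn (b^~ n) - b k n| * s ^+ n.
  apply: cvg_big => [x|n _]; first exact: add_continuous.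
  apply: cvgMl; apply: cvg_norm; apply: cvgB; last exact: cvg_cst.
  exact: (cvg_comp _ _ (@cvg_addnr k) (b_cvg n)).
apply: (cvgr_to_le cv).
apply: nearW => m; rewrite addnC; apply: le_trans (tele k m N) _.
rewrite (_ : 2 * E * _ = E * 2^-1 ^+ k * 2); last by ring.
apply: ler_wpM2l; first by rewrite mulr_ge0// exprn_ge0.
by rewrite lerBlDr lerDl mulr_ge0// exprn_ge0.
Qed.

End weighted_l1_more.

(** * Picard iteration on coefficients with an exponential time weight *)

Section picard.
Context dz (Z : measurableType dz) (R : realType).
Variables (nu : {sigma_finite_measure set Z -> \bar R}) (I : finType) (tau : Z -> R).
Variables (K : I -> I -> I -> nat -> Z * Z -> R) (Kh : Z * Z -> R).
Variables (f : nat -> Z -> I -> R) (u : Z -> I -> R) (rho C Cu : R).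

Let dom p := 0 < tau p <= 1.

Hypothesis mtau : measurable_fun setT tau.
Hypothesis rho0 : 0 < rho.
Hypothesis mK : forall i j k n, measurable_fun setT (K i j k n).
Hypothesis mKh : measurable_fun setT Kh.
Hypothesis KKh : forall i j k q, wle rho (fun n => K i j k n q) (Kh q).
Hypothesis Kz : forall i j k n p z, ~~ (0 < tau z < tau p) -> K i j k n (p, z) = 0.
(** The Volterra smallness: a large exponential weight in time makes the kernel arbitrarily small on
    the whole time interval, so that no stepping in time is needed. *)
Hypothesis Kint : forall eta, 0 < eta -> exists2 M, 0 <= M &
  forall p, dom p -> (\int[nu]_z (Kh (p, z) * expR (M * tau z))%:E
                      <= (eta * expR (M * tau p))%:E)%E.
Hypothesis mf : forall n i, measurable_fun setT (fun p => f n p i).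
Hypothesis wf : forall p i, dom p -> wle rho (fun n => f n p i) C.
Hypothesis mu : forall i, measurable_fun setT (fun p => u p i).
Hypothesis uC : forall p i, `|u p i| <= Cu.
(** At h = 0 a solution is already given. It is the starting point of the iteration, and thereby the
    constant term of the series. *)
Hypothesis u_eq : forall p i, dom p -> u p i = f 0%N p i -
  \sum_j \sum_k \int[nu]_z (K i j k 0%N (p, z) * (u z j * u z k)).

(** [op], [sq] and [Phi] are, coefficient by coefficient in h, the integral operator, the product of
    two components of the unknown, and the right-hand side of the equation. *)
Let op i j k (w : nat -> Z -> R) n p :=
  \int[nu]_z conv (fun m => K i j k m (p, z)) (w^~ z) n.

Let sq (a : nat -> Z -> I -> R) j k n z :=
  conv (fun m => a m z j) (fun m => a m z k) n.

Let Phi a n p i := f n p i - \sum_j \sum_k op i j k (sq a j k) n p.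

Let measurable_op i j k w n : (forall m, measurable_fun setT (w m)) ->
  measurable_fun setT (op i j k w n).
Proof.
move=> mw.
apply: (@measurable_Rintegral_param _ _ _ _ _ nu
  (fun q => conv (fun m => K i j k m q) (w^~ q.2) n)).
apply: measurable_sum => m; apply: measurable_funM => //.
exact: measurableT_comp.
Qed.

Let measurable_sq a j k n : (forall m i, measurable_fun setT (fun z => a m z i)) ->
  measurable_fun setT (sq a j k n).
Proof. by move=> ma; apply: measurable_sum => m; apply: measurable_funM. Qed.

Let measurable_Phi a n i : (forall m i, measurable_fun setT (fun z => a m z i)) ->
  measurable_fun setT (fun p => Phi a n p i).
Proof.
move=> ma; apply: measurable_funB => //.
apply: measurable_sum => j; apply: measurable_sum => k.
by apply: measurable_op => m; exact: measurable_sq.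
Qed.

Let mKp i j k n p : measurable_fun setT (fun z => K i j k n (p, z)).
Proof. exact: measurableT_comp. Qed.

Let mconv i j k w n p : (forall m, measurable_fun setT (w m)) ->
  measurable_fun setT (fun z => conv (fun m => K i j k m (p, z)) (w^~ z) n).
Proof. by move=> mw; apply: measurable_sum => m; apply: measurable_funM. Qed.

Section time_weight.
Variables (M eta : R).
Hypothesis M0 : 0 <= M.
Hypothesis eta0 : 0 <= eta.
Hypothesis HM : forall p, dom p -> (\int[nu]_z (Kh (p, z) * expR (M * tau z))%:E
  <= (eta * expR (M * tau p))%:E)%E.

Let g p B z := B * (Kh (p, z) * expR (M * tau z)).

Let mg p B : measurable_fun setT (g p B).
Proof.
apply: measurable_funM => //; apply: measurable_funM.
  exact: measurableT_comp.
by apply: measurableT_comp => //; exact: measurable_funM.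
Qed.

(** The sign of [Kh] comes from its role as a majorant, and this takes an index; the argument [i]
    witnesses that [I] is inhabited. *)
Let Kh0 q (i : I) : 0 <= Kh q.
Proof. exact: wle_ge0 (KKh i i i q). Qed.

Let g_int p B (i : I) : 0 <= B -> dom p ->
  (\int[nu]_z (g p B z)%:E <= (B * (eta * expR (M * tau p)))%:E)%E.
Proof.
move=> B0 dp; rewrite (eq_integral (fun z => B%:E * (g p 1 z)%:E))%E; last first.
  by move=> z _; rewrite -EFinM /g mul1r.
rewrite ge0_integralZl//.
- by rewrite EFinM lee_wpmul2l//; under eq_integral do rewrite /g mul1r; exact: HM.
- exact/measurable_EFinP.
- by move=> z _; rewrite lee_fin /g mul1r mulr_ge0 ?expR_ge0 ?(Kh0 _ i).
Qed.

Section op_bounds.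
Variables (s B : R) (w : nat -> Z -> R) (p : Z) (i j k : I).
Hypothesis s0 : 0 < s.
Hypothesis srho : s <= rho.
Hypothesis B0 : 0 <= B.
Hypothesis dp : dom p.
Hypothesis mw : forall m, measurable_fun setT (w m).
Hypothesis wB : forall z, dom z -> wle s (w^~ z) (B * expR (M * tau z)).

Let wK z : wle s (fun m => K i j k m (p, z)) (Kh (p, z)).
Proof. by apply: wle_shrink srho _; [exact: ltW|]. Qed.

Let K0 z : ~~ (0 < tau z < tau p) -> (fun m => K i j k m (p, z)) = (fun=> 0).
Proof. by move=> zp; apply/funext => m; exact: Kz. Qed.

Let zdom z : 0 < tau z < tau p -> dom z.
Proof.
by move=> /andP[z0 zp]; case/andP: dp => _ p1; rewrite /dom z0 ltW// (lt_le_trans zp).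
Qed.

Let conv0 a : conv (fun=> 0) a = (fun=> 0 : R).
Proof. by apply/funext => m; rewrite /conv big1// => l _; rewrite mul0r. Qed.

(** The bound on [w] is available only on [dom]. Off the causal region the kernel vanishes, so
    nothing has to be known about [w] there. *)
Let opg z : setT z ->
  wle s (fun n => conv (fun m => K i j k m (p, z)) (w^~ z) n) (g p B z).
Proof.
move=> _; case: (boolP (0 < tau z < tau p)) => zp.
  rewrite /g mulrCA; apply: wle_conv; [exact: ltW|exact: wK|].
  exact/wB/zdom.
by rewrite K0// conv0; apply: wle0; rewrite /g !mulr_ge0 ?expR_ge0 ?(Kh0 _ i).
Qed.

Lemma wle_op : wle s (fun n => op i j k w n p) (B * (eta * expR (M * tau p))).
Proof.
apply: (wle_Rintegral measurableT s0 _ (mg p B) opg (g_int i B0 dp)).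
by move=> n; exact: mconv.
Qed.

Lemma integrable_op n : nu.-integrable setT
  (EFin \o (fun z => conv (fun m => K i j k m (p, z)) (w^~ z) n)).
Proof.
apply: (integrable_coef measurableT s0 _ (mg p B) opg (g_int i B0 dp)).
by move=> m; exact: mconv.
Qed.

Lemma integrable_psum_op h : `|h| <= s -> nu.-integrable setT
  (EFin \o (fun z => psum h (fun m => K i j k m (p, z)) * psum h (w^~ z))).
Proof.
move=> hs.
have := @integrable_psum _ _ _ nu setT measurableT _ _ _
  (fun n => mconv i j k n p mw) (mg p B) opg _ (g_int i B0 dp) _ hs.
apply: eq_integrable => // z _ /=; congr EFin.
case: (boolP (0 < tau z < tau p)) => zp.
  by rewrite (psum_conv hs (wK z) (wB (zdom zp))).
by rewrite K0// conv0 psum0 mul0r.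
Qed.

Lemma psum_op h : `|h| <= s -> psum h (fun n => op i j k w n p) =
  \int[nu]_z (psum h (fun m => K i j k m (p, z)) * psum h (w^~ z)).
Proof.
move=> hs.
rewrite (psum_Rintegral measurableT s0 (fun n => mconv i j k n p mw) (mg p B) opg
  (g_int i B0 dp) hs).
apply: eq_Rintegral => z _.
case: (boolP (0 < tau z < tau p)) => zp.
  by rewrite (psum_conv hs (wK z) (wB (zdom zp))).
by rewrite K0// conv0 psum0 mul0r.
Qed.

End op_bounds.

Let opB i j k w w' n p s B B' : 0 < s -> s <= rho -> 0 <= B -> 0 <= B' -> dom p ->
  (forall m, measurable_fun setT (w m)) -> (forall m, measurable_fun setT (w' m)) ->
  (forall z, dom z -> wle s (w^~ z) (B * expR (M * tau z))) ->
  (forall z, dom z -> wle s (w'^~ z) (B' * expR (M * tau z))) ->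
  op i j k w n p - op i j k w' n p = op i j k (fun m z => w m z - w' m z) n p.
Proof.
move=> s0 sr B0 B'0 dp mw mw' wB wB'; rewrite /op -RintegralB//.
- by apply: eq_Rintegral => z _; rewrite convBr.
- exact: integrable_op s0 sr B0 dp mw wB n.
- exact: integrable_op s0 sr B'0 dp mw' wB' n.
Qed.

Hypothesis Cu0 : 0 <= Cu.
(** 2 (Cu + 1) is the Lipschitz constant of a product of two components in the ball of radius Cu +
    1, and the sum over j and k has #|I|^2 terms. The hypothesis makes [Phi] a contraction by 1 /
    2. *)
Hypothesis contr : (#|I| * #|I|)%:R * (eta * (2 * (Cu + 1))) <= 2^-1.

Let expM_ge1 z : dom z -> 1 <= expR (M * tau z).
Proof.
by move=> /andP[z0 _]; rewrite -{1}expR0 ler_expR mulr_ge0// ltW.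
Qed.

Let sum2 (x : R) : \sum_(j : I) \sum_(k : I) x = (#|I| * #|I|)%:R * x.
Proof. by rewrite !sumr_const -mulrnA mulr_natl. Qed.

Let wle_sq s a j k : 0 <= s ->
  (forall z j, dom z -> wle s (fun n => a n z j) (Cu + 1)) ->
  forall z, dom z -> wle s (fun n => sq a j k n z) ((Cu + 1) ^+ 2 * expR (M * tau z)).
Proof.
move=> s0 aB z dz'; apply: wle_trans (wle_conv s0 (aB z j dz') (aB z k dz')) _.
by rewrite -expr2 ler_peMr ?sqr_ge0// expM_ge1.
Qed.

(** Bilinearity: a_j a_k - b_j b_k = (a_j - b_j) a_k + b_j (a_k - b_k). Only the difference carries
    the time weight; the other factor is bounded by Cu + 1. *)
Let Phi_contr s a b e p i : 0 < s -> s <= rho -> dom p -> 0 <= e ->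
  (forall m i, measurable_fun setT (fun z => a m z i)) ->
  (forall m i, measurable_fun setT (fun z => b m z i)) ->
  (forall z j, dom z -> wle s (fun n => a n z j) (Cu + 1)) ->
  (forall z j, dom z -> wle s (fun n => b n z j) (Cu + 1)) ->
  (forall z j, dom z -> wle s (fun n => a n z j - b n z j) (e * expR (M * tau z))) ->
  wle s (fun n => Phi a n p i - Phi b n p i) (e / 2 * expR (M * tau p)).
Proof.
move=> s0 sr dp e0 ma mb aB bB abe.
have c1 : 0 <= (Cu + 1) ^+ 2 by exact: sqr_ge0.
have ms a' j k : (forall m i, measurable_fun setT (fun z => a' m z i)) ->
  forall m, measurable_fun setT (sq a' j k m) by move=> ma' m; exact: measurable_sq.
have PE n : - (\sum_j \sum_k op i j k (fun m z => sq a j k m z - sq b j k m z) n p) =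
    Phi a n p i - Phi b n p i.
  rewrite /Phi opprD opprK addrACA subrr add0r addrC -opprB; congr (- _).
  rewrite -sumrB; apply: eq_bigr => j _; rewrite -sumrB; apply: eq_bigr => k _.
  apply/esym/(opB _ _ _ _ s0 sr c1 c1 dp) => //; [exact: ms|exact: ms| |].
  - exact: wle_sq (ltW s0) aB.
  - exact: wle_sq (ltW s0) bB.
apply: wle_eq PE _; apply: wleN.
have C20 : 0 <= 2 * (Cu + 1) * e by rewrite mulr_ge0// mulr_ge0// addr_ge0.
apply: (@wle_trans _ _ _ (\sum_(j : I) \sum_(k : I)
    2 * (Cu + 1) * e * (eta * expR (M * tau p)))); last first.
  rewrite sum2.
  rewrite (_ : _ * _ = (#|I| * #|I|)%:R * (eta * (2 * (Cu + 1))) *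
    (e * expR (M * tau p))); last by ring.
  rewrite [leRHS](_ : _ = 2^-1 * (e * expR (M * tau p))); last by ring.
  by apply: ler_wpM2r => //; rewrite mulr_ge0// expR_ge0.
apply: wle_sum => [|j]; first exact: ltW.
apply: wle_sum => [|k]; first exact: ltW.
apply: (wle_op _ _ _ s0 sr C20 dp) => [m|z dz'].
  by apply: measurable_funB; exact: ms.
have E n : conv (fun m => a m z j - b m z j) (fun m => a m z k) n +
    conv (fun m => b m z j) (fun m => a m z k - b m z k) n =
    sq a j k n z - sq b j k n z.
  by rewrite convBl convBr /sq; ring.
apply: wle_eq E _.
have := wleD (ltW s0) (wle_conv (ltW s0) (abe z j dz') (aB z k dz'))
  (wle_conv (ltW s0) (bB z j dz') (abe z k dz')).
by move=> /wle_trans; apply; rewrite le_eqVlt; apply/orP; left; apply/eqP; ring.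
Qed.

(** The given solution as a series constant in h. By [u_eq] the constant term of [Phi a0 - a0]
    vanishes, which is what lets a small radius make the first step small. *)
Let a0 (n : nat) (p : Z) (i : I) : R := if n == 0%N then u p i else 0.

Let measurable_a0 n i : measurable_fun setT (fun p => a0 n p i).
Proof. by case: n => [|n]; [exact: mu|exact: measurable_cst]. Qed.

Let wle_a0 s z i : wle s (fun n => a0 n z i) Cu.
Proof. exact: wle_const. Qed.

(** The three terms come from [f], from the quadratic term by means of [contr], and from [a0]. The
    bound is not small; smallness comes only from passing to the radius [sigma]. *)
Let Phi_a0 p i : dom p -> wle rho (fun n => Phi a0 n p i - a0 n p i)
  (C + 2^-1 * (Cu * expR M) + Cu).
Proof.
move=> dp; apply: wleB => //; first exact: ltW.
apply: wleB; [exact: ltW|exact: wf|].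
apply: (@wle_trans _ _ _ (\sum_(j : I) \sum_(k : I)
    Cu * Cu * (eta * expR (M * tau p)))).
  apply: wle_sum => [|j]; first exact: ltW.
  apply: wle_sum => [|k]; first exact: ltW.
  apply: (wle_op _ _ _ rho0 (lexx _) (mulr_ge0 Cu0 Cu0) dp) => [m|z dz'].
    exact: measurable_sq.
  apply: wle_trans (wle_conv (ltW rho0) (wle_a0 _ z j) (wle_a0 _ z k)) _.
  by rewrite ler_peMr ?mulr_ge0// expM_ge1.
rewrite sum2.
have eM : expR (M * tau p) <= expR M.
  by case/andP: dp => p0 p1; rewrite ler_expR ler_piMr.
have eta_le : (#|I| * #|I|)%:R * (eta * Cu) <= 2^-1.
  have le2 : Cu <= 2 * (Cu + 1).
    by rewrite mulrDr -[leLHS]addr0 lerD// ler_peMl// ler1n.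
  by apply: le_trans contr; rewrite ler_wpM2l// ler_wpM2l.
rewrite (_ : _ * _ = (#|I| * #|I|)%:R * (eta * Cu) * (Cu * expR (M * tau p))); last by ring.
by apply: ler_pM => //; rewrite ?mulr_ge0 ?expR_ge0// ler_wpM2l.
Qed.

Let C0 := C + 2^-1 * (Cu * expR M) + Cu.
(** With this radius [eps] equals C0 / (1 + 2 exp(M) C0), so the steps eps exp(M) 2^-k of the
    iteration sum to at most 1 and the iterates cannot leave the unit ball around [a0]. *)
Let sigma := rho / (1 + 2 * (expR M * C0)).
Let eps := sigma / rho * C0.

Section nonempty.
Variable p0 : Z.
Hypothesis dp0 : dom p0.

Let C00 (i : I) : 0 <= C0.
Proof. exact: wle_ge0 (Phi_a0 i dp0). Qed.

Let den (i : I) : 1 <= 1 + 2 * (expR M * C0).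
Proof. by rewrite lerDl mulr_ge0// mulr_ge0 ?expR_ge0// C00. Qed.

Let sigma0 (i : I) : 0 < sigma.
Proof. by rewrite divr_gt0// (lt_le_trans ltr01 (den i)). Qed.

Let sigma_rho (i : I) : sigma <= rho.
Proof.
by rewrite ler_pdivrMr ?(lt_le_trans ltr01 (den i))// ler_peMr ?den// ltW.
Qed.

Let eps_small (i : I) : 0 <= eps /\ 2 * (eps * expR M) <= 1.
Proof.
have d0 := lt_le_trans ltr01 (den i).
rewrite /eps /sigma; split.
  by rewrite mulr_ge0 ?(C00 i)// divr_ge0 ?ltW// divr_gt0.
rewrite [X in X <= _](_ : _ = 2 * (expR M * C0) / (1 + 2 * (expR M * C0))).
  by rewrite ler_pdivrMr// mul1r lerDr.
by field; rewrite !gt_eqF.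
Qed.

Let pic k := iter k Phi a0.

Let measurable_pic k n i : measurable_fun setT (fun p => pic k n p i).
Proof. by elim: k n i => [|k IHk] n i //; exact: measurable_Phi. Qed.

(** The factor 2 - 2 * 2^-k is the sum of 2^-l over l < k, the accumulated length of the first k
    steps. *)
Let ball k : (forall p i, dom p -> wle sigma (fun n => pic k n p i - a0 n p i)
     (eps * (2 - 2 * 2^-1 ^+ k) * expR (M * tau p))) ->
   forall p i, dom p -> wle sigma (fun n => pic k n p i) (Cu + 1).
Proof.
move=> H p i dp.
have E n : a0 n p i + (pic k n p i - a0 n p i) = pic k n p i by ring.
apply: wle_eq E _.
apply: wle_trans (wleD (ltW (sigma0 i)) (wle_a0 _ p i) (H p i dp)) _.
rewrite lerD2l; have [e0 e1] := eps_small i; apply: le_trans e1.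
rewrite (_ : 2 * (eps * expR M) = eps * 2 * expR M); last by ring.
have h0 : 0 <= 2^-1 ^+ k :> R by rewrite exprn_ge0.
have h1 : 2^-1 ^+ k <= 1 :> R by rewrite exprn_ile1//; lra.
apply: ler_pM; rewrite ?expR_ge0//; first by rewrite mulr_ge0//; lra.
  by rewrite ler_wpM2l//; lra.
by case/andP: dp => p0' p1; rewrite ler_expR ler_piMr.
Qed.

(** The two bounds are proved together: contraction at step k + 1 needs both iterates in the ball,
    and their distance from [a0] is the sum of the earlier steps. *)
Let pic_bounds k : 
  (forall p i, dom p -> wle sigma (fun n => pic k n p i - a0 n p i)
     (eps * (2 - 2 * 2^-1 ^+ k) * expR (M * tau p))) /\
  (forall p i, dom p -> wle sigma (fun n => pic k.+1 n p i - pic k n p i)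
     (eps * 2^-1 ^+ k * expR (M * tau p))).
Proof.
elim: k => [|k [IH1 IH2]].
  split=> p i dp.
    have E n : 0 = pic 0 n p i - a0 n p i by rewrite subrr.
    by apply: wle_eq E _; apply: wle0; rewrite expr0 mulr1 subrr mulr0 mul0r.
  rewrite expr0 mulr1.
  apply: (@wle_trans _ _ _ eps); last first.
    by rewrite ler_peMr ?expM_ge1//; case: (eps_small i).
  (* The constant term to be shown zero is exactly the defect of [u] in its own equation. *)
  apply: (wle_small (ltW (sigma0 i)) (sigma_rho i)) => //; last exact: Phi_a0.
  rewrite /pic /= /a0 /= /Phi [u p i](u_eq i dp) -/a0.
  rewrite (_ : \sum_j \sum_k op i j k (sq a0 j k) 0 p = \sum_j \sum_k
     \int[nu]_z (K i j k 0%N (p, z) * (u z j * u z k))) ?subrr//.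
  apply: eq_bigr => j _; apply: eq_bigr => k _; apply: eq_Rintegral => z _.
  by rewrite /conv big_ord1 /sq /conv big_ord1.
have IH1' p i : dom p -> wle sigma (fun n => pic k.+1 n p i - a0 n p i)
     (eps * (2 - 2 * 2^-1 ^+ k.+1) * expR (M * tau p)).
  move=> dp.
  have E n : (pic k n p i - a0 n p i) + (pic k.+1 n p i - pic k n p i) =
    pic k.+1 n p i - a0 n p i by ring.
  apply: wle_eq E _.
  apply: wle_trans (wleD (ltW (sigma0 i)) (IH1 p i dp) (IH2 p i dp)) _.
  by rewrite exprS le_eqVlt; apply/orP; left; apply/eqP; field.
split=> // p i dp.
have [e0 _] := eps_small i.
rewrite (_ : eps * 2^-1 ^+ k.+1 = eps * 2^-1 ^+ k / 2); last by rewrite exprSr mulrA.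
apply: (@Phi_contr sigma (pic k.+1) (pic k)) => //.
- exact: sigma0.
- exact: sigma_rho.
- by rewrite mulr_ge0// exprn_ge0.
- exact: ball IH1'.
- exact: ball IH1.
Qed.

Let pic_ball k p i : dom p -> wle sigma (fun n => pic k n p i) (Cu + 1).
Proof. exact: ball (pic_bounds k).1 p i. Qed.

Let sol n p i := limn (fun k => pic k n p i).

Let sol_pic k p i : dom p -> wle sigma (fun n => sol n p i - pic k n p i)
  (2 * (eps * expR M) * 2^-1 ^+ k).
Proof.
move=> dp; apply: (wle_complete (b := fun k n => pic k n p i) (sigma0 i)) => {}k.
apply: wle_trans ((pic_bounds k).2 p i dp) _.
rewrite mulrAC ler_wpM2r ?exprn_ge0// ler_wpM2l//; first by case: (eps_small i).
by case/andP: dp => p0' p1; rewrite ler_expR ler_piMr.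
Qed.

Section fixed_parameter.
Variables (h T : R) (v : Z -> I -> R).
Hypothesis T1 : T <= 1.
Hypothesis mv : forall i, measurable_fun setT (fun p => v p i).
Hypothesis vC : forall p i, `|v p i| <= Cu.
Hypothesis v_eq : forall p i, 0 < tau p <= T -> v p i = psum h (fun n => f n p i) -
  \sum_j \sum_k \int[nu]_z (psum h (fun m => K i j k m (p, z)) * (v z j * v z k)).

(** Evaluated at [h], the iterates approach any bounded solution [v], with the error halved at each
    step. As [v] is not known to be a series, values are compared instead of coefficients. Causality
    keeps the argument at times below [T], where [v] satisfies the equation. *)
Let pic_v k p i : `|h| <= sigma -> 0 < tau p <= T ->
  `|psum h (fun n => pic k n p i) - v p i| <= 2 * Cu * 2^-1 ^+ k * expR (M * tau p).
Proof.
move=> hs; elim: k p i => [|k IHk] p i pT.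
  have dp : dom p by case/andP: pT => p0' pT'; rewrite /dom p0' (le_trans pT').
  rewrite /pic /= /a0 psum_const expr0 mulr1.
  apply: le_trans (ler_normB _ _) _; apply: le_trans (lerD (uC _ _) (vC _ _)) _.
  rewrite (_ : Cu + Cu = 2 * Cu); last by ring.
  by rewrite ler_peMr ?expM_ge1// mulr_ge0.
have dp : dom p by case/andP: pT => p0' pT'; rewrite /dom p0' (le_trans pT').
have s0 := sigma0 i; have sr := sigma_rho i; have hr := le_trans hs sr.
have c1 : 0 <= (Cu + 1) ^+ 2 by exact: sqr_ge0.
have mpic m l : measurable_fun setT (fun z => pic k m z l) by exact: measurable_pic.
have msq j k' m : measurable_fun setT (sq (pic k) j k' m) by exact: measurable_sq.
have wsq j k' := wle_sq j k' (ltW s0) (fun z j dz' => pic_ball k j dz').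
pose U z j := psum h (fun n => pic k n z j).
have picE : psum h (fun n => pic k.+1 n p i) = psum h (fun n => f n p i) -
  \sum_j \sum_k' \int[nu]_z (psum h (fun m => K i j k' m (p, z)) *
     psum h (fun n => sq (pic k) j k' n z)).
  have wops j k' := wle_op i j k' s0 sr c1 dp (msq j k') (wsq j k').
  have wops1 j := wle_sum (index_enum I) (ltW s0) (wops j).
  have wops2 := wle_sum (index_enum I) (ltW s0) wops1.
  rewrite (psumB hs (wle_shrink (ltW s0) sr (wf i dp)) wops2); congr (_ - _).
  rewrite (psum_sum (index_enum I) (ltW s0) hs wops1); apply: eq_bigr => j _.
  rewrite (psum_sum (index_enum I) (ltW s0) hs (wops j)); apply: eq_bigr => k' _.
  exact: psum_op s0 sr c1 dp (msq j k') (wsq j k') _ hs.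
rewrite picE (v_eq i pT) opprD opprK addrACA subrr add0r addrC -sumrB.
apply: le_trans (ler_norm_sum _ _ _) _.
apply: (@le_trans _ _ (\sum_(j : I) \sum_(k' : I)
   2 * (Cu + 1) * (2 * Cu * 2^-1 ^+ k) * (eta * expR (M * tau p)))); last first.
  rewrite sum2.
  rewrite (_ : _ * _ = (#|I| * #|I|)%:R * (eta * (2 * (Cu + 1))) *
    (2 * Cu * 2^-1 ^+ k * expR (M * tau p))); last by ring.
  rewrite [leRHS](_ : _ = 2^-1 * (2 * Cu * 2^-1 ^+ k * expR (M * tau p))); last first.
    by rewrite exprS; ring.
  by apply: ler_wpM2r => //; rewrite !mulr_ge0 ?exprn_ge0 ?expR_ge0.
apply: ler_sum => j _; rewrite -sumrB.
apply: le_trans (ler_norm_sum _ _ _) _; apply: ler_sum => k' _.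
have wK z : wle sigma (fun m => K i j k' m (p, z)) (Kh (p, z)).
  by apply: wle_shrink sr _; [exact: ltW|].
have zdom z : 0 < tau z < tau p -> dom z /\ 0 < tau z <= T.
  move=> /andP[z0 zp]; case/andP: pT => _ pT'.
  have zT := ltW (lt_le_trans zp pT').
  by rewrite /dom z0 zT (le_trans zT T1).
have mpsK : measurable_fun setT (fun z => psum h (fun m => K i j k' m (p, z))).
  apply: (@measurable_psum _ _ _ setT (fun m z => K i j k' m (p, z)) _ sigma) => //.
  by move=> z _; exact: wK.
have mvv : measurable_fun setT (fun z => psum h (fun m => K i j k' m (p, z)) *
    (v z j * v z k')).
  by apply: measurable_funM => //; exact: measurable_funM.
have Kv z : setT z -> `|psum h (fun m => K i j k' m (p, z)) * (v z j * v z k')| <=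
    g p (Cu ^+ 2) z.
  move=> _; rewrite /g; case: (boolP (0 < tau z < tau p)) => zp; last first.
    rewrite (psum_eq h (fun m => Kz i j k' m zp)) psum0.
    by rewrite mul0r normr0 !mulr_ge0 ?expR_ge0 ?sqr_ge0 ?(Kh0 _ i).
  rewrite normrM [leRHS]mulrCA; apply: ler_pM => //; first exact: psum_le hs (wK z).
  rewrite -[leLHS]mulr1; apply: ler_pM => //; first by rewrite normrM expr2 ler_pM.
  by apply: expM_ge1; case: (zdom z zp).
have iv : nu.-integrable setT (EFin \o (fun z =>
    psum h (fun m => K i j k' m (p, z)) * (v z j * v z k'))).
  apply: (integrable_dom measurableT mvv Kv).
  apply: (integrable_ub (mg p (Cu ^+ 2)) _ (g_int i (sqr_ge0 Cu) dp)) => z _.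
  by rewrite /g !mulr_ge0 ?expR_ge0 ?sqr_ge0 ?(Kh0 _ i).
have iU := integrable_psum_op i j k' s0 sr c1 dp (msq j k') (wsq j k') hs.
rewrite distrC -RintegralB//.
have c2 : 0 <= 2 * (Cu + 1) * (2 * Cu * 2^-1 ^+ k).
  by rewrite !mulr_ge0 ?exprn_ge0 ?addr_ge0.
apply: (norm_Rintegral_le measurableT _ (mg p _) _ (g_int i c2 dp)).
  apply: measurable_funB => //.
  by have /measurable_int/measurable_EFinP := iU.
move=> z _; rewrite -mulrBr.
case: (boolP (0 < tau z < tau p)) => zp; last first.
  rewrite (psum_eq h (fun m => Kz i j k' m zp)) psum0.
  by rewrite mul0r normr0 /g; rewrite mulr_ge0// mulr_ge0 ?expR_ge0 ?(Kh0 _ i).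
have [dz' zT] := zdom z zp.
rewrite /g mulrCA normrM; apply: ler_pM => //; first exact: psum_le hs (wK z).
rewrite (psum_conv hs (pic_ball k j dz') (pic_ball k k' dz')) -!/(U _ _).
have -> : U z j * U z k' - v z j * v z k' =
  (U z j - v z j) * U z k' + v z j * (U z k' - v z k') by ring.
apply: le_trans (ler_normD _ _) _; rewrite !normrM.
have Uk : `|U z k'| <= Cu + 1 by exact: psum_le hs (pic_ball k k' dz').
have vj : `|v z j| <= Cu + 1 by rewrite (le_trans (vC z j))// lerDl.
apply: le_trans (lerD (ler_pM _ _ (IHk z j zT) Uk) (ler_pM _ _ vj (IHk z k' zT))) _ => //.
by rewrite le_eqVlt; apply/orP; left; apply/eqP; ring.
Qed.

(** Both [v] and the sum of the limit series lie within O(2^-k) of the k-th iterate evaluated at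
    [h]. *)
Lemma fixed_point_unique p i : `|h| <= sigma -> 0 < tau p <= T ->
  v p i = psum h (fun n => sol n p i).
Proof.
move=> hs pT.
have dp : dom p by case/andP: pT => p0' pT'; rewrite /dom p0' (le_trans pT').
pose Q := 2 * (eps * expR M) + 2 * Cu * expR (M * tau p).
have key k : `|v p i - psum h (fun n => sol n p i)| <= Q * 2^-1 ^+ k.
  have wsol : wle sigma (fun n => sol n p i)
      (2 * (eps * expR M) * 2^-1 ^+ k + (Cu + 1)).
    have E n : (sol n p i - pic k n p i) + pic k n p i = sol n p i by ring.
    by apply: wle_eq E _; apply: wleD (ltW (sigma0 i)) (sol_pic k i dp) (pic_ball k i dp).
  have -> : v p i - psum h (fun n => sol n p i) =
     - (psum h (fun n => sol n p i - pic k n p i)) - (psum h (fun n => pic k n p i) - v p i).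
    by rewrite (psumB hs wsol (pic_ball k i dp)); ring.
  apply: le_trans (ler_normB _ _) _; rewrite normrN /Q mulrDl; apply: lerD.
    exact: psum_le hs (sol_pic k i dp).
  by apply: le_trans (pic_v k i hs pT) _; rewrite mulrAC.
apply/eqP; rewrite -subr_eq0 -normr_le0.
have cQ : (fun k => Q * 2^-1 ^+ k) @ \oo --> Q * 0.
  by apply: cvgMr; apply: cvg_expr; rewrite ger0_norm//; lra.
rewrite mulr0 in cQ.
by apply: (cvgr_to_ge cQ); exact: nearW.
Qed.

End fixed_parameter.

(** Cu + 2 is the ball radius Cu + 1 of the iterates plus the distance of the limit from the first
    of them, at most 1. *)
Lemma fixed_point_of_weight (i0 : I) : exists (sigma : R) (a : nat -> Z -> I -> R),
  [/\ 0 < sigma, forall p i, dom p -> wle sigma (fun n => a n p i) (Cu + 2) &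
   forall (h T : R) (v : Z -> I -> R), `|h| <= sigma -> T <= 1 ->
     (forall i, measurable_fun setT (fun p => v p i)) ->
     (forall p i, `|v p i| <= Cu) ->
     (forall p i, 0 < tau p <= T -> v p i = psum h (fun n => f n p i) -
       \sum_j \sum_k \int[nu]_z
         (psum h (fun m => K i j k m (p, z)) * (v z j * v z k))) ->
     forall p i, 0 < tau p <= T -> v p i = psum h (fun n => a n p i)].
Proof.
exists sigma, sol; split; first exact: sigma0.
  move=> p i dp.
  have E n : (sol n p i - pic 0 n p i) + pic 0 n p i = sol n p i by ring.
  apply: wle_eq E _.
  apply: wle_trans (wleD (ltW (sigma0 i)) (sol_pic 0 i dp) (pic_ball 0 i dp)) _.
  by case: (eps_small i) => _; rewrite expr0; lra.
by move=> h T v hs T1 mv vC v_eq p i pT; exact: (fixed_point_unique T1 mv vC v_eq).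
Qed.

End nonempty.

End time_weight.

(* M makes the linearized map a contraction for the weight exp (- M tau);
   the radius sigma is then chosen so small that the iterates stay in the unit
   ball around u. *)
Lemma analytic_fixed_point (i0 : I) (p0 : Z) : 0 < tau p0 <= 1 ->
  exists (sigma : R) (a : nat -> Z -> I -> R),
  [/\ 0 < sigma, forall p i, 0 < tau p <= 1 -> wle sigma (fun n => a n p i) (Cu + 2) &
   forall (h T : R) (v : Z -> I -> R), `|h| <= sigma -> T <= 1 ->
     (forall i, measurable_fun setT (fun p => v p i)) ->
     (forall p i, `|v p i| <= Cu) ->
     (forall p i, 0 < tau p <= T -> v p i = psum h (fun n => f n p i) -
       \sum_j \sum_k \int[nu]_z
         (psum h (fun m => K i j k m (p, z)) * (v z j * v z k))) ->
     forall p i, 0 < tau p <= T -> v p i = psum h (fun n => a n p i)].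
Proof.
move=> dp0.
have Cu0 : 0 <= Cu by apply: le_trans (uC p0 i0).
pose c := (#|I| * #|I|)%:R * (2 * (Cu + 1)).
have c0 : 0 <= c by rewrite !mulr_ge0// addr_ge0.
have c1 : 0 < 2 * (c + 1) by rewrite mulr_gt0// ltr_wpDl.
(* The required product is then c / (2 (c + 1)) <= 1 / 2; adding 1 keeps the denominator
   positive. *)
pose eta := (2 * (c + 1))^-1.
have eta0 : 0 < eta by rewrite invr_gt0.
have [M M0 HM] := Kint eta0.
apply: (@fixed_point_of_weight M eta M0 (ltW eta0) HM Cu0 _ p0 dp0 i0).
rewrite (_ : _ * _ = c / (2 * (c + 1))); last by rewrite /eta /c; ring.
by rewrite ler_pdivrMr//; lra.
Qed.

End picard.

(** * Lebesgue and Gaussian integrals *)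

Section improper_integrals.
Variable R : realType.
Notation leb := (@lebesgue_measure R).
Implicit Types (f F : R -> R) (t s a b L : R).

Lemma ge0_FTC2_exhaustion_le f F (A : set R) (a b : nat -> R) L :
  (forall n, a n < b n) -> {homo a : m n / (m <= n)%N >-> n <= m} ->
  {homo b : m n / (m <= n)%N >-> m <= n} -> A = \bigcup_n `[a n, b n]%classic ->
  (forall x, A x -> is_derive x (1 : R) F (f x)) ->
  (forall x, A x -> derivable f x 1) -> (forall x, A x -> 0 <= f x) ->
  (forall n, F (b n) - F (a n) <= L) ->
  (\int[leb]_(x in A) (f x)%:E <= L%:E)%E.
Proof.
move=> ab a_dec b_inc AE dF df f0 FL.
have An n x : a n <= x <= b n -> A x by rewrite AE => xn; exists n; rewrite //= in_itv.
have cf n : {within `[a n, b n], continuous f}.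
  by apply: derivable_within_continuous => x; rewrite in_itv/= => /An; exact: df.
have cF x : A x -> {for x, continuous F}.
  by move=> /dF[dFx _]; apply/differentiable_continuous/derivable1_diffP.
have int_n n : (\int[leb]_(x in `[a n, b n]) (f x)%:E <= L%:E)%E.
  rewrite (@continuous_FTC2 _ f F) ?lee_fin//.
    split=> [x||].
    - move=> /subset_itv_oo_cc; rewrite /= in_itv/= => /An /dF; by case.
    - by apply: cvg_at_right_filter; apply: cF; apply: (An n); rewrite lexx ltW.
    - by apply: cvg_at_left_filter; apply: cF; apply: (An n); rewrite lexx ltW.
  move=> x /subset_itv_oo_cc; rewrite /= in_itv/= => /An /dF [_ <-].
  by rewrite derive1E.
have cv : (fun n => \int[leb]_(x in `[a n, b n]) (f x)%:E)%E @ \oo -->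
    (\int[leb]_(x in \bigcup_n `[a n, b n]%classic) (f x)%:E)%E.
  apply: ge0_nondecreasing_set_cvg_integral => //.
  - move=> m n mn; rewrite subsetEset; apply: subset_itvScc; rewrite bnd_simp.
      exact: a_dec.
    exact: b_inc.
  - by move=> n; apply/measurable_EFinP; apply: subspace_continuous_measurable_fun.
  - by move=> n x /=; rewrite in_itv/= lee_fin => /An; exact: f0.
rewrite AE; apply: (cvge_to_le cv); exact: nearW.
Qed.

Let sq_powR (x : R) : 0 < x ->
  is_derive x (1 : R) (fun y : R => - 2 * y `^ (- 2^-1)) (x `^ (- (3 / 2))).
Proof.
move=> x0.
have := @is_deriveZ _ _ _ (fun y : R => y `^ (- 2^-1)) (- 2) x 1 _ (is_derive1_powR (- 2^-1) x0).
rewrite (_ : - 2^-1 - 1 = - (3 / 2)); last by field.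
by rewrite /GRing.scale /= mulrA mulrNN divff// mul1r.
Qed.

Lemma integral_powRN32 (t : R) : 0 < t ->
  (\int[leb]_(s in `]t, +oo[) (s `^ (- (3 / 2)))%:E <= (2 * t `^ (- 2^-1))%:E)%E.
Proof.
move=> t0.
have itp x : x \in `]t, +oo[%classic -> 0 < x.
  by rewrite inE/= in_itv/= andbT; exact: lt_trans.
apply: (@ge0_FTC2_exhaustion_le _ (fun s => - 2 * s `^ (- 2^-1)) _
    (fun n => t + n.+1%:R^-1) (fun n => t + n.+2%:R)).
- by move=> n; rewrite ltrD2l (@le_lt_trans _ _ 1)// ?invf_le1// ?ler1n// ltr1n.
- by move=> m n mn; rewrite lerD2l lef_pV2// ?posrE// ler_nat.
- by move=> m n mn; rewrite lerD2l ler_nat.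
- apply/seteqP; split=> x /=; rewrite in_itv/= ?andbT; last first.
    case=> n _; rewrite /= in_itv/= => /andP[+ _]; apply: lt_le_trans.
    by rewrite ltrDl.
  move=> tx.
  have xt0 : 0 < x - t by rewrite subr_gt0.
  near \oo => n; exists n => //=; rewrite in_itv/=; apply/andP; split.
    rewrite -lerBrDl ltW//; near: n; exact: (near_infty_natSinv_lt (PosNum xt0)).
  rewrite -lerBlDl (@le_trans _ _ n%:R) ?ler_nat//; last by rewrite leqW.
  by near: n; exact: nbhs_infty_ger.
- by move=> x /mem_set/itp; exact: sq_powR.
- by move=> x /mem_set/itp x0; apply: derivable_powR; rewrite in_itv/= andbT.
- by move=> x _; exact: powR_ge0.
- move=> n; rewrite !mulNr opprK addrC lerBlDr ler_wpDr ?mulr_ge0 ?powR_ge0//.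
  rewrite ler_wpM2l// !powRN lef_pV2 ?posrE ?powR_gt0 ?ltr_wpDr//.
  by rewrite ge0_ler_powR ?nnegrE ?lerDl ?invr_ge0 ?addr_ge0 ?(ltW t0).
Unshelve. all: by end_near. Qed.

Let powR_le1 (x p : R) : 0 <= p -> 0 <= x -> x <= 1 -> x `^ p <= 1.
Proof.
move=> p0 x0 x1.
by have := @ge0_ler_powR _ p p0 x 1; rewrite !nnegrE powR1; exact.
Qed.

Lemma integral_powRN34 t : 0 < t <= 1 ->
  (\int[leb]_(s in `]0%R, t[) ((t - s) `^ (- (3 / 4)))%:E <= 4%:E)%E.
Proof.
move=> /andP[t0 t1].
have itp x : x \in `]0%R, t[%classic -> 0 < t - x.
  by rewrite inE/= in_itv/= subr_gt0 => /andP[].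
have dsub x : is_derive x (1 : R) (fun y : R => t - y) (- 1).
  rewrite -[X in is_derive _ _ _ X]add0r.
  exact: (@is_deriveB _ _ _ (cst t) id).
(* With n + 3 the two cut-offs are at most a third of the interval, so the left endpoint stays below
   the right one from n = 0 on. *)
apply: (@ge0_FTC2_exhaustion_le _ (fun s => - 4 * (t - s) `^ (4^-1)) _
    (fun n => t * n.+3%:R^-1) (fun n => t * (1 - n.+3%:R^-1))).
- move=> n; have n3 : n.+3%:R^-1 <= 3^-1 :> R by rewrite lef_pV2 ?posrE// ler_nat.
  by move: n3; set w := n.+3%:R^-1 => n3; rewrite ltr_pM2l//; lra.
- by move=> m n mn; rewrite ler_pM2l// lef_pV2// ?posrE// ler_nat.
- by move=> m n mn; rewrite ler_pM2l// lerB// lef_pV2// ?posrE// ler_nat.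
- apply/seteqP; split=> x /=; rewrite in_itv/=; last first.
    case=> n _; rewrite /= in_itv/= => /andP[h1 h2]; apply/andP; split.
      by apply: lt_le_trans h1; rewrite mulr_gt0// invr_gt0.
    by apply: le_lt_trans h2 _; rewrite -[ltRHS]mulr1 ltr_pM2l//.
  move=> /andP[x0 xt].
  have xt0 : 0 < x / t by rewrite divr_gt0.
  have xt1 : 0 < 1 - x / t by rewrite subr_gt0 ltr_pdivrMr// mul1r.
  have le3 n : n.+3%:R^-1 <= n.+1%:R^-1 :> R.
    by rewrite lef_pV2 ?posrE// ler_nat ltnS leqW// leqW.
  near \oo => n; exists n => //=; rewrite in_itv/=; apply/andP; split.
    rewrite mulrC -ler_pdivlMr// (le_trans (le3 n))// ltW//.
    by near: n; exact: (near_infty_natSinv_lt (PosNum xt0)).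
  rewrite mulrC -ler_pdivrMr// lerBrDr addrC -lerBrDr (le_trans (le3 n))// ltW//.
  by near: n; exact: (near_infty_natSinv_lt (PosNum xt1)).
- move=> x /mem_set/itp x0.
  have d1 := is_derive1_powR 4^-1 x0.
  have := @is_deriveZ _ _ _ _ (- 4) _ _ _
    (@is_derive1_comp R (fun y => y `^ 4^-1) (fun y => t - y) x _ _ d1 (dsub x)).
  rewrite (_ : 4^-1 - 1 = - (3 / 4)); last by field.
  rewrite /GRing.scale /= (_ : - 4 * _ = (t - x) `^ (- (3 / 4))); last by field.
  by [].
- move=> x /mem_set/itp x0.
  have d1 := is_derive1_powR (- (3 / 4)) x0.
  by have [] := @is_derive1_comp R (fun y => y `^ (- (3 / 4))) (fun y => t - y) x _ _ d1 (dsub x).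
- by move=> x _; exact: powR_ge0.
- move=> n; rewrite !mulNr opprK addrC lerBlDr ler_wpDr ?mulr_ge0 ?powR_ge0//.
  have n1 : n.+3%:R^-1 <= 1 :> R by rewrite invf_le1// ler1n.
  rewrite -[leRHS]mulr1 ler_wpM2l//; apply: powR_le1 => //.
    by rewrite subr_ge0 ler_piMr// ltW.
  by rewrite (le_trans _ t1)// lerBlDr lerDl mulr_ge0 ?(ltW t0)// invr_ge0.
Unshelve. all: by end_near. Qed.

(* exp (- M r) <= (M r)^(-1/4) trades the smallness in M for an integrable
   singularity. *)
Lemma weighted_powRN12_small (C eta : R) : 0 <= C -> 0 < eta -> exists2 M, 0 <= M &
  forall t, 0 < t <= 1 ->
  (\int[leb]_(s in `]0%R, t[) (C * (t - s) `^ (- 2^-1) * expR (M * s))%:E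
    <= (eta * expR (M * t))%:E)%E.
Proof.
(* The integral of (t - s)^(-3/4) is at most 4, so 4 C / q <= eta is what is needed. M = q^4 makes
   (M r)^(1/4) equal to q r^(1/4). *)
move=> C0 eta0; pose q := 4 * C / eta + 1.
have q0 : 0 < q by rewrite ltr_wpDl// divr_ge0 ?(ltW eta0)// mulr_ge0.
pose M := q ^+ 4; have M0 : 0 < M by rewrite exprn_gt0.
exists M => [|t t01]; first exact: ltW.
have mpow p : measurable_fun `]0%R, t[ (fun s : R => (t - s) `^ p).
  apply: measurable_funTS; apply: (measurableT_comp (measurable_powR p)).
  exact: measurable_funB.
apply: (@le_trans _ _ (\int[leb]_(s in `]0%R, t[)
    ((C * q^-1 * expR (M * t))%:E * ((t - s) `^ (- (3 / 4)))%:E))%E).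
  apply: ge0_le_integral => //.
  - by move=> s _; rewrite lee_fin !mulr_ge0 ?powR_ge0 ?expR_ge0.
  - apply/measurable_EFinP; apply: measurable_funM.
      by apply: measurable_funM; [exact: measurable_cst|exact: mpow].
    by apply: measurableT_comp => //; exact: measurable_funM.
  - by apply/measurable_EFinP; apply: measurable_funM; [exact: measurable_cst|exact: mpow].
  move=> s /=; rewrite in_itv/= => /andP[s0 st]; rewrite lee_fin.
  pose r := t - s; have r0 : 0 < r by rewrite subr_gt0.
  rewrite (_ : M * s = M * t - M * r); last by rewrite /r; ring.
  rewrite expRD -/r.
  have eMr : expR (- (M * r)) <= q^-1 * r `^ (- 4^-1).
    have Mr0 : 0 < M * r by rewrite mulr_gt0.
    rewrite expRN powRN -invfM lef_pV2 ?posrE ?expR_gt0 ?mulr_gt0 ?powR_gt0//.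
    have -> : q * r `^ 4^-1 = (M * r) `^ 4^-1.
      rewrite powRM ?ltW//; congr (_ * _).
      by rewrite /M -powR_mulrn ?ltW// -powRrM divff// powRr1 ?ltW.
    (* For y >= 0, y^(1/4) <= 1 + y <= exp(y), split according to whether y exceeds 1. *)
    apply: (@le_trans _ _ (1 + M * r)); last exact: expR_ge1Dx.
    have [Mr1|Mr1] := leP (M * r) 1.
      by rewrite ler_wpDr ?(ltW Mr0)// powR_le1// ltW.
    by rewrite ler_wpDl// ler1_powR ?ltW//; lra.
  rewrite (_ : r `^ (- (3 / 4)) = r `^ (- 2^-1) * r `^ (- 4^-1)); last first.
    rewrite -powRD ?(gt_eqF r0) ?implybT//; congr (_ `^ _); by field.
  rewrite [leRHS](_ : _ = C * r `^ (- 2^-1) *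
    (expR (M * t) * (q^-1 * r `^ (- 4^-1)))); last by ring.
  by rewrite ler_wpM2l ?mulr_ge0 ?powR_ge0// ler_wpM2l// expR_ge0.
rewrite ge0_integralZl//.
- rewrite (@le_trans _ _ ((C * q^-1 * expR (M * t))%:E * 4%:E)%E)//.
    apply: lee_wpmul2l; last exact: integral_powRN34.
    by rewrite lee_fin !mulr_ge0 ?expR_ge0// invr_ge0 ltW.
  rewrite -EFinM lee_fin mulrAC ler_wpM2r ?expR_ge0//.
  rewrite mulrAC ler_pdivrMr// (_ : eta * q = 4 * C + eta).
    by rewrite mulrC lerDl ltW.
  by rewrite /q; field; rewrite gt_eqF.
- apply/measurable_EFinP.
  exact: mpow.
- by move=> s _; rewrite lee_fin powR_ge0.
- by rewrite lee_fin !mulr_ge0 ?expR_ge0// invr_ge0 ltW.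
Qed.

End improper_integrals.

(** * Change of variables under dilation of the line *)

Section lebesgue_scaling.
Variable R : realType.
Notation leb := (@lebesgue_measure R).

(** The image of Lebesgue measure under multiplication by [l], multiplied by [l], has the right
    value on intervals, and so it is Lebesgue measure by uniqueness. *)
Lemma ge0_integral_lebesgue_scale (l : R) (f : R -> \bar R) : 0 < l ->
  measurable_fun setT f -> (forall x, 0 <= f x)%E ->
  (\int[leb]_x f x = l%:E * \int[leb]_x f (l * x)%R)%E.
Proof.
move=> l0 mf f0.
have ml : measurable_fun (@setT (measurableTypeR R)) ( *%R l : R -> measurableTypeR R).
  exact: measurable_funM.
have mf' : measurable_fun setT (f \o *%R l) by exact: measurableT_comp.
pose nnl : {nonneg R} := NngNum (ltW l0).
have mfp : measurable_fun (@setT (measurableTypeR R)) f by [].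
have := ge0_integral_pushforward ml leb measurableT mfp (fun x _ => f0 x).
rewrite preimage_setT => <-.
rewrite -[X in X%:E]/(nnl%:num) -ge0_integral_mscale//.
apply: eq_measure_integral => A mA _.
apply: lebesgue_measure_unique => // _ [[a b]] _ <-.
transitivity (l%:E * leb ( *%R l @^-1` `]a, b]%classic))%E; last by [].
rewrite (_ : _ @^-1` _ = `]a / l, b / l]%classic); last first.
  by apply/seteqP; split=> x /=; rewrite !in_itv/= ltr_pdivrMr// ler_pdivlMr// mulrC.
rewrite !lebesgue_measure_itv/= !lte_fin ltr_pM2r ?invr_gt0//.
case: ifP => _; last by rewrite mule0.
by rewrite -!EFinD -EFinM -mulrBl mulrC divfK// gt_eqF.
Qed.

(** Infinite values are included, so dilation of a real integral holds for every measurable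
    integrand, integrable or not. *)
Let fine_scaleB (l : R) (x y : \bar R) : 0 < l ->
  fine (l%:E * x - l%:E * y) = l * fine (x - y).
Proof.
move=> l0; case: x y => [x||] [y||] /=;
  rewrite ?(gt0_muley, gt0_muleNy) ?lte_fin//= ?mulr0//.
by rewrite mulrBr.
Qed.

Lemma Rintegral_lebesgue_scale (l : R) (D : set R) (f : R -> R) : 0 < l ->
  measurable D -> measurable_fun D f ->
  \int[leb]_(x in D) f x = l * \int[leb]_(x in *%R l @^-1` D) f (l * x).
Proof.
move=> l0 mD mf; pose g := f \_ D.
have mg : measurable_fun setT (EFin \o g).
  by apply/measurable_EFinP/(measurable_restrictT _ mD).
rewrite [LHS]Rintegral_mkcond [X in _ * X]Rintegral_mkcond.
have -> : (fun x => f (l * x)) \_ ( *%R l @^-1` D) = fun x => g (l * x).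
  by apply/funext => x; rewrite /g /patch; congr (if _ then _ else _); rewrite !inE.
rewrite /Rintegral [X in fine X]integralE [X in _ * fine X]integralE.
rewrite -fine_scaleB//; congr (fine (_ - _)).
- rewrite (@ge0_integral_lebesgue_scale l (EFin \o g)^\+%E)//; last exact: measurable_funepos.
  by congr (_ * _)%E; apply: eq_integral => x _; rewrite !funeposE.
- rewrite (@ge0_integral_lebesgue_scale l (EFin \o g)^\-%E)//; last exact: measurable_funeneg.
  by congr (_ * _)%E; apply: eq_integral => x _; rewrite !funenegE.
Qed.

End lebesgue_scaling.

(** * Gaussian integrals on R^d *)

Section gaussian.
Context {R : realType}.
Notation leb := (@lebesgue_measure R).

Lemma integral_lebesgue_rV_succ n (f : 'rV[R]_n.+1 -> \bar R) :
  measurable_fun setT f -> (forall x, 0 <= f x)%E ->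
  (\int[lebesgue_rV n.+1]_x f x =
   \int[leb]_a \int[lebesgue_rV n]_y f (rV_cons (a, y)))%E.
Proof.
move=> mf f0.
have := ge0_integral_pushforward (@measurable_rV_cons R n)
  (leb \x lebesgue_rV n)%E measurableT mf (fun x _ => f0 x).
rewrite preimage_setT fubini_tonelli1//=.
by apply: measurableT_comp mf _; exact: measurable_rV_cons.
Qed.

Lemma integral_lebesgue_rV_prod n (f : 'I_n -> R -> R) (c : 'I_n -> R) :
  (forall i, measurable_fun setT (f i)) -> (forall i x, 0 <= f i x) ->
  (forall i, (\int[leb]_r (f i r)%:E = (c i)%:E)%E) ->
  (\int[lebesgue_rV n]_x (\prod_i f i (x 0 i))%:E = (\prod_i c i)%:E)%E.
Proof.
elim: n f c => [|n IHn] f c mf f0 fc.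
  rewrite /= integral_dirac//.
    by rewrite diracT mul1e !big_ord0.
  apply/measurable_EFinP; rewrite (_ : (fun _ => _) = cst 1)//.
  by apply/funext => x; rewrite big_ord0.
rewrite integral_lebesgue_rV_succ; first last.
- by move=> x; rewrite lee_fin; apply: prodr_ge0.
- apply/measurable_EFinP; apply: measurable_prod => i _.
  by apply: measurableT_comp (mf i) _; exact: measurable_entry.
transitivity (\int[leb]_a ((\prod_(i < n) c (lift ord0 i))%:E * (f ord0 a)%:E))%E.
  apply: eq_integral => a _.
  rewrite -(IHn (fun i => f (lift ord0 i)))//.
  rewrite -ge0_integralZr ?lee_fin//.
  - apply: eq_integral => y _; rewrite big_ord_recl rV_cons0/= mulrC EFinM.
    by congr (_%:E * _)%E; apply: eq_bigr => i _; rewrite rV_consS.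
  - apply/measurable_EFinP; apply: measurable_prod => i _.
    by apply: measurableT_comp (mf _) _; exact: measurable_entry.
  - by move=> y _; rewrite lee_fin; apply: prodr_ge0.
rewrite ge0_integralZl ?lee_fin//.
- by rewrite fc -EFinM mulrC big_ord_recl.
- by apply/measurable_EFinP; exact: mf.
- by move=> x _; rewrite lee_fin.
- apply: prodr_ge0 => i _; rewrite -lee_fin -fc integral_ge0// => x _.
  by rewrite lee_fin.
Qed.

(** With z = |x|^2 / (4 s), the coefficients decay like exp(- 3 z / 4). This Gaussian keeps exp(- z
    / 4) and leaves exp(- z / 2) to absorb the polynomial factors of the kernel derivatives. The
    normalization remains that of the heat kernel. *)
Definition gauss {d} (s : R) (x : 'rV[R]_d) : R :=
  (4 * pi * s) `^ (- (d%:R / 2)) * expR (- (enorm x ^+ 2 / (16 * s))).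

Lemma enorm_sqr d (x : 'rV[R]_d) : enorm x ^+ 2 = \sum_i x 0 i ^+ 2.
Proof. by rewrite sqr_sqrtr// sumr_ge0// => i _; exact: sqr_ge0. Qed.

Lemma powR_Nhalf d (a : R) : 0 <= a -> a `^ (- (d%:R / 2)) = (Num.sqrt a)^-1 ^+ d.
Proof.
by move=> a0; rewrite powRN [d%:R / 2]mulrC powRrM powR12_sqrt// powR_mulrn ?sqrtr_ge0// exprVn.
Qed.

Lemma integral_gauss d (s : R) (x : 'rV[R]_d) : 0 < s ->
  (\int[lebesgue_rV d]_y (gauss s (x - y))%:E = (2 ^+ d)%:E)%E.
Proof.
move=> s0; pose sg := Num.sqrt (8 * s).
have sg2 : sg ^+ 2 = 8 * s by rewrite sqr_sqrtr// mulr_ge0// ltW.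
have sgn0 : sg != 0 by rewrite gt_eqF// sqrtr_gt0 mulr_gt0.
have pi0 := pi_gt0 R.
have a0 : 0 < 4 * pi * s by rewrite !mulr_gt0.
(* The exponent belongs to variance 8 s, whose peak (16 pi s)^(-1/2) is half of (4 pi s)^(-1/2);
   each coordinate thus contributes a factor 2. *)
have peak : (Num.sqrt (4 * pi * s))^-1 = 2 * normal_peak sg.
  rewrite /normal_peak sg2 (_ : 8 * s * pi *+ 2 = 4 * (4 * pi * s)); last by ring.
  have -> : Num.sqrt (4 * (4 * pi * s)) = 2 * Num.sqrt (4 * pi * s).
    rewrite sqrtrM//; congr (_ * _); rewrite (_ : 4 = 2 ^+ 2).
      by rewrite sqrtr_sqr ger0_norm.
    by rewrite expr2 -natrM.
  by rewrite invfM mulrA divff// mul1r.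
rewrite (eq_integral (fun y : 'rV[R]_d =>
    (\prod_i (2 * normal_pdf (x 0 i) sg (y 0 i)))%:E)); last first.
  move=> y _; congr EFin; rewrite /gauss powR_Nhalf ?ltW// peak enorm_sqr.
  rewrite (_ : (2 * normal_peak sg) ^+ d = \prod_(i < d) (2 * normal_peak sg)); last first.
    by rewrite prodr_const card_ord.
  rewrite mulr_suml -sumrN expR_sum -big_split /=.
  apply: eq_bigr => i _; rewrite normal_pdfE// -mulrA; congr (_ * (_ * _)).
  rewrite /normal_fun sg2 !mxE; congr expR.
  rewrite mulNr -[x 0 i - _]opprB sqrrN; congr (- (_ / _)); by ring.
rewrite (@integral_lebesgue_rV_prod d (fun i r => 2 * normal_pdf (x 0 i) sg r) (fun=> 2)).
- by rewrite prodr_const card_ord.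
- by move=> i; apply: measurable_funM => //; exact: measurable_normal_pdf.
- by move=> i r; rewrite mulr_ge0// normal_pdf_ge0.
move=> i; under eq_integral do rewrite EFinM.
rewrite ge0_integralZl ?lee_fin//.
- by rewrite integral_normal_pdf mule1.
- by apply/measurable_EFinP; exact: measurable_normal_pdf.
- by move=> r _; rewrite lee_fin normal_pdf_ge0.
Qed.

End gaussian.

(** * Heat and Oseen kernels *)

Section directional_derivatives.
Context {R : realType}.

Lemma is_derive_line (V : normedModType R) (f : V -> R) (x v : V) (df : R) :
  is_derive (0 : R) (1 : R) (fun r => f (r *: v + x)) df -> is_derive x v f df.
Proof.
have E : (fun h : R => h^-1 *: (((fun r => f (r *: v + x)) \o shift 0) (h *: 1) -
    f (0 *: v + x))) = (fun h : R => h^-1 *: ((f \o shift x) (h *: v) - f x)).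
  by apply/funext => h /=; rewrite scale0r add0r addr0 [h *: 1]mulr1.
by move=> [d e]; split; [rewrite /derivable -E|rewrite /derive -E].
Qed.

Lemma is_derive_on_line (V : normedModType R) (f df : V -> R) (x v : V) (r : R) :
  (forall y, is_derive y v f (df y)) ->
  is_derive r (1 : R) (fun r => f (r *: v + x)) (df (r *: v + x)).
Proof.
move=> fdf; have [d e] := fdf (r *: v + x).
have E : (fun h : R => h^-1 *: (((fun r => f (r *: v + x)) \o shift r) (h *: 1) -
    f (r *: v + x))) = (fun h : R => h^-1 *: ((f \o shift (r *: v + x)) (h *: v) - f (r *: v + x))).
  by apply/funext => h /=; rewrite [h *: 1]mulr1 scalerDl addrA.
by split; [rewrite /derivable E|rewrite /derive E].
Qed.

End directional_derivatives.

Section heat_derivatives.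
Context {R : realType} {d : nat}.
Implicit Types (s t h r : R) (x y : 'rV[R]_d) (i j k : 'I_d).

Local Notation e k := (delta_mx 0 k : 'rV[R]_d).

(** Closed forms of the spatial derivatives of the heat kernel up to order three. The Oseen kernel
    already contains two of them, and the divergence in the Duhamel term adds the third. *)
Definition heat_d1 j s x := - (x 0 j / (2 * s)) * heat_kernel s x.

Definition heat_d2 i j s x :=
  (x 0 i * x 0 j / (4 * s ^+ 2) - (i == j)%:R / (2 * s)) * heat_kernel s x.

Definition heat_d3 i j k s x :=
  (- (x 0 i * x 0 j * x 0 k / (8 * s ^+ 3)) +
   ((i == k)%:R * x 0 j + (j == k)%:R * x 0 i + (i == j)%:R * x 0 k) / (4 * s ^+ 2)) *
  heat_kernel s x.

Lemma coord_line i k r x : (r *: e k + x) 0 i = r * (i == k)%:R + x 0 i.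
Proof. by rewrite !mxE eqxx. Qed.

Lemma enorm_line k r x : enorm (r *: e k + x) ^+ 2 = enorm x ^+ 2 + (2 * r * x 0 k + r ^+ 2).
Proof.
rewrite !enorm_sqr (bigD1 k)//= [in RHS](bigD1 k)//= coord_line eqxx mulr1.
rewrite (eq_bigr (fun i => x 0 i ^+ 2)); last first.
  by move=> i /negbTE ik; rewrite coord_line ik mulr0 add0r.
ring.
Qed.

Lemma is_derive_coord_line i k x :
  is_derive (0 : R) (1 : R) (fun r => (r *: e k + x) 0 i) (i == k)%:R.
Proof.
rewrite (_ : (fun r => _) = ((i == k)%:R \*: id) + cst (x 0 i)); last first.
  by apply/funext => r; rewrite coord_line !fctE /GRing.scale /= mulrC.
by apply: is_derive_eq; rewrite addr0 /GRing.scale /= mulr1.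
Qed.

Lemma is_derive_heat_line k s x : s != 0 ->
  is_derive (0 : R) (1 : R) (fun r => heat_kernel s (r *: e k + x)) (heat_d1 k s x).
Proof.
move=> s0; pose c := (4 * pi * s) `^ (- (d%:R / 2)).
pose p r := - (enorm x ^+ 2 / (4 * s)) - r * (x 0 k / (2 * s)) - r ^+ 2 / (4 * s).
have dp : is_derive (0 : R) (1 : R) p (- (x 0 k / (2 * s))).
  rewrite (_ : p = cst (- (enorm x ^+ 2 / (4 * s))) -
    ((x 0 k / (2 * s)) \*: id) - ((4 * s)^-1 \*: (id ^+ 2))); last first.
    by apply/funext => r; rewrite /p !fctE /GRing.scale /= [r * _]mulrC [r ^+ 2 / _]mulrC.
  by apply: is_derive_eq; rewrite /GRing.scale /=; ring.
rewrite (_ : (fun r => _) = c \*: (expR \o p)); last first.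
  apply/funext => r; rewrite /heat_kernel enorm_line -/c /=; congr (_ * expR _).
  by rewrite /p; field.
apply: is_derive_eq; rewrite /heat_d1 /heat_kernel -/c /GRing.scale /=.
by rewrite /p !mul0r expr0n mul0r !subr0; ring.
Qed.

Lemma is_derive_heat k s x : s != 0 ->
  is_derive x (e k) (heat_kernel s) (heat_d1 k s x).
Proof. by move=> s0; apply: is_derive_line; exact: is_derive_heat_line. Qed.

Lemma is_derive_heat_d1 i j s x : s != 0 ->
  is_derive x (e i) (heat_d1 j s) (heat_d2 i j s x).
Proof.
move=> s0; apply: is_derive_line.
have dx := is_derive_coord_line j i x; have dG := is_derive_heat_line i x s0.
rewrite (_ : (fun r => _) = ((- (2 * s)^-1) \*: (fun r => (r *: e i + x) 0 j)) *
   (fun r => heat_kernel s (r *: e i + x))); last first.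
  apply/funext => r.
  transitivity (- (2 * s)^-1 * (r *: e i + x) 0 j * heat_kernel s (r *: e i + x)) => //.
  by rewrite /heat_d1; field.
apply: is_derive_eq.
rewrite ?fctE /= ?(scale0r, add0r) /GRing.scale /= /heat_d1 /heat_d2 eq_sym.
by field.
Qed.

Lemma is_derive_heat_d2 i j k s x : s != 0 ->
  is_derive x (e k) (heat_d2 i j s) (heat_d3 i j k s x).
Proof.
move=> s0; apply: is_derive_line.
have dxi := is_derive_coord_line i k x; have dxj := is_derive_coord_line j k x.
have dG := is_derive_heat_line k x s0.
rewrite (_ : (fun r => _) =
   (((4 * s ^+ 2)^-1 \*: ((fun r => (r *: e k + x) 0 i) * (fun r => (r *: e k + x) 0 j)))
    - cst ((i == j)%:R / (2 * s))) *
   (fun r => heat_kernel s (r *: e k + x))); last first.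
  apply/funext => r.
  transitivity (((4 * s ^+ 2)^-1 * ((r *: e k + x) 0 i * (r *: e k + x) 0 j) -
    (i == j)%:R / (2 * s)) * heat_kernel s (r *: e k + x)) => //.
  by rewrite /heat_d2; field.
apply: is_derive_eq.
rewrite ?fctE /= ?(scale0r, add0r) /GRing.scale /= /heat_d1 /heat_d3.
by field.
Qed.

Lemma partial_heat j s : s != 0 -> partial j (heat_kernel s) = heat_d1 j s.
Proof. by move=> s0; apply/funext => x; have [] := is_derive_heat j x s0. Qed.

Lemma partial2_heat i j s : s != 0 ->
  partial i (partial j (heat_kernel s)) = heat_d2 i j s.
Proof.
by move=> s0; rewrite partial_heat//; apply/funext => x; have [] := is_derive_heat_d1 i j x s0.
Qed.

End heat_derivatives.

Section measurability.
Context {R : realType}.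

(** As 0^-1 = 0, inversion is not continuous at 0; the form x (x^2)^-1 reduces it to a real
    power. *)
Lemma measurable_invr : measurable_fun setT (fun x : R => x^-1).
Proof.
rewrite (_ : (fun x => _) = (fun x : R => x * (x ^+ 2) `^ (- 1))).
  apply: measurable_funM => //.
  by apply: (measurableT_comp (measurable_powR (- 1))); exact: measurable_funX.
apply/funext => x; rewrite powR_inv1 ?sqr_ge0//.
have [->|x0] := eqVneq x 0; first by rewrite invr0 mul0r.
by rewrite expr2 invfM mulrA divff// mul1r.
Qed.

Lemma measurable_funV d (T : measurableType d) (f : T -> R) :
  measurable_fun setT f -> measurable_fun setT (fun x => (f x)^-1).
Proof. exact: measurableT_comp measurable_invr. Qed.

Lemma measurable_coord d (i : 'I_d) : measurable_fun setT (fun x : 'rV[R]_d => x 0 i).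
Proof. exact: measurable_entry. Qed.

Lemma measurable_subl d (x : 'rV[R]_d) : measurable_fun setT (fun y : 'rV[R]_d => x - y).
Proof.
apply: measurable_fun_mxP => a b.
rewrite (_ : (fun y => _) = fun y : 'rV[R]_d => x a b - y a b).
  by apply: measurable_funB => //; exact: measurable_entry.
by apply/funext => y; rewrite !mxE.
Qed.

Lemma measurable_enorm_sqr d : measurable_fun setT (fun x : 'rV[R]_d => enorm x ^+ 2).
Proof.
rewrite (_ : (fun x => _) = fun x : 'rV[R]_d => \sum_i x 0 i ^+ 2).
  by apply: measurable_sum => i; apply: measurable_funX; exact: measurable_coord.
by apply/funext => x; rewrite enorm_sqr.
Qed.

End measurability.

(** * Differentiating the Oseen kernel in space *)

Section oseen_derivative.
Context {R : realType} {d : nat}.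
Implicit Types (s t h r : R) (x y : 'rV[R]_d) (i j k : 'I_d).
Notation leb := (@lebesgue_measure R).

Definition heat_peak s : R := (4 * pi * s) `^ (- (d%:R / 2)).

Lemma heat_peak_ge0 s : 0 <= heat_peak s.
Proof. exact: powR_ge0. Qed.

Lemma heat_kernel_ge0 s x : 0 <= heat_kernel s x.
Proof. by rewrite mulr_ge0 ?powR_ge0 ?expR_ge0. Qed.

Lemma heat_kernel_le_peak s x : 0 < s -> heat_kernel s x <= heat_peak s.
Proof.
move=> s0; rewrite ler_piMr ?heat_peak_ge0// -[leRHS]expR0 ler_expR oppr_le0.
by rewrite divr_ge0 ?sqr_ge0// mulr_ge0// ltW.
Qed.

Lemma coord_le_enorm x i : `|x 0 i| <= enorm x.
Proof.
rewrite -sqrtr_sqr ler_sqrt; last by apply: sumr_ge0 => j _; exact: sqr_ge0.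
by rewrite (bigD1 i)//= lerDl; apply: sumr_ge0 => j _; exact: sqr_ge0.
Qed.

Lemma measurable_heat_peak : measurable_fun setT heat_peak.
Proof.
by apply: (measurableT_comp (measurable_powR _)); exact: measurable_funM.
Qed.

Lemma measurable_heat_exponent (c : R) :
  measurable_fun setT (fun q : R * 'rV[R]_d => enorm q.2 ^+ 2 / (c * q.1)).
Proof.
apply: measurable_funM; first exact: measurableT_comp (@measurable_enorm_sqr R d) _.
by apply: measurable_funV; apply: measurable_funM.
Qed.

Lemma measurable_heat_kernel :
  measurable_fun setT (fun q : R * 'rV[R]_d => heat_kernel q.1 q.2).
Proof.
apply: measurable_funM; first exact: measurableT_comp measurable_heat_peak _.
apply: measurableT_comp => //; apply: measurableT_comp => //.
exact: measurable_heat_exponent.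
Qed.

Let mcoord i : measurable_fun setT (fun q : R * 'rV[R]_d => q.2 0 i).
Proof. exact: measurableT_comp (measurable_coord i) _. Qed.

Let minv (c : R) n : measurable_fun setT (fun q : R * 'rV[R]_d => (c * q.1 ^+ n)^-1).
Proof.
by apply: measurable_funV; apply: measurable_funM => //; exact: measurable_funX.
Qed.

Lemma measurable_heat_d2 i j :
  measurable_fun setT (fun q : R * 'rV[R]_d => heat_d2 i j q.1 q.2).
Proof.
apply: measurable_funM; last exact: measurable_heat_kernel.
apply: measurable_funB; apply: measurable_funM => //.
  exact: measurable_funM.
exact: (minv 2 1).
Qed.

Lemma measurable_heat_d3 i j k :
  measurable_fun setT (fun q : R * 'rV[R]_d => heat_d3 i j k q.1 q.2).
Proof.
apply: measurable_funM; last exact: measurable_heat_kernel.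
apply: measurable_funD.
  apply: measurableT_comp => //; apply: measurable_funM => //.
  by apply: measurable_funM => //; apply: measurable_funM.
apply: measurable_funM => //.
by apply: measurable_funD; [apply: measurable_funD|]; apply: measurable_funM.
Qed.

(** A crude bound for s > t, locally uniform in x and degenerating as t tends to 0. It and its third
    order analogue serve only to dominate the tail integral at fixed t. *)
Lemma heat_d2_le i j t s x (X : R) : 0 < t -> t < s -> (forall l, `|x 0 l| <= X) ->
  `|heat_d2 i j s x| <= (X ^+ 2 / t + 1) * (s^-1 * heat_peak s).
Proof.
move=> t0 ts xX; have s0 := lt_trans t0 ts.
have X0 : 0 <= X := le_trans (normr_ge0 _) (xX i).
rewrite normrM [leRHS]mulrA (ger0_norm (heat_kernel_ge0 s x)).
apply: ler_pM => //; [exact: heat_kernel_ge0| |exact: heat_kernel_le_peak].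
apply: le_trans (ler_normB _ _) _; rewrite [leRHS]mulrDl mul1r; apply: lerD.
  rewrite normrM normrM (ger0_norm (x := (4 * s ^+ 2)^-1)); last first.
    by rewrite invr_ge0 mulr_ge0// sqr_ge0.
  rewrite -[leRHS]mulrA; apply: ler_pM => //.
  - by rewrite invr_ge0 mulr_ge0// sqr_ge0.
  - by rewrite expr2 ler_pM.
  - rewrite -invfM lef_pV2 ?posrE ?mulr_gt0 ?exprn_gt0// expr2 mulrA.
    by rewrite ler_wpM2r ?(ltW s0)//; nra.
rewrite normrM (ger0_norm (x := (2 * s)^-1)); last by rewrite invr_ge0 mulr_ge0// ltW.
rewrite -[leRHS]mul1r; apply: ler_pM => //; first by rewrite invr_ge0 mulr_ge0// ltW.
  by case: (i == j); rewrite ?normr1 ?normr0.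
by rewrite lef_pV2 ?posrE ?mulr_gt0//; lra.
Qed.

Lemma heat_d3_le i j k t s x (X : R) : 0 < t -> t < s -> (forall l, `|x 0 l| <= X) ->
  `|heat_d3 i j k s x| <= (X ^+ 3 / t ^+ 2 + X / t) * (s^-1 * heat_peak s).
Proof.
move=> t0 ts xX; have s0 := lt_trans t0 ts.
have X0 : 0 <= X := le_trans (normr_ge0 _) (xX i).
rewrite normrM [leRHS]mulrA (ger0_norm (heat_kernel_ge0 s x)).
apply: ler_pM => //; [exact: heat_kernel_ge0| |exact: heat_kernel_le_peak].
apply: le_trans (ler_normD _ _) _; rewrite [leRHS]mulrDl normrN; apply: lerD.
  rewrite normrM !normrM (ger0_norm (x := (8 * s ^+ 3)^-1)); last first.
    by rewrite invr_ge0 mulr_ge0// exprn_ge0// ltW.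
  rewrite -[leRHS]mulrA; apply: ler_pM => //.
  - by rewrite invr_ge0 mulr_ge0// exprn_ge0// ltW.
  - by rewrite exprSr expr2 !ler_pM ?mulr_ge0.
  - rewrite -invfM lef_pV2 ?posrE ?mulr_gt0 ?exprn_gt0//.
    have ts2 : t ^+ 2 <= s ^+ 2 by rewrite lerXn2r ?nnegrE ?ltW.
    have := ler_wpM2r (ltW s0) ts2; have : 0 <= s ^+ 2 * s by rewrite mulr_ge0 ?sqr_ge0// ltW.
    by rewrite -(exprSr s 2); lra.
rewrite normrM (ger0_norm (x := (4 * s ^+ 2)^-1)); last by rewrite invr_ge0 mulr_ge0// sqr_ge0.
have bX (b : bool) l : `|b%:R * x 0 l| <= X.
  by case: b; rewrite ?mul1r ?mul0r ?normr0.
have sum3 : `|(i == k)%:R * x 0 j + (j == k)%:R * x 0 i + (i == j)%:R * x 0 k| <= 3 * X.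
  apply: le_trans (ler_normD _ _) _; apply: le_trans (lerD (ler_normD _ _) (lexx _)) _.
  by have := bX (i == k) j; have := bX (j == k) i; have := bX (i == j) k; lra.
apply: (@le_trans _ _ (3 * X * (4 * s ^+ 2)^-1)).
  by rewrite ler_wpM2r// invr_ge0 mulr_ge0// sqr_ge0.
rewrite [leLHS](_ : _ = X * (3 / (4 * s ^+ 2))); last by ring.
rewrite -[leRHS]mulrA ler_wpM2l// -invfM ler_pdivrMr ?mulr_gt0 ?exprn_gt0//.
rewrite mulrC ler_pdivlMr ?mulr_gt0//.
have ss : t * s <= s * s by rewrite ler_wpM2r ?(ltW s0)// ltW.
by rewrite [s ^+ 2]expr2; nra.
Qed.

(** The power s^(-1 - d/2) splits off s^(-3/2), and the remaining s^(-(d - 1)/2) is largest at s = t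
    when d >= 1. One integral thus serves all dimensions. *)
Lemma heat_peak_integrable_tail t : (0 < d)%N -> 0 < t ->
  exists2 c, 0 <= c & forall s, t < s -> s^-1 * heat_peak s <= c * s `^ (- (3 / 2)).
Proof.
move=> d0 t0; pose p : R := (d%:R - 1) / 2.
have p0 : 0 <= p by rewrite divr_ge0// subr_ge0 ler1n.
exists ((4 * pi) `^ (- (d%:R / 2)) * t `^ (- p)).
  by rewrite mulr_ge0 ?powR_ge0.
move=> s ts; have s0 := lt_trans t0 ts.
have sn0 : s != 0 by rewrite gt_eqF.
rewrite /heat_peak powRM ?mulr_ge0 ?pi_ge0 ?(ltW s0)//.
rewrite mulrCA -mulrA; apply: ler_wpM2l; first exact: powR_ge0.
have -> : s^-1 * s `^ (- (d%:R / 2)) = s `^ (- p) * s `^ (- (3 / 2)).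
  rewrite -(powR_inv1 (ltW s0)) -!powRD ?sn0 ?implybT//.
  by congr (_ `^ _); rewrite /p; field.
rewrite ler_wpM2r ?powR_ge0// !powRN lef_pV2 ?posrE ?powR_gt0//.
by rewrite ge0_ler_powR ?nnegrE ?(ltW t0) ?(ltW s0) ?(ltW ts).
Qed.

Lemma integrable_powRN32 (A t : R) : 0 <= A -> 0 < t ->
  leb.-integrable `]t, +oo[ (EFin \o (fun s => A * s `^ (- (3 / 2)))).
Proof.
move=> A0 t0.
have mp : measurable_fun `]t, +oo[ (fun s : R => s `^ (- (3 / 2))).
  by apply: measurable_funTS; exact: measurable_powR.
have i1 : leb.-integrable `]t, +oo[ (EFin \o (fun s : R => s `^ (- (3 / 2)))).
  apply: integrable_ub (integral_powRN32 t0) => // s _; exact: powR_ge0.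
have mB : @measurable _ (measurableTypeR R) `]t, +oo[%classic by exact: measurable_itv.
have := integrableZl mB A i1.
by apply: eq_integrable => // s _ /=; rewrite EFinM.
Qed.

Let mslice (f : R -> 'rV[R]_d -> R) x (D : set R) :
  measurable_fun setT (fun q : R * 'rV[R]_d => f q.1 q.2) ->
  measurable_fun D (f^~ x).
Proof.
move=> mf; apply: measurable_funTS.
apply: (measurableT_comp (f := fun q => f q.1 q.2) mf (g := fun s => (s, x))).
exact: measurable_fun_pair.
Qed.

Lemma integrable_heat_d2 i j t x : 0 < t ->
  leb.-integrable `]t, +oo[ (EFin \o (fun s => heat_d2 i j s x)).
Proof.
move=> t0; have d0 : (0 < d)%N by apply: leq_trans (ltn_ord i).
have [c c0 cs] := heat_peak_integrable_tail d0 t0.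
pose A := (enorm x ^+ 2 / t + 1) * c.
have A0 : 0 <= A by rewrite mulr_ge0// addr_ge0// divr_ge0 ?sqr_ge0// ltW.
apply: (integrable_dom _ _ _ (integrable_powRN32 A0 t0)) => //.
  by apply: mslice; exact: measurable_heat_d2.
move=> s; rewrite /= in_itv/= andbT => ts.
apply: le_trans (heat_d2_le i j t0 ts (coord_le_enorm x)) _.
by rewrite /A -mulrA ler_wpM2l ?cs// addr_ge0// divr_ge0 ?sqr_ge0// ltW.
Qed.

Lemma is_derive_oseen_tail i j k t x : 0 < t ->
  is_derive x (delta_mx 0 k : 'rV[R]_d)
    (fun x => \int[leb]_(s in `]t, +oo[) heat_d2 i j s x)
    (\int[leb]_(s in `]t, +oo[) heat_d3 i j k s x).
Proof.
move=> t0; apply: is_derive_line; set e := delta_mx 0 k.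
have d0 : (0 < d)%N by apply: leq_trans (ltn_ord i).
have [c c0 cs] := heat_peak_integrable_tail d0 t0.
pose f r s := heat_d2 i j s (r *: e + x).
(* Differentiation under the integral takes place for r in ]-1, 1[, where no coordinate of the
   displaced point exceeds |x| + 1. *)
pose X := enorm x + 1.
have X0 : 0 <= X by rewrite addr_ge0// sqrtr_ge0.
pose A := (X ^+ 3 / t ^+ 2 + X / t) * c.
have A0 : 0 <= A.
  by rewrite mulr_ge0// addr_ge0// divr_ge0 ?exprn_ge0// ltW.
have df r s : t < s -> is_derive r (1 : R) (f^~ s) (heat_d3 i j k s (r *: e + x)).
  move=> ts; apply: (is_derive_on_line (df := heat_d3 i j k s)) => y.
  by apply: is_derive_heat_d2; rewrite gt_eqF// (lt_trans t0).
have I0 : `]-1, 1[%classic (0 : R) by rewrite /= in_itv/= ltrN10 ltr01.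
have mB : @measurable _ (measurableTypeR R) `]t, +oo[%classic by exact: measurable_itv.
have intf r : `]-1, 1[%classic r -> leb.-integrable `]t, +oo[ (EFin \o f r).
  by move=> _; exact: integrable_heat_d2.
have derf r s : `]-1, 1[%classic r -> `]t, +oo[%classic s -> derivable (f^~ s) r 1.
  by move=> _; rewrite /= in_itv/= andbT => ts; case: (df r s ts).
have d1E r s : t < s -> partial1of2 f r s = heat_d3 i j k s (r *: e + x).
  by move=> ts; rewrite partial1of2E; case: (df r s ts).
have G0 s : 0 <= A * s `^ (- (3 / 2)) by rewrite mulr_ge0// powR_ge0.
have Gub r s : `]-1, 1[%classic r -> `]t, +oo[%classic s ->
    `|partial1of2 f r s| <= A * s `^ (- (3 / 2)).
  rewrite /= !in_itv/= andbT => r1 ts; rewrite d1E//.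
  apply: (@le_trans _ _ ((X ^+ 3 / t ^+ 2 + X / t) * (s^-1 * heat_peak s))).
    apply: heat_d3_le => // l; rewrite coord_line.
    apply: le_trans (ler_normD _ _) _; rewrite addrC lerD ?coord_le_enorm//.
    case: (l == k); rewrite ?mulr1 ?mulr0 ?normr0//.
    by rewrite ler_norml !ltW//; case/andP: r1.
  by rewrite /A -mulrA ler_wpM2l ?cs// addr_ge0// divr_ge0 ?exprn_ge0// ltW.
have iG := integrable_powRN32 A0 t0.
split.
  exact: (derivable_under_integral mB I0 intf derf G0 iG Gub).
rewrite -derive1E (differentiation_under_integral mB I0 intf derf G0 iG Gub).
apply: eq_Rintegral => s; rewrite inE/= in_itv/= andbT => ts.
by rewrite d1E// scale0r add0r.
Qed.

Lemma partial_oseen i j k t x : 0 < t ->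
  partial k (oseen_kernel i j t) x =
  (i == j)%:R * heat_d1 k t x + \int[leb]_(s in `]t, +oo[) heat_d3 i j k s x.
Proof.
move=> t0.
rewrite /partial (_ : oseen_kernel i j t = ((i == j)%:R \*: heat_kernel t) +
    (fun x => \int[leb]_(s in `]t, +oo[) heat_d2 i j s x)); last first.
  apply/funext => y; rewrite /oseen_kernel !fctE; congr (_ + _).
  apply: eq_Rintegral => s; rewrite inE/= in_itv/= andbT => ts.
  by rewrite partial2_heat// gt_eqF// (lt_trans t0).
have d1 := is_derive_heat k x (lt0r_neq0 t0).
have d2 := is_derive_oseen_tail i j k x t0.
by rewrite derive_val.
Qed.

End oseen_derivative.

(** * Series of the heat kernel and of its derivatives *)

Section kernel_series.
Context {R : realType} {d : nat}.
Implicit Types (s t h r b : R) (x y : 'rV[R]_d) (i j k : 'I_d).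
Notation leb := (@lebesgue_measure R).

Lemma mul_expR_Nsqr_le (y : R) : 0 <= y -> y * expR (- (y ^+ 2 / 2)) <= 1.
Proof.
move=> y0; rewrite expRN ler_pdivrMr ?expR_gt0// mul1r.
by apply: le_trans (expR_ge1Dx (y ^+ 2 / 2)); nra.
Qed.

(** From (y^2 / 2 - y)^2 >= 0 one gets y^3 <= y^4 / 4 + y^2 <= 4 (1 + y^2 / 4)^2, and 1 + y^2 / 4 <=
    exp(y^2 / 4). *)
Lemma cube_expR_Nsqr_le (y : R) : 0 <= y -> y ^+ 3 * expR (- (y ^+ 2 / 2)) <= 4.
Proof.
move=> y0; rewrite expRN ler_pdivrMr ?expR_gt0//.
have e1 := expR_ge1Dx (y ^+ 2 / 4).
have e2 : (1 + y ^+ 2 / 4) ^+ 2 <= expR (y ^+ 2 / 2).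
  rewrite (_ : y ^+ 2 / 2 = y ^+ 2 / 4 + y ^+ 2 / 4); last by field.
  rewrite expRD -expr2 lerXn2r// nnegrE ?expR_ge0//.
  by rewrite addr_ge0// divr_ge0// sqr_ge0.
apply: le_trans (ler_wpM2l _ e2) => //.
have : 0 <= (y ^+ 2 / 2 - y) ^+ 2 by exact: sqr_ge0.
rewrite (_ : _ ^+ 2 = (y ^+ 2) ^+ 2 / 4 - y ^+ 3 + y ^+ 2); last by field.
rewrite (_ : 4 * (1 + y ^+ 2 / 4) ^+ 2 = (y ^+ 2) ^+ 2 / 4 + 2 * y ^+ 2 + 4); last by field.
by have := sqr_ge0 y; lra.
Qed.

(** Coefficients in h of (1 + h)^-b Gamma((1 + h) s, x). Once the first and third derivatives are
    multiplied by 1 + h and (1 + h)^2, only b = 0 occurs, and b = 1 in the cubic term; b stays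
    nonnegative, as the majorant requires. *)
Definition heat_series b n s x :=
  heat_peak (d := d) s * heat_coef (d%:R / 2 + b) (enorm x ^+ 2 / (4 * s)) n.

Definition heat_d1_series k n s x := - (x 0 k / (2 * s)) * heat_series 0 n s x.

Definition heat_d3_series i j k n s x :=
  - (x 0 i * x 0 j * x 0 k / (8 * s ^+ 3)) * heat_series 1 n s x +
  ((i == k)%:R * x 0 j + (j == k)%:R * x 0 i + (i == j)%:R * x 0 k) / (4 * s ^+ 2) *
    heat_series 0 n s x.

Let exponent_ge0 s x : 0 < s -> 0 <= enorm x ^+ 2 / (4 * s).
Proof. by move=> s0; rewrite divr_ge0 ?sqr_ge0// mulr_ge0// ltW. Qed.

Let order_ge0 b : 0 <= b -> 0 <= d%:R / 2 + b.
Proof. by move=> b0; rewrite addr_ge0. Qed.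

Lemma gauss_ge0 s x : 0 <= gauss s x.
Proof. by rewrite mulr_ge0 ?powR_ge0 ?expR_ge0. Qed.

(** The exponential bounds exp((d / 2 + b) / 2) for b <= 1. The factor 6 covers the polynomial
    terms, the worst being y^3 + (3 / 2) y against exp(- y^2 / 2), at most 4 + 3 / 2. *)
Definition series_const : R := 6 * expR (d%:R / 4 + 1 / 2).

Lemma series_const_ge0 : 0 <= series_const.
Proof. by rewrite mulr_ge0// expR_ge0. Qed.

(** The decay exp(- 3 z / 4) is split into exp(- z / 2), kept explicit, and exp(- z / 4), which is
    the exponential in [gauss]. *)
Lemma wle_heat_series b s x : 0 <= b <= 1 -> 0 < s ->
  wle (1 / 8) (fun n => heat_series b n s x)
    (expR (d%:R / 4 + 1 / 2) * expR (- (enorm x ^+ 2 / (8 * s))) * gauss s x).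
Proof.
move=> /andP[b0 b1] s0.
have := @wleZ R _ (heat_peak (d := d) s) _ _ (wle_heat_coef (order_ge0 b0) (exponent_ge0 x s0)).
move=> /wle_trans; apply.
rewrite ger0_norm ?heat_peak_ge0// /gauss -/(heat_peak (d := d) s) [leRHS]mulrCA.
rewrite -!expRD; apply: ler_wpM2l; first exact: heat_peak_ge0.
rewrite ler_expR.
rewrite (_ : enorm x ^+ 2 / (8 * s) = enorm x ^+ 2 / (4 * s) / 2); last by field; rewrite gt_eqF.
rewrite (_ : enorm x ^+ 2 / (16 * s) = enorm x ^+ 2 / (4 * s) / 4); last by field; rewrite gt_eqF.
set z := _ / (4 * s); lra.
Qed.

Lemma psum_heat_series b s h x : 0 <= b -> 0 < s -> `|h| < 1 / 32 ->
  psum h (fun n => heat_series b n s x) = heat_kernel ((1 + h) * s) x * (1 + h) `^ (- b).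
Proof.
move=> b0 s0 h32; have h0 : 0 < 1 + h by move: h32; rewrite ltr_norml => ?; lra.
have h8 : `|h| <= 1 / 8 by apply/ltW/(lt_trans h32); lra.
rewrite (psumZ _ h8 (wle_heat_coef (order_ge0 b0) (exponent_ge0 x s0))).
rewrite psum_heat_coef ?order_ge0 ?exponent_ge0//.
rewrite /heat_kernel /heat_peak [4 * pi * ((1 + h) * s)]mulrCA.
rewrite [((1 + h) * _) `^ _]powRM ?mulr_ge0 ?pi_ge0 ?(ltW s0) ?(ltW h0)//.
rewrite opprD powRD ?(gt_eqF h0) ?implybT//.
rewrite (_ : enorm x ^+ 2 / (4 * ((1 + h) * s)) = enorm x ^+ 2 / (4 * s) / (1 + h)).
  set w := (1 + h) `^ _; set w' := (1 + h) `^ _; ring.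
by field; rewrite !gt_eqF.
Qed.

Lemma measurable_heat_series b n :
  measurable_fun setT (fun q : R * 'rV[R]_d => heat_series b n q.1 q.2).
Proof.
apply: measurable_funM; first exact: measurableT_comp (measurable_heat_peak (d := d)) _.
apply: (measurableT_comp (measurable_heat_coef _ _)).
exact: measurable_heat_exponent.
Qed.

Let mcoord i : measurable_fun setT (fun q : R * 'rV[R]_d => q.2 0 i).
Proof. exact: measurableT_comp (measurable_coord i) _. Qed.

Let minv (c : R) n : measurable_fun setT (fun q : R * 'rV[R]_d => (c * q.1 ^+ n)^-1).
Proof.
by apply: measurable_funV; apply: measurable_funM => //; exact: measurable_funX.
Qed.

Lemma measurable_heat_d1_series k n :
  measurable_fun setT (fun q : R * 'rV[R]_d => heat_d1_series k n q.1 q.2).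
Proof.
apply: measurable_funM; last exact: measurable_heat_series.
by apply: measurableT_comp => //; apply: measurable_funM => //; exact: (minv 2 1).
Qed.

Lemma measurable_heat_d3_series i j k n :
  measurable_fun setT (fun q : R * 'rV[R]_d => heat_d3_series i j k n q.1 q.2).
Proof.
apply: measurable_funD; apply: measurable_funM; try exact: measurable_heat_series.
  apply: measurableT_comp => //; apply: measurable_funM => //.
  by apply: measurable_funM => //; apply: measurable_funM.
apply: measurable_funM => //.
by apply: measurable_funD; [apply: measurable_funD|]; apply: measurable_funM.
Qed.

(** The similarity variable y = |x| / (2 sqrt s), with w = sqrt s, turns the derivative bounds into
    one-variable inequalities and removes the real powers. *)
Let scaled_norm s x : 0 < s -> exists y w : R, [/\ 0 <= y, 0 < w & s = w ^+ 2] /\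
  [/\ enorm x = 2 * y * w, enorm x ^+ 2 / (8 * s) = y ^+ 2 / 2,
      s `^ (- 2^-1) = w^-1 & s `^ (- (3 / 2)) = (w ^+ 3)^-1].
Proof.
move=> s0; pose w := Num.sqrt s; have w0 : 0 < w by rewrite sqrtr_gt0.
have sE : s = w ^+ 2 by rewrite sqr_sqrtr// ltW.
exists (enorm x / (2 * w)), w; split; split=> //.
- by rewrite divr_ge0 ?sqrtr_ge0// mulr_ge0// ltW.
- by field; rewrite gt_eqF.
- by rewrite sE; field; rewrite gt_eqF.
- by rewrite powRN powR12_sqrt// ltW.
- by rewrite powRN [3 / 2]mulrC powRrM powR12_sqrt ?ltW// -powR_mulrn ?sqrtr_ge0.
Qed.

Lemma wle_heat_d1_series k s x : 0 < s ->
  wle (1 / 8) (fun n => heat_d1_series k n s x) (series_const * (s `^ (- 2^-1) * gauss s x)).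
Proof.
move=> s0; have b01 : 0 <= (0 : R) <= 1 by rewrite lexx ler01.
apply: wle_trans (wleZ _ (wle_heat_series x b01 s0)) _.
have [y [w [[y0 w0 sE] [xE eE p1 p3]]]] := scaled_norm x s0.
rewrite eE /series_const [leRHS]mulrA [leLHS]mulrA; apply: ler_wpM2r; first exact: gauss_ge0.
rewrite [6 * _]mulrC [leLHS]mulrCA -[leRHS]mulrA; apply: ler_wpM2l; first exact: expR_ge0.
rewrite p1.
rewrite normrN normrM (ger0_norm (x := (2 * s)^-1)); last first.
  by rewrite invr_ge0 mulr_ge0// ltW.
apply: (@le_trans _ _ (enorm x / (2 * s) * expR (- (y ^+ 2 / 2)))).
  by rewrite ler_wpM2r ?expR_ge0// ler_wpM2r ?coord_le_enorm// invr_ge0 mulr_ge0// ltW.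
rewrite xE sE (_ : 2 * y * w / (2 * w ^+ 2) = y / w); last first.
  by field; rewrite gt_eqF.
rewrite mulrAC ler_wpM2r ?invr_ge0 ?ltW//.
by have := mul_expR_Nsqr_le y0; lra.
Qed.

Lemma wle_heat_d3_series i j k s x : 0 < s ->
  wle (1 / 8) (fun n => heat_d3_series i j k n s x)
    (series_const * (s `^ (- (3 / 2)) * gauss s x)).
Proof.
move=> s0; have b0 : 0 <= (0 : R) <= 1 by rewrite lexx ler01.
have b1 : 0 <= (1 : R) <= 1 by rewrite lexx ler01.
have e8 : 0 <= 1 / 8 :> R by lra.
apply: wle_trans (wleD e8 (wleZ _ (wle_heat_series x b1 s0)) (wleZ _ (wle_heat_series x b0 s0))) _.
have [y [w [[y0 w0 sE] [xE eE p1 p3]]]] := scaled_norm x s0.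
rewrite eE -mulrDl /series_const [leRHS]mulrA [leLHS]mulrA.
apply: ler_wpM2r; first exact: gauss_ge0.
rewrite [6 * _]mulrC [leLHS]mulrCA -[leRHS]mulrA; apply: ler_wpM2l; first exact: expR_ge0.
rewrite p3.
set E := expR _.
have E0 : 0 <= E by exact: expR_ge0.
have xl l : `|x 0 l| <= enorm x by exact: coord_le_enorm.
have q0 : 0 <= enorm x by rewrite sqrtr_ge0.
have i8 : 0 <= (8 * s ^+ 3)^-1 by rewrite invr_ge0 mulr_ge0// exprn_ge0// ltW.
have i4 : 0 <= (4 * s ^+ 2)^-1 by rewrite invr_ge0 mulr_ge0// exprn_ge0// ltW.
have bX (b : bool) l : `|b%:R * x 0 l| <= enorm x.
  by case: b; rewrite ?mul1r ?mul0r ?normr0.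
have c3 : `|- (x 0 i * x 0 j * x 0 k / (8 * s ^+ 3))| <= enorm x ^+ 3 / (8 * s ^+ 3).
  rewrite normrN normrM (ger0_norm i8) ler_wpM2r// !normrM exprSr expr2.
  by rewrite !ler_pM ?mulr_ge0.
have c1 : `|((i == k)%:R * x 0 j + (j == k)%:R * x 0 i + (i == j)%:R * x 0 k) /
    (4 * s ^+ 2)| <= 3 * enorm x / (4 * s ^+ 2).
  rewrite normrM (ger0_norm i4) ler_wpM2r//.
  apply: le_trans (ler_normD _ _) _; apply: le_trans (lerD (ler_normD _ _) (lexx _)) _.
  by have := bX (i == k) j; have := bX (j == k) i; have := bX (i == j) k; lra.
apply: le_trans (ler_wpM2r E0 (lerD c3 c1)) _.
rewrite xE sE.
rewrite (_ : _ / _ + _ = (y ^+ 3 + 3 / 2 * y) / w ^+ 3); last first.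
  by field; rewrite gt_eqF.
rewrite mulrAC ler_wpM2r ?invr_ge0 ?exprn_ge0 ?ltW//.
by have := mul_expR_Nsqr_le y0; have := cube_expR_Nsqr_le y0; rewrite -/E; lra.
Qed.

Lemma psum_heat_d1_series k s h x : 0 < s -> `|h| < 1 / 32 ->
  psum h (fun n => heat_d1_series k n s x) = (1 + h) * heat_d1 k ((1 + h) * s) x.
Proof.
move=> s0 h32; have h0 : 0 < 1 + h by move: h32; rewrite ltr_norml => ?; lra.
have h8 : `|h| <= 1 / 8 by apply/ltW/(lt_trans h32); lra.
have b01 : 0 <= (0 : R) <= 1 by rewrite lexx ler01.
rewrite (psumZ _ h8 (wle_heat_series x b01 s0)) psum_heat_series// oppr0 powRr0 mulr1.
by rewrite /heat_d1; field; rewrite !gt_eqF.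
Qed.

Lemma psum_heat_d3_series i j k s h x : 0 < s -> `|h| < 1 / 32 ->
  psum h (fun n => heat_d3_series i j k n s x) = (1 + h) ^+ 2 * heat_d3 i j k ((1 + h) * s) x.
Proof.
move=> s0 h32; have h0 : 0 < 1 + h by move: h32; rewrite ltr_norml => ?; lra.
have h8 : `|h| <= 1 / 8 by apply/ltW/(lt_trans h32); lra.
have b0 : 0 <= (0 : R) <= 1 by rewrite lexx ler01.
have b1 : 0 <= (1 : R) <= 1 by rewrite lexx ler01.
have w0 := wle_heat_series x b0 s0; have w1 := wle_heat_series x b1 s0.
rewrite (psumD h8 (wleZ _ w1) (wleZ _ w0)) (psumZ _ h8 w1) (psumZ _ h8 w0).
rewrite !psum_heat_series// oppr0 powRr0 mulr1 powR_inv1 ?ltW//.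
by rewrite /heat_d3; field; rewrite !gt_eqF.
Qed.

End kernel_series.

(** * Series and majorant of the differentiated Oseen kernel *)

Section oseen_series.
Context {R : realType} {d : nat}.
Implicit Types (s t h r b : R) (x y : 'rV[R]_d) (i j k : 'I_d).
Notation leb := (@lebesgue_measure R).

(** Coefficients in h of (1 + h) d_k E_ij((1 + h) t, x). *)
Definition oseen_series i j k n t x : R :=
  (i == j)%:R * heat_d1_series k n t x +
  \int[leb]_(s in `]t, +oo[) heat_d3_series i j k n s x.

(** The tail of Gaussians accounts for the slow spatial decay that the Helmholtz projection
    introduces. *)
Definition oseen_bound t x : R := series_const (d := d) *
  (t `^ (- 2^-1) * gauss t x + \int[leb]_(s in `]t, +oo[) (s `^ (- (3 / 2)) * gauss s x)).

Let mtail t : @measurable _ (measurableTypeR R) `]t, +oo[%classic.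
Proof. exact: measurable_itv. Qed.

Lemma measurable_gauss : measurable_fun setT (fun q : R * 'rV[R]_d => gauss q.1 q.2).
Proof.
apply: measurable_funM; first exact: measurableT_comp (measurable_heat_peak (d := d)) _.
apply: measurableT_comp => //; apply: measurableT_comp => //.
exact: measurable_heat_exponent.
Qed.

Let slice (f : R -> 'rV[R]_d -> R) x (D : set R) :
  measurable_fun setT (fun q : R * 'rV[R]_d => f q.1 q.2) ->
  measurable_fun D (f^~ x).
Proof.
move=> mf; apply: measurable_funTS.
apply: (measurableT_comp (f := fun q => f q.1 q.2) mf (g := fun s => (s, x))).
exact: measurable_fun_pair.
Qed.

Let tail s x : R := s `^ (- (3 / 2)) * gauss s x.

Let measurable_tail : measurable_fun setT (fun q : R * 'rV[R]_d => tail q.1 q.2).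
Proof.
apply: measurable_funM; last exact: measurable_gauss.
by apply: (measurableT_comp (measurable_powR _)).
Qed.

Let tail_ge0 s x : 0 <= tail s x.
Proof. by rewrite mulr_ge0 ?powR_ge0 ?gauss_ge0. Qed.

Lemma integrable_oseen_tail t x : 0 < t -> leb.-integrable `]t, +oo[ (EFin \o tail^~ x).
Proof.
move=> t0.
apply: (integrable_dom _ _ _ (integrable_powRN32 (heat_peak_ge0 t (d := d)) t0)) => //.
  by apply: slice; exact: measurable_tail.
move=> s; rewrite /= in_itv/= andbT => ts; have s0 := lt_trans t0 ts.
rewrite ger0_norm// /tail mulrC ler_wpM2r ?powR_ge0//.
apply: (@le_trans _ _ (heat_peak (d := d) s)).
  rewrite ler_piMr ?heat_peak_ge0// -[leRHS]expR0 ler_expR oppr_le0.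
  by rewrite divr_ge0 ?sqr_ge0// mulr_ge0// ltW.
rewrite /heat_peak !powRN lef_pV2 ?posrE ?powR_gt0 ?mulr_gt0 ?pi_gt0//.
rewrite ge0_ler_powR ?nnegrE ?mulr_ge0 ?pi_ge0 ?(ltW t0) ?(ltW s0)//.
by rewrite ler_wpM2l ?mulr_ge0 ?pi_ge0// ltW.
Qed.

Let tailE t x : 0 < t -> (\int[leb]_(s in `]t, +oo[) (series_const (d := d) * tail s x)%:E)%E =
  (series_const (d := d) * \int[leb]_(s in `]t, +oo[) tail s x)%:E.
Proof.
move=> t0; have i1 := integrable_oseen_tail x t0.
rewrite -RintegralZl// /Rintegral fineK//.
apply: integrable_fin_num => //; have := integrableZl (mtail t) (series_const (d := d)) i1.
by apply: eq_integrable => // s _ /=; rewrite EFinM.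
Qed.

Let wtail i j k t x : 0 < t -> forall s, `]t, +oo[%classic s ->
  wle (1 / 8) (fun n => heat_d3_series i j k n s x) (series_const (d := d) * tail s x).
Proof.
move=> t0 s; rewrite /= in_itv/= andbT => ts.
by apply: wle_heat_d3_series; exact: lt_trans ts.
Qed.

Let mtailZ t x : measurable_fun `]t, +oo[ (fun s => series_const (d := d) * tail s x).
Proof. by apply: measurable_funM => //; by apply: slice; exact: measurable_tail. Qed.

Let mcoef i j k t x n : measurable_fun `]t, +oo[ (fun s => heat_d3_series i j k n s x).
Proof. by apply: slice; exact: measurable_heat_d3_series. Qed.

Let e8 : 0 < 1 / 8 :> R. Proof. lra. Qed.

Lemma wle_oseen_tail i j k t x : 0 < t ->
  wle (1 / 8) (fun n => \int[leb]_(s in `]t, +oo[) heat_d3_series i j k n s x)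
    (series_const (d := d) * \int[leb]_(s in `]t, +oo[) tail s x).
Proof.
move=> t0.
apply: (wle_Rintegral (mtail t) e8 (fun n => @mcoef i j k t x n) (@mtailZ t x)
  (wtail i j k x t0)).
by rewrite tailE.
Qed.

Lemma wle_oseen_series i j k t x : 0 < t ->
  wle (1 / 8) (fun n => oseen_series i j k n t x) (oseen_bound t x).
Proof.
move=> t0; rewrite /oseen_bound mulrDr.
apply: wleD; [exact: ltW| |exact: wle_oseen_tail].
apply: wle_trans (wleZ _ (wle_heat_d1_series k x t0)) _.
rewrite ler_piMl//; first by rewrite !mulr_ge0 ?series_const_ge0 ?powR_ge0 ?gauss_ge0.
by case: (i == j); rewrite ?normr1 ?normr0.
Qed.

(** Substituting (1 + h) s for s in the tail integral makes its range independent of h. The Jacobian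
    supplies the second factor 1 + h needed by the third derivatives. *)
Lemma psum_oseen_series i j k t h x : 0 < t -> `|h| < 1 / 32 ->
  psum h (fun n => oseen_series i j k n t x) =
  (1 + h) * partial k (oseen_kernel i j ((1 + h) * t)) x.
Proof.
move=> t0 h32; have h0 : 0 < 1 + h by move: h32; rewrite ltr_norml => ?; lra.
have h8 : `|h| <= 1 / 8 by apply/ltW/(lt_trans h32); lra.
have th0 : 0 < (1 + h) * t by rewrite mulr_gt0.
have w1 := wle_heat_d1_series k x t0.
rewrite (psumD h8 (wleZ _ w1) (wle_oseen_tail i j k x t0)) (psumZ _ h8 w1).
have gA : (\int[leb]_(s in `]t, +oo[) (series_const (d := d) * tail s x)%:E <=
  (series_const (d := d) * \int[leb]_(s in `]t, +oo[) tail s x)%:E)%E by rewrite tailE.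
rewrite (psum_Rintegral (mtail t) e8 (fun n => @mcoef i j k t x n) (@mtailZ t x)
  (wtail i j k x t0) gA h8).
rewrite psum_heat_d1_series// partial_oseen// mulrDr mulrCA; congr (_ + _).
rewrite (Rintegral_lebesgue_scale h0) //; last first.
  by apply: slice; exact: measurable_heat_d3.
rewrite mulrA -expr2.
rewrite (_ : _ @^-1` _ = `]t, +oo[%classic); last first.
  by apply/seteqP; split=> s /=; rewrite !in_itv/= !andbT ltr_pM2l.
have ip := integrable_psum (mtail t) (fun n => @mcoef i j k t x n) (@mtailZ t x)
  (wtail i j k x t0) gA h8.
under [X in _ = _ * X]eq_Rintegral => s.
  rewrite inE/= in_itv/= andbT => ts.
  rewrite (_ : heat_d3 _ _ _ _ _ =
      (1 + h) ^- 2 * psum h (fun n => heat_d3_series i j k n s x)); last first.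
    by rewrite psum_heat_d3_series ?(lt_trans t0)// mulKf// expf_neq0// gt_eqF.
  over.
by rewrite RintegralZl// mulrA divff ?mul1r// expf_neq0// gt_eqF.
Qed.

(** The range of integration depends on the parameter; a cut-off in the integrand replaces it by the
    whole line. *)
Let measurable_tail_integral (f : R -> 'rV[R]_d -> R) :
  measurable_fun setT (fun q : R * 'rV[R]_d => f q.1 q.2) ->
  measurable_fun setT (fun q : R * 'rV[R]_d => \int[leb]_(s in `]q.1, +oo[) f s q.2).
Proof.
move=> mf.
pose F (w : (R * 'rV[R]_d) * R) := if w.1.1 < w.2 then f w.2 w.1.2 else 0.
rewrite (_ : (fun q => _) = fun q => \int[leb]_s F (q, s)).
  apply: measurable_Rintegral_param; apply: measurable_fun_ifT => //.
    by apply: measurable_fun_ltr => //; exact: measurableT_comp.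
  apply: (measurableT_comp (f := fun q => f q.1 q.2) mf
    (g := fun w : (R * 'rV[R]_d) * R => (w.2, w.1.2))).
  by apply: measurable_fun_pair => //; exact: measurableT_comp.
apply/funext => q; rewrite Rintegral_mkcond; congr Rintegral; apply/funext => s.
by rewrite patchE /F mem_setE/= in_itv/= andbT.
Qed.

Lemma measurable_oseen_series i j k n :
  measurable_fun setT (fun q : R * 'rV[R]_d => oseen_series i j k n q.1 q.2).
Proof.
apply: measurable_funD; first by apply: measurable_funM => //; exact: measurable_heat_d1_series.
exact: measurable_tail_integral (measurable_heat_d3_series i j k n).
Qed.

Lemma measurable_oseen_bound :
  measurable_fun setT (fun q : R * 'rV[R]_d => oseen_bound q.1 q.2).
Proof.
apply: measurable_funM => //; apply: measurable_funD.
  apply: measurable_funM; last exact: measurable_gauss.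
  by apply: (measurableT_comp (measurable_powR _)).
exact: measurable_tail_integral measurable_tail.
Qed.

(** By Tonelli each Gaussian has mass 2^d in space, and the remaining integral of s^(-3/2) over s >
    t is 2 t^(-1/2). The local term adds one more, whence the 3. *)
Lemma integral_oseen_bound t x : 0 < t ->
  (\int[lebesgue_rV d]_y (oseen_bound t (x - y))%:E <=
   (3 * 2 ^+ d * series_const (d := d) * t `^ (- 2^-1))%:E)%E.
Proof.
move=> t0; have cs0 := series_const_ge0 (R := R) (d := d).
have msub := measurable_subl x.
have mg : measurable_fun setT (fun y : 'rV[R]_d => gauss t (x - y)).
  apply: (measurableT_comp measurable_gauss (g := fun y => (t, x - y))).
  exact: measurable_fun_pair.
have mt : measurable_fun setT (fun y : 'rV[R]_d => \int[leb]_(s in `]t, +oo[) tail s (x - y)).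
  apply: (measurableT_comp (measurable_tail_integral measurable_tail) (g := fun y => (t, x - y))).
  exact: measurable_fun_pair.
under eq_integral do rewrite EFinM EFinD [X in (_ * (X + _))%E]EFinM.
rewrite ge0_integralZl_EFin//; last 2 first.
- move=> y _; rewrite -EFinD lee_fin addr_ge0 ?mulr_ge0 ?powR_ge0 ?gauss_ge0//.
  by apply: Rintegral_ge0 => s _; exact: tail_ge0.
- apply: emeasurable_funD; first by apply/measurable_EFinP; exact: measurable_funM.
  exact/measurable_EFinP.
rewrite ge0_integralD//; last 4 first.
- by move=> y _; rewrite -EFinM lee_fin mulr_ge0 ?powR_ge0 ?gauss_ge0.
- by apply/measurable_EFinP; exact: measurable_funM.
- by move=> y _; rewrite lee_fin; apply: Rintegral_ge0 => s _; exact: tail_ge0.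
- exact/measurable_EFinP.
rewrite ge0_integralZl_EFin ?powR_ge0//; last 2 first.
- by move=> y _; rewrite lee_fin gauss_ge0.
- exact/measurable_EFinP.
rewrite integral_gauss//.
pose F (w : 'rV[R]_d * R) : \bar R := (if t < w.2 then tail w.2 (x - w.1) else 0)%:E.
have F0 w : (0 <= F w)%E by rewrite lee_fin; case: ifP.
have mF : measurable_fun setT F.
  apply/measurable_EFinP; apply: measurable_fun_ifT => //.
    exact: measurable_fun_ltr.
  apply: (measurableT_comp measurable_tail (g := fun w : 'rV[R]_d * R => (w.2, x - w.1))).
  by apply: measurable_fun_pair => //; exact: measurableT_comp msub _.
rewrite [X in (_ * (_ + X))%E](_ : _ = \int[lebesgue_rV d]_y \int[leb]_s F (y, s))%E; last first.
  apply: eq_integral => y _; rewrite /Rintegral fineK; last first.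
    by apply: integrable_fin_num => //; exact: integrable_oseen_tail.
  rewrite [LHS]integral_mkcond; apply: eq_integral => s _.
  by rewrite /F patchE mem_setE/= in_itv/= andbT; case: ifP.
rewrite fubini_tonelli//.
rewrite [X in (_ * (_ + X) <= _)%E](_ : _ =
    (\int[leb]_(s in `]t, +oo[) ((2 ^+ d)%:E * (s `^ (- (3 / 2)))%:E))%E); last first.
  rewrite [RHS]integral_mkcond; apply: eq_integral => s _.
  rewrite patchE mem_setE/= in_itv/= andbT /F/=; case: ifP => ts; last by rewrite integral0.
  rewrite /tail; under eq_integral do rewrite EFinM.
  rewrite ge0_integralZl_EFin ?powR_ge0//; last 2 first.
  - by move=> y _; rewrite lee_fin gauss_ge0.
  - apply/measurable_EFinP; apply: (measurableT_comp measurable_gauss (g := fun y => (s, x - y))).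
    exact: measurable_fun_pair.
  by rewrite integral_gauss ?(lt_trans t0)// muleC.
rewrite ge0_integralZl_EFin ?exprn_ge0//; last 2 first.
- by move=> s _; rewrite lee_fin powR_ge0.
- by apply/measurable_EFinP/measurable_funTS; exact: measurable_powR.
apply: (@le_trans _ _ ((series_const (d := d))%:E * ((t `^ (- 2^-1))%:E * (2 ^+ d)%:E +
   (2 ^+ d)%:E * (2 * t `^ (- 2^-1))%:E))%E).
  rewrite lee_wpmul2l ?lee_fin// leeD2l// lee_wpmul2l ?lee_fin ?exprn_ge0//.
  exact: integral_powRN32.
rewrite -[leLHS]/((series_const (d := d) * (t `^ (- 2^-1) * 2 ^+ d +
  2 ^+ d * (2 * t `^ (- 2^-1))))%:E).
by rewrite lee_fin le_eqVlt; apply/orP; left; apply/eqP; ring.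
Qed.

End oseen_series.

(** * The mild formulation as a fixed point equation *)

Section kernel_of_two_points.
Context {R : realType} {d : nat}.
Implicit Types (s t h r b : R) (x y : 'rV[R]_d) (i j k : 'I_d).
Notation leb := (@lebesgue_measure R).
Notation Z := (R * 'rV[R]_d)%type.
Notation nu := (leb \x lebesgue_rV d)%E.
Implicit Types (p z : Z).

Let causal (q : Z * Z) := 0 < q.2.1 < q.1.1.

(** Extension by zero off 0 < s < t builds causality into the kernel, so all integrals run over one
    fixed space-time. *)
Definition kernel_series i j k n (q : Z * Z) : R :=
  if 0 < q.2.1 < q.1.1 then oseen_series i j k n (q.1.1 - q.2.1) (q.1.2 - q.2.2) else 0.

Definition kernel_bound (q : Z * Z) : R :=
  if 0 < q.2.1 < q.1.1 then oseen_bound (q.1.1 - q.2.1) (q.1.2 - q.2.2) else 0.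

Let measurable_causal : measurable_fun setT causal.
Proof.
have m1 : measurable_fun setT (fun q : Z * Z => q.2.1).
  exact: (measurableT_comp measurable_fst measurable_snd).
apply: measurable_and; apply: measurable_fun_ltr => //.
exact: (measurableT_comp measurable_fst measurable_fst).
Qed.

Let measurable_shifted (f : R -> 'rV[R]_d -> R) :
  measurable_fun setT (fun q : Z => f q.1 q.2) ->
  measurable_fun setT (fun q : Z * Z =>
    if causal q then f (q.1.1 - q.2.1) (q.1.2 - q.2.2) else 0).
Proof.
move=> mf; apply: measurable_fun_ifT => //.
apply: (measurableT_comp mf (g := fun q : Z * Z => (q.1.1 - q.2.1, q.1.2 - q.2.2))).
apply: measurable_fun_pair.
  apply: measurable_funB; first exact: (measurableT_comp measurable_fst measurable_fst).
  exact: (measurableT_comp measurable_fst measurable_snd).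
apply: measurable_fun_mxP => a b.
rewrite (_ : (fun q => _) = fun q : Z * Z => q.1.2 a b - q.2.2 a b); last first.
  by apply/funext => q; rewrite !mxE.
have me := measurable_entry (T := measurableTypeR R) a b.
apply: measurable_funB.
  exact: (measurableT_comp me (measurableT_comp measurable_snd measurable_fst)).
exact: (measurableT_comp me (measurableT_comp measurable_snd measurable_snd)).
Qed.

Lemma measurable_kernel_series i j k n : measurable_fun setT (kernel_series i j k n).
Proof. exact: measurable_shifted (measurable_oseen_series i j k n). Qed.

Lemma measurable_kernel_bound : measurable_fun setT kernel_bound.
Proof. exact: measurable_shifted measurable_oseen_bound. Qed.

Lemma wle_kernel_series i j k q : wle (1 / 8) (fun n => kernel_series i j k n q) (kernel_bound q).
Proof.
rewrite /kernel_series /kernel_bound; case: ifP => [/andP[_ ts]|_]; last exact: wle0.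
by apply: wle_oseen_series; rewrite subr_gt0.
Qed.

Lemma kernel_bound_ge0 q : 0 <= kernel_bound q.
Proof.
rewrite /kernel_bound; case: ifP => // /andP[_ ts].
rewrite mulr_ge0 ?series_const_ge0// addr_ge0//.
  by rewrite mulr_ge0 ?powR_ge0 ?gauss_ge0.
by apply: Rintegral_ge0 => s _; rewrite mulr_ge0 ?powR_ge0 ?gauss_ge0.
Qed.

(** Integrating out space leaves the one-dimensional kernel c (t - s)^(-1/2), for which the weighted
    smallness is known. *)
Lemma integral_kernel_bound eta : 0 < eta -> exists2 M, 0 <= M & forall p, 0 < p.1 <= 1 ->
  (\int[nu]_z (kernel_bound (p, z) * expR (M * z.1))%:E <= (eta * expR (M * p.1))%:E)%E.
Proof.
move=> eta0; pose c : R := 3 * 2 ^+ d * series_const (d := d).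
have c0 : 0 <= c by rewrite !mulr_ge0 ?exprn_ge0 ?series_const_ge0.
have [M M0 HM] := weighted_powRN12_small c0 eta0.
exists M => // -[t x] /= t01; apply: le_trans (HM t t01).
have mF : measurable_fun setT (fun z => (kernel_bound ((t, x), z) * expR (M * z.1))%:E).
  apply/measurable_EFinP; apply: measurable_funM.
    apply: (measurableT_comp measurable_kernel_bound (g := fun z => ((t, x), z))).
    exact: measurable_fun_pair.
  apply: measurableT_comp => //; exact: measurable_funM.
rewrite fubini_tonelli1//; last first.
  by move=> z; rewrite lee_fin mulr_ge0 ?expR_ge0 ?kernel_bound_ge0.
rewrite [leRHS]integral_mkcond; apply: ge0_le_integral => //.
- move=> s _; apply: integral_ge0 => y _.
  by rewrite lee_fin mulr_ge0 ?expR_ge0 ?kernel_bound_ge0.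
- apply: (measurable_fun_fubini_tonelli_F (m2 := lebesgue_rV d)) => //.
  by move=> z; rewrite lee_fin mulr_ge0 ?expR_ge0 ?kernel_bound_ge0.
- have mD : @measurable _ (measurableTypeR R) `]0, t[%classic by exact: measurable_itv.
  apply/(measurable_restrictT _ mD)/measurable_EFinP/measurable_funTS.
  apply: measurable_funM; last by apply: measurableT_comp => //; exact: measurable_funM.
  apply: measurable_funM => //.
  by apply: (measurableT_comp (measurable_powR _)); exact: measurable_funB.
move=> s _; rewrite /fubini_F /= patchE mem_setE/= in_itv/= /kernel_bound /=; case: ifP => s01.
  have ts : 0 < t - s by rewrite subr_gt0; case/andP: s01.
  under eq_integral do rewrite mulrC EFinM.
  rewrite ge0_integralZl_EFin ?expR_ge0//.
  - rewrite [X in (_ <= X%:E)%E]mulrC [leRHS]EFinM lee_wpmul2l ?lee_fin ?expR_ge0//.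
    by apply: le_trans (integral_oseen_bound x ts) _.
  - move=> y _; rewrite lee_fin; have := kernel_bound_ge0 ((t, x), (s, y)).
    by rewrite /kernel_bound/= s01.
  - apply/measurable_EFinP.
    apply: (measurableT_comp measurable_oseen_bound (g := fun y => (t - s, x - y))).
    by apply: measurable_fun_pair => //; exact: measurable_subl.
by under eq_integral do rewrite mul0r; rewrite integral0.
Qed.

Lemma integrable_kernel_bound p : 0 < p.1 <= 1 ->
  nu.-integrable setT (EFin \o (fun z => kernel_bound (p, z))).
Proof.
move=> p01; have [M M0 HM] := integral_kernel_bound (ltr01 : 0 < 1 :> R).
have mk : measurable_fun setT (fun z => kernel_bound (p, z)).
  apply: (measurableT_comp measurable_kernel_bound (g := fun z => (p, z))).
  exact: measurable_fun_pair.
apply: (@integrable_dom _ _ _ nu setT measurableT _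
  (fun z => kernel_bound (p, z) * expR (M * z.1))) => //.
  move=> z _; rewrite ger0_norm ?kernel_bound_ge0//.
  have := kernel_bound_ge0 (p, z); rewrite /kernel_bound.
  case: ifP => [/andP[z0 _] k0|_ _]; last by rewrite mul0r.
  by rewrite ler_peMr// -[leLHS]expR0 ler_expR mulr_ge0// ltW.
apply: integrable_ub (HM p p01).
  by apply: measurable_funM => //; apply: measurableT_comp => //; exact: measurable_funM.
by move=> z _; rewrite mulr_ge0 ?expR_ge0 ?kernel_bound_ge0.
Qed.

End kernel_of_two_points.

(** * The mild equation for the dilated solution *)

Section mild_fixed_point.
Import lebesgue_integral_fubini.
Context {R : realType} {d : nat}.
Implicit Types (s t h r b : R) (x y : 'rV[R]_d) (i j k : 'I_d).
Notation leb := (@lebesgue_measure R).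
Notation Z := (R * 'rV[R]_d)%type.
Notation nu := (leb \x lebesgue_rV d)%E.
Implicit Types (p z : Z).

(* Built by hand because inference finds only the instance for products of
   subprobabilities. *)
Definition space_time_measure :=
  HB.pack_for {sigma_finite_measure set (measurableTypeR R * 'rV[R]_d)%type -> \bar R} nu
    (measure_function_Measure_isSigmaFinite__to__measure_function_isSFinite leb (lebesgue_rV d))
    (measure_function_Measure_isSigmaFinite__to__measure_function_isSigmaFinite
      leb (lebesgue_rV d)).

Variables (u : R -> 'rV[R]_d -> 'rV[R]_d) (C2 : R).
Hypothesis mild : mild_solution u.
Hypothesis bounded : forall t x, 0 <= t <= 1 -> enorm (u t x) <= C2.

(** Extension by zero where the dilated time leaves [0, 1] makes the function bounded and measurable
    everywhere; the equation is claimed only where no extension is involved. *)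
Definition dilation r p i : R := if 0 <= r * p.1 <= 1 then u (r * p.1) p.2 0 i else 0.

Lemma bound_ge0 : 0 <= C2.
Proof.
apply: le_trans (bounded (t := 0) 0 _); first exact: sqrtr_ge0.
by rewrite lexx ler01.
Qed.

Lemma dilation_le r p i : `|dilation r p i| <= C2.
Proof.
rewrite /dilation; case: ifP => [rp|_]; last by rewrite normr0 bound_ge0.
exact: le_trans (coord_le_enorm _ _) (bounded _ rp).
Qed.

Lemma measurable_dilation r i : measurable_fun setT (fun p => dilation r p i).
Proof.
have [um _ _] := mild.
pose S := [set p : Z | 0 <= p.1 <= 1].
have mS : measurable S.
  rewrite (_ : S = setT `&` fst @^-1` `[0, 1]%classic); last first.
    by rewrite setTI; apply/seteqP; split=> p; rewrite /S /= in_itv.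
  by apply: measurable_fst => //; exact: measurable_itv.
have mu : measurable_fun S (fun p : Z => u p.1 p.2 0 i).
  exact: (measurableT_comp (measurable_entry (T := measurableTypeR R) 0 i) um).
have mg : measurable_fun setT ((fun p : Z => u p.1 p.2 0 i) \_ S).
  exact/(measurable_restrictT _ mS).
rewrite (_ : (fun p => _) = fun p : Z => ((fun p : Z => u p.1 p.2 0 i) \_ S) (r * p.1, p.2)).
  apply: (measurableT_comp mg (g := fun p : Z => (r * p.1, p.2))).
  by apply: measurable_fun_pair => //; exact: measurable_funM.
apply/funext => p; rewrite /dilation patchE /S; case: ifPn => rp; first by rewrite mem_set.
by rewrite memNset// => /=; exact/negP.
Qed.

Let initial_data y i : u 0 y 0 i = dilation 1 (0, y) i.
Proof. by rewrite /dilation /= mulr0 lexx ler01. Qed.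

Let initial_le y i : `|u 0 y 0 i| <= C2.
Proof. by rewrite initial_data dilation_le. Qed.

Let measurable_initial i : measurable_fun setT (fun y => u 0 y 0 i).
Proof.
rewrite (_ : (fun y => _) = fun y => dilation 1 (0, y) i); last first.
  by apply/funext => y; exact: initial_data.
apply: (measurableT_comp (measurable_dilation 1 i) (g := fun y => (0 : R, y))).
exact: measurable_fun_pair.
Qed.

Let slice (f : R -> 'rV[R]_d -> R) t x : measurable_fun setT (fun q : Z => f q.1 q.2) ->
  measurable_fun setT (fun y => f t (x - y)).
Proof.
move=> mf; apply: (measurableT_comp mf (g := fun y => (t, x - y))).
by apply: measurable_fun_pair => //; exact: measurable_subl.
Qed.

Definition caloric_series n p i : R :=
  \int[lebesgue_rV d]_y (heat_series 0 n p.1 (p.2 - y) * u 0 y 0 i).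

Lemma measurable_caloric_series n i : measurable_fun setT (fun p => caloric_series n p i).
Proof.
apply: (@measurable_Rintegral_param _ _ _ _ R (lebesgue_rV d)
  (fun w : Z * 'rV[R]_d => heat_series 0 n w.1.1 (w.1.2 - w.2) * u 0 w.2 0 i)).
apply: measurable_funM; last exact: (measurableT_comp (measurable_initial i) measurable_snd).
apply: (measurableT_comp (measurable_heat_series 0 n)
  (g := fun w : Z * 'rV[R]_d => (w.1.1, w.1.2 - w.2))).
apply: measurable_fun_pair; first exact: (measurableT_comp measurable_fst measurable_fst).
apply: measurable_fun_mxP => a b.
rewrite (_ : (fun w => _) = fun w : Z * 'rV[R]_d => w.1.2 a b - w.2 a b); last first.
  by apply/funext => w; rewrite !mxE.
have me := measurable_entry (T := measurableTypeR R) a b.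
apply: measurable_funB; last exact: (measurableT_comp me measurable_snd).
exact: (measurableT_comp me (measurableT_comp measurable_snd measurable_fst)).
Qed.

Let caloric_bound : R := 2 ^+ d * (series_const (d := d) * C2).

Let mterm t x i n : measurable_fun setT (fun y => heat_series 0 n t (x - y) * u 0 y 0 i).
Proof.
apply: measurable_funM; last exact: measurable_initial.
by apply: (slice (f := heat_series 0 n)); exact: measurable_heat_series.
Qed.

Let mbound t x : measurable_fun setT (fun y => series_const (d := d) * C2 * gauss t (x - y)).
Proof.
by apply: measurable_funM => //; apply: (slice (f := gauss)); exact: measurable_gauss.
Qed.

Let wterm t x i : 0 < t -> forall y, [set: 'rV[R]_d] y ->
  wle (1 / 8) (fun n => heat_series 0 n t (x - y) * u 0 y 0 i)
    (series_const (d := d) * C2 * gauss t (x - y)).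
Proof.
move=> t0 y _; have b01 : 0 <= (0 : R) <= 1 by rewrite lexx ler01.
have := wleZ (u 0 y 0 i) (wle_heat_series (x - y) b01 t0).
move=> /(@wle_eq R _ _ (fun n => heat_series 0 n t (x - y) * u 0 y 0 i)).
move=> /(_ (fun n => mulrC _ _)) /wle_trans; apply.
rewrite [leRHS](_ : _ = C2 * (series_const (d := d) * gauss t (x - y))); last by ring.
apply: ler_pM => //; first by rewrite mulr_ge0 ?gauss_ge0// mulr_ge0 ?expR_ge0.
apply: ler_wpM2r; first exact: gauss_ge0.
rewrite /series_const [leRHS]mulrC; apply: ler_wpM2l; first exact: expR_ge0.
apply: (@le_trans _ _ 1); last by lra.
by rewrite -[leRHS]expR0 ler_expR oppr_le0 divr_ge0 ?sqr_ge0// mulr_ge0// ltW.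
Qed.

Let int_bound t x : 0 < t ->
  (\int[lebesgue_rV d]_y (series_const (d := d) * C2 * gauss t (x - y))%:E <= caloric_bound%:E)%E.
Proof.
move=> t0; under eq_integral do rewrite EFinM.
rewrite ge0_integralZl_EFin ?mulr_ge0 ?series_const_ge0 ?bound_ge0//.
- by rewrite integral_gauss// -EFinM lee_fin mulrC.
- by move=> y _; rewrite lee_fin gauss_ge0.
- by apply/measurable_EFinP; apply: (slice (f := gauss)); exact: measurable_gauss.
Qed.

Let e8 : 0 < 1 / 8 :> R. Proof. lra. Qed.

Lemma wle_caloric_series p i : 0 < p.1 <= 1 ->
  wle (1 / 8) (fun n => caloric_series n p i) caloric_bound.
Proof.
case: p => t x /= /andP[t0 _].
exact: (wle_Rintegral measurableT e8 (mterm t x i) (mbound t x)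
  (wterm x i t0) (int_bound x t0)).
Qed.

Lemma psum_caloric_series h p i : `|h| < 1 / 32 -> 0 < p.1 <= 1 ->
  psum h (fun n => caloric_series n p i) =
  \int[lebesgue_rV d]_y (heat_kernel ((1 + h) * p.1) (p.2 - y) * u 0 y 0 i).
Proof.
case: p => t x /= h32 /andP[t0 _].
have h8 : `|h| <= 1 / 8 by apply/ltW/(lt_trans h32); lra.
rewrite (psum_Rintegral measurableT e8 (mterm t x i) (mbound t x)
  (wterm x i t0) (int_bound x t0) h8).
have b01 : 0 <= (0 : R) <= 1 by rewrite lexx ler01.
apply: eq_Rintegral => y _; rewrite (psum_eq h (fun n => mulrC _ _)).
rewrite (psumZ _ h8 (wle_heat_series (x - y) b01 t0)) psum_heat_series//.
by rewrite oppr0 powRr0 mulr1 mulrC.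
Qed.

Section duhamel.
Variables (h t : R) (x : 'rV[R]_d) (i j k : 'I_d).
Hypothesis h32 : `|h| < 1 / 32.
Hypothesis t01 : 0 < t <= 1.
Hypothesis ht1 : (1 + h) * t <= 1.

Let r := 1 + h.
Let p : Z := (t, x).
Let G z := psum h (fun n => kernel_series i j k n (p, z)) * (dilation r z j * dilation r z k).
Let H s := \int[lebesgue_rV d]_y G (s, y).

Let r0 : 0 < r. Proof. by move: h32; rewrite /r ltr_norml => ?; lra. Qed.

Let h8 : `|h| <= 1 / 8. Proof. by apply/ltW/(lt_trans h32); lra. Qed.

Let measurable_G : measurable_fun setT G.
Proof.
apply: measurable_funM; last by apply: measurable_funM; exact: measurable_dilation.
apply: (measurable_psum (g := fun z => kernel_bound (p, z)) _ _ h8).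
  move=> n; apply: (measurableT_comp (measurable_kernel_series i j k n) (g := fun z => (p, z))).
  exact: measurable_fun_pair.
by move=> z _; exact: wle_kernel_series.
Qed.

Let G_le z : `|G z| <= C2 ^+ 2 * kernel_bound (p, z).
Proof.
rewrite normrM mulrC; apply: ler_pM => //; last exact: psum_le h8 (wle_kernel_series _ _ _ _).
by rewrite normrM expr2 ler_pM ?dilation_le.
Qed.

Let integrable_G : nu.-integrable setT (EFin \o G).
Proof.
have p01 : 0 < p.1 <= 1 by [].
have i1 : nu.-integrable setT (EFin \o (fun z => C2 ^+ 2 * kernel_bound (p, z))).
  have := integrableZl measurableT (C2 ^+ 2) (integrable_kernel_bound p01).
  by apply: eq_integrable => // z _ /=; rewrite EFinM.
by apply: (@integrable_dom _ _ _ nu setT measurableT G _ measurable_G) i1 => z _; exact: G_le.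
Qed.

Let kernel0 z : ~~ (0 < z.1 < t) -> G z = 0.
Proof.
move=> /negbTE zt; rewrite /G (psum_eq h (b := fun=> 0)) ?psum0 ?mul0r// => n.
by rewrite /kernel_series /= zt.
Qed.

(** Fubini alone would give this for almost every [s]. The pointwise kernel bound gives every [s],
    so the real-valued iterated integral agrees with the extended one everywhere. *)
Let integrable_slice s : (lebesgue_rV d).-integrable setT (EFin \o (fun y => G (s, y))).
Proof.
have [st|st] := boolP (0 < s < t); last first.
  rewrite (_ : _ \o _ = cst 0%E); first exact: integrable0.
  by apply/funext => y; rewrite /= kernel0.
have ts : 0 < t - s by rewrite subr_gt0; case/andP: st.
have mo : measurable_fun setT (fun y => oseen_bound (t - s) (x - y)).
  by apply: (slice (f := oseen_bound)); exact: measurable_oseen_bound.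
have k0 y : 0 <= oseen_bound (t - s) (x - y).
  by have := kernel_bound_ge0 (p, (s, y)); rewrite /kernel_bound /= st.
have i1 := integrable_ub mo (fun y _ => k0 y) (integral_oseen_bound x ts).
have i2 : (lebesgue_rV d).-integrable setT
    (EFin \o (fun y => C2 ^+ 2 * oseen_bound (t - s) (x - y))).
  have := integrableZl measurableT (C2 ^+ 2) i1.
  by apply: eq_integrable => // y _ /=; rewrite EFinM.
apply: (integrable_dom measurableT _ _ i2).
  apply: (measurableT_comp measurable_G (g := fun y => (s, y))).
  exact: measurable_fun_pair.
by move=> y _; apply: le_trans (G_le _) _; rewrite /kernel_bound /= st.
Qed.

Let fubini_FE : fubini_F (lebesgue_rV d) (EFin \o G) = EFin \o H.
Proof.
apply/funext => s; rewrite /fubini_F /= /H /Rintegral fineK//.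
by apply: integrable_fin_num => //; exact: integrable_slice.
Qed.

Let integrable_H : leb.-integrable setT (EFin \o H).
Proof. by rewrite -fubini_FE; exact: (integrable_fubini_F integrable_G). Qed.

(** The substitution r s for s turns r t - r s into r (t - s), and its Jacobian is the factor 1 + h
    in the sum of the kernel series. Fubini then merges the iterated integral into one over
    space-time. *)
Lemma duhamel_product :
  \int[leb]_(s in `]0, (r * t)[) \int[lebesgue_rV d]_y
     (partial k (oseen_kernel i j (r * t - s)) (x - y) * (u s y 0 j * u s y 0 k)) =
  \int[nu]_z G z.
Proof.
have mD : @measurable _ (measurableTypeR R) `]0, t[%classic by exact: measurable_itv.
have mH : measurable_fun setT H.
  by apply/measurable_EFinP; exact: (measurable_int _ integrable_H).
transitivity (\int[leb]_(s in `]0, t[) H s); last first.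
  have GH : (\int[nu]_z (G z)%:E = \int[leb]_s (H s)%:E)%E.
    transitivity (\int[leb]_s fubini_F (lebesgue_rV d) (EFin \o G) s)%E.
      exact/esym/(integral12_prod_meas1 integrable_G).
    by rewrite fubini_FE.
  rewrite [RHS]/Rintegral GH.
  rewrite [LHS]Rintegral_mkcond /Rintegral; congr fine; apply: eq_integral => s _.
  rewrite patchE mem_setE/= in_itv/=; case: ifPn => // st.
  rewrite /H (_ : (fun y => _) = cst 0); first by rewrite /Rintegral integral0.
  by apply/funext => y; rewrite kernel0.
(* The factor r^-1 cancels the 1 + h carried by the sum of the kernel series. *)
transitivity (\int[leb]_(s in `]0, (r * t)[) (r^-1 * H (r^-1 * s))).
  apply: eq_Rintegral => s; rewrite inE/= in_itv/= => /andP[s0 st].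
  have rs : 0 < r^-1 * s < t.
    by rewrite mulr_gt0 ?invr_gt0//= mulrC ltr_pdivrMr// mulrC.
  rewrite -RintegralZl//; apply: eq_Rintegral => y _.
  rewrite /G (psum_eq h (b := fun n => oseen_series i j k n (t - r^-1 * s) (x - y))); last first.
    by move=> n; rewrite /kernel_series/= rs.
  rewrite psum_oseen_series ?subr_gt0//; last by case/andP: rs.
  rewrite /dilation/= mulVKf ?gt_eqF// (ltW s0) (le_trans (ltW st) ht1)/=.
  by rewrite -/r mulrBr mulVKf ?gt_eqF// !mulrA mulVf ?gt_eqF// mul1r.
rewrite (Rintegral_lebesgue_scale r0); last 2 first.
- exact: measurable_itv.
- apply: measurable_funTS; apply: measurable_funM => //.
  by apply: (measurableT_comp mH); exact: measurable_funM.
rewrite (_ : _ @^-1` _ = `]0, t[%classic); last first.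
  by apply/seteqP; split=> s /=; rewrite !in_itv/= pmulr_rgt0// ltr_pM2l.
under eq_Rintegral do rewrite mulKf ?gt_eqF//.
rewrite RintegralZl//; first by rewrite mulVKf ?gt_eqF.
by apply: (integrableS measurableT mD) integrable_H.
Qed.

End duhamel.

Lemma dilation_eq h p i : `|h| < 1 / 32 -> 0 < p.1 <= 1 -> (1 + h) * p.1 <= 1 ->
  dilation (1 + h) p i = psum h (fun n => caloric_series n p i) -
    \sum_j \sum_k \int[nu]_z (psum h (fun n => kernel_series i j k n (p, z)) *
      (dilation (1 + h) z j * dilation (1 + h) z k)).
Proof.
case: p => t x /= h32 t01 rt.
have r0 : 0 < 1 + h by move: h32; rewrite ltr_norml => ?; lra.
have rt0 : 0 < (1 + h) * t by rewrite mulr_gt0//; case/andP: t01.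
have [_ _ u_eq] := mild.
rewrite {1}/dilation /= (ltW rt0) rt/= u_eq ?rt0// psum_caloric_series//=.
congr (_ - _); apply: eq_bigr => j _; apply: eq_bigr => k _.
exact: duhamel_product.
Qed.

(** Applies the abstract fixed point theorem with [dilation 1] as the starting solution and
    [dilation (1 + h)] as the competitor [v]; the cap 1 / 64 keeps h inside the range 1 / 32 of the
    kernel identities. *)
Lemma time_series : exists (sigma A : R) (a : nat -> R -> 'rV[R]_d -> 'I_d -> R),
  [/\ 0 < sigma <= 1 / 64,
      forall t x i, 0 < t <= 1 -> wle sigma (fun n => a n t x i) A &
      forall h t x i, `|h| <= sigma -> 0 < t <= 1 -> (1 + h) * t <= 1 ->
        u ((1 + h) * t) x 0 i = psum h (fun n => a n t x i)].
Proof.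
have e64 : 0 < 1 / 64 :> R by lra.
have [d0|d0] := posnP d.
  (* In dimension 0 there are no components and the claim is vacuous; the fixed point theorem needs
     an inhabited index type. *)
  exists (1 / 64), 0, (fun _ _ _ _ => 0); rewrite e64 lexx; split=> // [t x i|h t x i];
  exfalso; have := leq_ltn_trans (leq0n i) (ltn_ord i); by rewrite d0.
have Kz i j k n p z : ~~ (0 < z.1 < p.1) -> kernel_series i j k n (p, z) = 0.
  by move=> /negbTE zp; rewrite /kernel_series /= zp.
have u_eq p i : 0 < p.1 <= 1 -> dilation 1 p i = caloric_series 0 p i -
    \sum_j \sum_k \int[nu]_z (kernel_series i j k 0 (p, z) * (dilation 1 z j * dilation 1 z k)).
  move=> p01; have e32 : `|0 : R| < 1 / 32 by rewrite normr0; lra.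
  have := @dilation_eq 0 p i e32 p01; rewrite addr0 mul1r psum_at0 => ->; last by case/andP: p01.
  congr (_ - _); apply: eq_bigr => j _; apply: eq_bigr => k _.
  by apply: eq_Rintegral => z _; rewrite psum_at0.
have [sigma [a [s0 wa ha]]] := @analytic_fixed_point _ _ R space_time_measure 'I_d fst
  kernel_series kernel_bound caloric_series (dilation 1) (1 / 8) _ C2 measurable_fst e8
  measurable_kernel_series
  measurable_kernel_bound wle_kernel_series Kz integral_kernel_bound measurable_caloric_series
  wle_caloric_series (measurable_dilation 1) (dilation_le 1) u_eq (Ordinal d0) (1, 0)
  (ltac:(by rewrite ltr01 lexx)).
exists (Num.min sigma (1 / 64)), (C2 + 2), (fun n t x i => a n (t, x) i).
have m0 : 0 < Num.min sigma (1 / 64) by rewrite lt_min s0.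
split; first by rewrite m0 ge_min lexx orbT.
  move=> t x i t01; apply: wle_shrink (wa (t, x) i t01); first exact: ltW.
  by rewrite ge_min lexx.
move=> h t x i; rewrite le_min => /andP[hs h64] t01 rt.
have h32 : `|h| < 1 / 32 by apply: le_lt_trans h64 _; lra.
have r0 : 0 < 1 + h by move: h32; rewrite ltr_norml => ?; lra.
(* The horizon is T = t: the equation for the dilated solution holds at every earlier time, since
   its dilate is at most (1 + h) t <= 1. *)
have := ha h t (dilation (1 + h)) hs _ (measurable_dilation (1 + h)) (dilation_le (1 + h)).
move=> /(_ _ _ (t, x) i) <-.
- by rewrite /dilation /= mulr_ge0 ?rt ?(ltW r0)//; case/andP: t01 => /ltW.
- by case/andP: t01.
- move=> q l /andP[q0 qt]; apply: dilation_eq => //.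
    by rewrite q0 (le_trans qt)//; case/andP: t01.
  by apply: le_trans rt; rewrite ler_pM2l.
- by case/andP: t01 => /= ->; rewrite lexx.
Qed.

End mild_fixed_point.

(** * Time derivatives *)

Section time_calculus.
Context {R : realType} {d : nat}.
Implicit Types (s t r e : R) (x y : 'rV[R]_d) (i j k : 'I_d).

(** Approaching from the left stays inside the interval, also at the endpoint t = 1. *)
Lemma within_time_proper t : 0 < t <= 1 -> ProperFilter (within `]0, 1]%classic t^').
Proof.
move=> /andP[t0 t1]; apply: Build_ProperFilter_ex => P.
move=> /nbhs_ballP[e /= e0 Pe]; pose m := Num.min e t.
have m0 : 0 < m by rewrite lt_min e0.
have [me mt] : m <= e /\ m <= t by rewrite !ge_min !lexx orbT.
exists (t - m / 2); apply: Pe.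
- by rewrite /ball/= opprD addNKr opprK ger0_norm; lra.
- by rewrite lt_eqF//; lra.
- by rewrite /= in_itv/=; apply/andP; split; lra.
Qed.

Lemma row_norm_lt (v : 'rV[R]_d) e : 0 < e -> (forall i, `|v 0 i| < e) -> `|v| < e.
Proof.
move=> e0 ve; rewrite [`|v|]mx_normrE; apply/bigmax_ltP; split => // -[a i] _ /=.
by rewrite (ord1 a).
Qed.

Lemma cvg_row T (F : set_system T) (FF : Filter F) (f : T -> 'rV[R]_d) (l : 'rV[R]_d) :
  (forall i, (fun z => f z 0 i) @ F --> l 0 i) -> f @ F --> l.
Proof.
move=> fl; apply/cvgrPdist_lt => e e0.
have H i : \forall z \near F, `|l 0 i - f z 0 i| < e by move/cvgrPdist_lt: (fl i); exact.
apply: filterS (filter_forall FF H) => z lz; apply: row_norm_lt => // i.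
by rewrite !mxE.
Qed.

Lemma quotient_cvg (g : R -> R) t dg : is_derive t (1 : R) g dg ->
  (s - t)^-1 * (g s - g t) @[s --> t^'] --> dg.
Proof.
move=> [gt <-]; apply/cvgrPdist_lt => e e0.
have /cvgrPdist_lt/(_ e e0)/nbhs_ballP[r /= r0 Hr] :
  (fun h => h^-1 *: ((g \o shift t) (h *: (1 : R)) - g t)) @ 0^' --> 'D_1 g t by exact: gt.
apply/nbhs_ballP; exists r => //= s bs st; have := Hr (s - t).
rewrite /= subr_eq0 /GRing.scale /= mulr1 subrK; apply => //.
by move: bs; rewrite /ball/= sub0r normrN distrC.
Qed.

(** The comparison functions [g i] are differentiable on both sides of t, whereas [f] agrees with
    them only at times in ]0, 1]. This is how the endpoint 1 is handled. *)
Lemma time_quotient_cvg (f : R -> 'rV[R]_d) (g : 'I_d -> R -> R) (dg : 'I_d -> R) t e :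
  0 < t <= 1 -> 0 < e -> (forall s i, 0 < s <= 1 -> `|s - t| < e -> f s 0 i = g i s) ->
  (forall i, is_derive t (1 : R) (g i) (dg i)) ->
  time_quotient f t s @[s --> within `]0, 1] t^'] --> \row_i dg i.
Proof.
move=> t01 e0 fg gd; have FP := within_time_proper t01.
apply: cvg_row => i; rewrite mxE.
apply/cvgrPdist_lt => eps eps0.
have /cvgrPdist_lt/(_ eps eps0)/nbhs_ballP[r /= r0 Hr] := quotient_cvg (gd i).
apply/nbhs_ballP; exists (Num.min r e); first by rewrite /= lt_min r0.
move=> s; rewrite /ball/= lt_min => /andP[sr se] st; rewrite in_itv/= => s01.
rewrite !mxE !fg ?subrr ?normr0//; first exact: Hr.
by rewrite distrC.
Qed.

Lemma time_derive_eq (f : R -> 'rV[R]_d) (g : 'I_d -> R -> R) (dg : 'I_d -> R) t e :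
  0 < t <= 1 -> 0 < e -> (forall s i, 0 < s <= 1 -> `|s - t| < e -> f s 0 i = g i s) ->
  (forall i, is_derive t (1 : R) (g i) (dg i)) ->
  time_derivable f t /\ forall i, time_derive f t 0 i = dg i.
Proof.
move=> t01 e0 fg gd; have cv := time_quotient_cvg t01 e0 fg gd.
have FP := within_time_proper t01.
split; first by apply/cvg_ex; exists (\row_i dg i).
by move=> i; rewrite /time_derive (cvg_lim _ cv) ?mxE//; exact: norm_hausdorff.
Qed.

Lemma enorm_le (v : 'rV[R]_d) B : (forall i, `|v 0 i| <= B) -> enorm v <= d%:R * B.
Proof.
have [d0|d0] := posnP d.
  move=> _; rewrite (_ : enorm v = 0); first by rewrite (_ : d%:R = 0 :> R) ?mul0r// d0.
  rewrite /enorm big1 ?sqrtr0// => i _; exfalso.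
  by have := leq_ltn_trans (leq0n i) (ltn_ord i); rewrite d0.
move=> vB; have B0 : 0 <= B by exact: le_trans (normr_ge0 _) (vB (Ordinal d0)).
have dB : 0 <= d%:R * B by rewrite mulr_ge0.
rewrite -(ger0_norm dB) -sqrtr_sqr ler_sqrt ?sqr_ge0//.
apply: (@le_trans _ _ (\sum_(i < d) B ^+ 2)).
  by apply: ler_sum => i _; rewrite -real_normK ?num_real// lerXn2r ?nnegrE.
rewrite sumr_const card_ord -[_ *+ d]mulr_natl exprMn.
apply: ler_wpM2r; first exact: sqr_ge0.
by rewrite expr2 ler_peMl// ler1n.
Qed.

Lemma fact_le_expn n : (n`! <= n ^ n)%N.
Proof.
suff H m : (m <= n)%N -> (m`! <= n ^ m)%N by exact: H.
by elim: m => // m IH mn; rewrite factS expnS leq_mul// IH// ltnW.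
Qed.

Lemma pseries_diffs_iter (c : nat -> R) n m :
  m`!%:R * iter n (@pseries_diffs R) c m = (m + n)`!%:R * c (m + n)%N.
Proof.
elim: n m => [|n IH] m; first by rewrite addn0.
by rewrite iterS /pseries_diffs mulrA -natrM mulnC -factS IH addSnnS.
Qed.

Lemma wle_pseries_diffs_iter s (c : nat -> R) A n : 0 < s -> wle s c A ->
  exists B, wle (s / 2 ^+ n) (iter n (@pseries_diffs R) c) B.
Proof.
move=> s0 cA; elim: n => [|n [B IH]]; first by exists A; rewrite expr0 divr1.
have sn : 0 < s / 2 ^+ n by rewrite divr_gt0// exprn_gt0.
exists (B / (s / 2 ^+ n)); rewrite exprSr invfM mulrA.
exact: wle_pseries_diffs.
Qed.

Lemma is_derive_psum_scaled s (c : nat -> R) A t r : 0 < s -> wle s c A -> 0 < t ->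
  `|(r - t) / t| < s / 4 -> is_derive r (1 : R) (fun r => psum ((r - t) / t) c)
    (psum ((r - t) / t) (pseries_diffs c) / t).
Proof.
move=> s0 cA t0 rt; have dp := is_derive_psum s0 cA rt.
have dl : is_derive r (1 : R) (fun r => (r - t) / t) t^-1.
  rewrite (_ : (fun r => _) = (t^-1 \*: (id - cst t))); last first.
    by apply/funext => y; rewrite !fctE mulrC.
  by apply: is_derive_eq; rewrite subr0 /GRing.scale /= mulr1.
exact: (is_derive1_comp (f := fun r => psum r c) (g := fun r => (r - t) / t) dp dl).
Qed.

End time_calculus.

(** * Derivative bounds and analyticity from the series *)

Section bounds_from_series.
Context {R : realType} {d : nat}.
Implicit Types (s t r h : R) (x y : 'rV[R]_d) (i j k : 'I_d).
Variables (u : R -> 'rV[R]_d -> 'rV[R]_d) (sigma A : R).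
Variable a : nat -> R -> 'rV[R]_d -> 'I_d -> R.
Hypothesis sigma0 : 0 < sigma.
Hypothesis wa : forall t x i, 0 < t <= 1 -> wle sigma (fun n => a n t x i) A.
Hypothesis ua : forall h t x i, `|h| <= sigma -> 0 < t <= 1 -> (1 + h) * t <= 1 ->
  u ((1 + h) * t) x 0 i = psum h (fun n => a n t x i).

Let series_at s t x i : 0 < t <= 1 -> s <= 1 -> `|s - t| <= sigma * t ->
  `|(s - t) / t| <= sigma /\ u s x 0 i = psum ((s - t) / t) (fun n => a n t x i).
Proof.
move=> t01 s1 st; have t0 : 0 < t by case/andP: t01.
have hs : `|(s - t) / t| <= sigma by rewrite normrM normfV (gtr0_norm t0) ler_pdivrMr.
have E : (1 + (s - t) / t) * t = s by field; rewrite gt_eqF.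
by split=> //; rewrite -ua// E.
Qed.

Let coef n t x i := iter n (@pseries_diffs R) (fun m => a m t x i).

(** The centre t of the expansion stays fixed while s varies, because the next derivative at s needs
    the formula on a whole neighbourhood of s. Dividing the radius by 4 at each order leaves room
    for that neighbourhood and stays within the differentiability range sigma / 2^n / 4. *)
Let near_time n s t x : 0 < t <= 1 -> 0 < s <= 1 -> `|s - t| < sigma / 4 ^+ n.+1 * t ->
  (forall r i, 0 < r <= 1 -> `|r - t| < sigma / 4 ^+ n * t ->
    time_deriven n (u^~ x) r 0 i = t ^- n * psum ((r - t) / t) (coef n t x i)) ->
  time_derivable (time_deriven n (u^~ x)) s /\ forall i, time_deriven n.+1 (u^~ x) s 0 i =
  t ^- n.+1 * psum ((s - t) / t) (coef n.+1 t x i).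
Proof.
move=> t01 s01 st IH; have t0 : 0 < t by case/andP: t01.
have p4 : 0 < sigma / 4 ^+ n by rewrite divr_gt0// exprn_gt0.
have p44 : sigma / 4 ^+ n.+1 * t < sigma / 4 ^+ n * t.
  by rewrite ltr_pM2r// exprSr invfM mulrA; lra.
pose e := sigma / 4 ^+ n * t - `|s - t|.
have e0 : 0 < e by rewrite subr_gt0 (lt_trans st).
have fg r i : 0 < r <= 1 -> `|r - s| < e -> time_deriven n (u^~ x) r 0 i =
    t ^- n * psum ((r - t) / t) (coef n t x i).
  move=> r01 rs; apply: IH => //.
  rewrite (_ : r - t = (r - s) + (s - t)); last by ring.
  by apply: le_lt_trans (ler_normD _ _) _; rewrite -ltrBrDr.
have sn : 0 < sigma / 2 ^+ n by rewrite divr_gt0// exprn_gt0.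
have hs : `|(s - t) / t| < sigma / 2 ^+ n / 4.
  rewrite normrM normfV (gtr0_norm t0) ltr_pdivrMr//; apply: lt_le_trans st _.
  rewrite ler_pM2r// exprSr invfM mulrA ler_pM2r// ler_pM2l// lef_pV2 ?posrE ?exprn_gt0//.
  by rewrite lerXn2r ?nnegrE//; lra.
have gd i : is_derive s (1 : R) (fun r => t ^- n * psum ((r - t) / t) (coef n t x i))
    (t ^- n.+1 * psum ((s - t) / t) (coef n.+1 t x i)).
  have [B cB] := wle_pseries_diffs_iter n sigma0 (wa x i t01).
  have dp := is_derive_psum_scaled sn cB t0 hs.
  rewrite (_ : (fun r => _) = t ^- n \*: (fun r => psum ((r - t) / t) (coef n t x i)))//.
  apply: is_derive_eq; rewrite /GRing.scale /= exprSr invfM -mulrA; congr (_ * _).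
  by rewrite mulrC.
exact: time_derive_eq s01 e0 fg gd.
Qed.

Lemma time_deriven_eq n s t x i : 0 < t <= 1 -> 0 < s <= 1 -> `|s - t| < sigma / 4 ^+ n * t ->
  time_deriven n (u^~ x) s 0 i =
  t ^- n * psum ((s - t) / t) (iter n (@pseries_diffs R) (fun m => a m t x i)).
Proof.
move=> t01; elim: n s i => [|n IH] s i s01 st; last exact: (near_time t01 s01 st IH).2.
rewrite expr0 divr1 in st; rewrite expr0 invr1 mul1r.
by case: (series_at x i t01 _ (ltW st)) => //; case/andP: s01.
Qed.

Lemma time_derivable_deriven n t x : 0 < t <= 1 ->
  time_derivable (time_deriven n (u^~ x)) t.
Proof.
move=> t01; have t0 : 0 < t by case/andP: t01.
apply: (near_time t01 t01 _ (fun r i r01 rt => time_deriven_eq x i t01 r01 rt)).1.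
by rewrite subrr normr0 mulr_gt0// divr_gt0// exprn_gt0.
Qed.

(** At s = t only the constant term of the n-th formal derivative survives, namely n! a_n; then
    |a_n| <= A sigma^-n and n! <= n^n. *)
Lemma time_deriven_le n t x i : 0 < t <= 1 ->
  `|time_deriven n (u^~ x) t 0 i| <= A * (sigma^-1 * n%:R / t) ^+ n.
Proof.
move=> t01; have t0 : 0 < t by case/andP: t01.
have st : `|t - t| < sigma / 4 ^+ n * t.
  by rewrite subrr normr0 mulr_gt0// divr_gt0// exprn_gt0.
rewrite (time_deriven_eq x i t01 t01 st) subrr mul0r psum_at0.
have := pseries_diffs_iter (fun m => a m t x i) n 0; rewrite mul1r add0n => ->.
have := wle_coef n (ltW sigma0) (wa x i t01).
rewrite -ler_pdivlMr ?exprn_gt0// => an.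
rewrite !normrM normfV normrX (gtr0_norm t0) (ger0_norm (x := n`!%:R))//.
rewrite !exprMn !exprVn.
rewrite [leRHS](_ : _ = t ^- n * (n%:R ^+ n * (A / sigma ^+ n))); last by ring.
apply: ler_wpM2l; first by rewrite invr_ge0 exprn_ge0// ltW.
by apply: ler_pM => //; rewrite -natrX ler_nat fact_le_expn.
Qed.

Lemma time_analytic_series t x : 0 < t <= 1 -> time_analytic (u^~ x) t.
Proof.
move=> t01; have t0 : 0 < t by case/andP: t01.
exists (fun m => \row_i (a m t x i / t ^+ m)), (sigma * t); first by rewrite mulr_gt0.
move=> s /andP[s0 s1] st; apply: cvg_row => i.
have [hs ->] := series_at x i t01 s1 (ltW st).
rewrite (_ : (fun N => _) = pseries (fun m => a m t x i) ((s - t) / t)).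
  exact: psum_cvg hs (wa x i t01).
apply/funext => N; rewrite /pseries /series /= summxE; apply: eq_bigr => m _.
by rewrite !mxE expr_div_n; ring.
Qed.

Lemma time_derivatives_bound : exists2 N : R, 1 <= N &
  forall n : nat, (1 <= n)%N ->
      (forall x : 'rV[R]_d, time_derivablen n (u^~ x)) /\
      (ereal_sup [set (t ^+ n)%:E *
          'N[lebesgue_rV d]_(+oo)[(fun x : 'rV[R]_d =>
             (enorm (time_deriven n (u^~ x) t))%:E)] | t in `]0%R : R, 1%R]]
        <= (N ^+ n.+1 * n%:R ^+ n)%:E)%E.
Proof.
(* One factor N absorbs d |A|, where d comes from passing from components to the Euclidean norm; the
   other n factors absorb sigma^-n. *)
pose N : R := 1 + d%:R * `|A| + sigma^-1.
have dA0 : 0 <= d%:R * `|A| by rewrite mulr_ge0.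
have s0 : 0 < sigma^-1 by rewrite invr_gt0.
have N1 : 1 <= N by rewrite /N; lra.
exists N => // n _; split=> [x m t _|]; first exact: time_derivable_deriven.
apply: ub_ereal_sup => _ [t /= t01 <-]; rewrite in_itv/= in t01.
have t0 : 0 < t by case/andP: t01.
pose c := N ^+ n.+1 * n%:R ^+ n / t ^+ n.
have N0 : 0 <= N by exact: le_trans N1.
have c0 : 0 <= c by rewrite divr_ge0 ?mulr_ge0 ?exprn_ge0// ltW.
have bound x : enorm (time_deriven n (u^~ x) t) <= c.
  apply: (@le_trans _ _ (d%:R * (`|A| * (sigma^-1 * n%:R / t) ^+ n))).
    apply: enorm_le => i; apply: le_trans (time_deriven_le n x i t01) _.
    by rewrite ler_wpM2r ?ler_norm// exprn_ge0// divr_ge0 ?mulr_ge0 ?(ltW t0) ?(ltW s0).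
  rewrite mulrA !exprMn -!mulrA [leRHS](_ : _ =
      N * (N ^+ n * (n%:R ^+ n * t ^-1 ^+ n))); last first.
    by rewrite /c exprS exprVn; ring.
  rewrite mulrA; apply: ler_pM; rewrite ?mulr_ge0 ?exprn_ge0 ?invr_ge0 ?(ltW t0) ?(ltW sigma0)//.
    by rewrite /N; lra.
  apply: ler_wpM2r; first by rewrite mulr_ge0 ?exprn_ge0 ?invr_ge0 ?(ltW t0).
  by rewrite lerXn2r ?nnegrE ?(ltW s0)//; rewrite /N; lra.
have Nc : ('N[lebesgue_rV d]_(+oo)[(fun x : 'rV[R]_d =>
    (enorm (time_deriven n (u^~ x) t))%:E)] <= c%:E)%E.
  (* The norm has a default branch with value 0; in the other branch the pointwise bound controls
     the essential supremum. *)
  rewrite unlock; case: ifP => _; last by rewrite lee_fin.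
  apply/ess_supP; apply: aeW => x /=.
  by rewrite lee_fin ger0_norm ?bound// sqrtr_ge0.
apply: (@le_trans _ _ ((t ^+ n)%:E * c%:E)%E).
  by rewrite lee_wpmul2l// lee_fin exprn_ge0// ltW.
by rewrite -EFinM lee_fin /c mulrC divfK// expf_neq0// gt_eqF.
Qed.

End bounds_from_series.

Theorem theorem3p1 (R : realType) (d : nat)
    (u : R -> 'rV[R]_d -> 'rV[R]_d) (C2 : R) :
  mild_solution u ->
  (forall (t : R) (x : 'rV[R]_d), 0 <= t <= 1 -> enorm (u t x) <= C2) ->
  (exists2 N : R, 1 <= N &
    forall n : nat, (1 <= n)%N ->
      (forall x : 'rV[R]_d, time_derivablen n (u^~ x)) /\
      (ereal_sup [set (t ^+ n)%:E *
          'N[lebesgue_rV d]_(+oo)[(fun x : 'rV[R]_d =>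
             (enorm (time_deriven n (u^~ x) t))%:E)] | t in `]0%R : R, 1%R]]
        <= (N ^+ n.+1 * n%:R ^+ n)%:E)%E) /\
  (forall (t : R) (x : 'rV[R]_d), 0 < t <= 1 -> time_analytic (u^~ x) t).
Proof.
move=> mild bounded.
have [sigma [A [a [/andP[sigma0 _] wa ua]]]] := time_series mild bounded.
split; first exact: time_derivatives_bound sigma0 wa ua.
by move=> t x t01; exact: (time_analytic_series sigma0 wa ua x t01).
Qed.
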